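(* For every conical complex $\Sigma$ there exists a canonical desingularization $\Sigma'$ of $\Sigma$, that is, a sequence of star subdivisions $(\Sigma_i)_{i=0}^n$ of $\Sigma$ such that $\Sigma_0=\Sigma$ and $\Sigma_n=\Sigma'$ is regular. Moreover: (1) All the centers are in $|\mathrm{sing}(\Sigma)|$, where $\mathrm{sing}(\Sigma)$ is the subset of all irreducible singular faces of $\Sigma$. The centers are in the relative interiors of irreducible faces of the intermediate subdivisions. (2) The centers of the consecutive star subdivisions are either sets of minimal points or sets of canonical barycenters of irreducible faces. (3) The subdivision does not affect the set $\mathrm{Reg}(\Sigma)$ of all the regular cones. (4) The algorithm is functorial for regular local projections and local isomorphisms of complexes, in the sense that the centers transform functorially with the trivial subdivisions removed. In the case of surjective local isomorphisms, the centers of the star subdivisions transform functorially.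
   Context: Conical complex: a finite partially ordered set $\Sigma$ of finitely generated strictly convex rational cones $\sigma$, each of maximal dimension in its space $N_\sigma^{\mathbb Q}=N_\sigma\otimes\mathbb Q$ ($N_\sigma$ a lattice), such that for $\tau\preceq\sigma$ there is a linear injection $i_{\tau,\sigma}\colon\tau\to\sigma$ onto a face of $\sigma$, with $i_{\tau,\sigma}(N_\tau)$ saturated in $N_\sigma$; every face of $\sigma$ arises this way; and $i_{\tau\delta}=i_{\sigma\delta}i_{\tau\sigma}$ for $\tau\preceq\sigma\preceq\delta$. The support $|\Sigma|$ is the gluing of the cones along the $i_{\tau\sigma}$; it is the disjoint union of the relative interiors $\mathrm{int}(\sigma)$. For a subset $\Sigma_0\subset\Sigma$, $|\Sigma_0|=\bigcup_{\sigma\in\Sigma_0}\mathrm{int}(\sigma)$. Vertices of $\sigma$ are the primitive integral vectors on its rays. A cone is regular if generated by part of a basis of its lattice, singular otherwise; $\Sigma$ is regular if all cones are. A cone is irreducible (singular) if it cannot be written as $\tau\times\sigma_1$ with $\sigma_1$ a (nonzero) regular cone. A minimal point (vector) of $\sigma$ is a nonzero integral vector of $\sigma$ which is not a vertex and is not a sum of two nonzero integral vectors of $\sigma$. A minimal internal vector of $\sigma$ is an integral vector in $\mathrm{int}(\sigma)$ which is not a sum of two nonzero integral vectors of $\sigma$ at least one of which lies in $\mathrm{int}(\sigma)$. The canonical barycenter of $\sigma$ is the sum of all its minimal internal vectors. Star subdivision: $\mathrm{Star}(\tau,\Sigma)=\{\sigma:\tau\preceq\sigma\}$, and $\mathrm{Link}(\tau,\Sigma)$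 is the set of faces of cones of $\mathrm{Star}(\tau,\Sigma)$ that do not belong to $\mathrm{Star}(\tau,\Sigma)$. For a vector $v\in\mathrm{int}(\tau)$ (taken primitive on its ray), $v\cdot\Sigma=(\Sigma\setminus\mathrm{Star}(\tau,\Sigma))\cup\{\langle v\rangle+\sigma:\sigma\in\mathrm{Link}(\tau,\Sigma)\}$. For a finite set $V=\{v_1,\dots,v_k\}$, $v_i\in\mathrm{int}(\tau_i)$ with disjoint stars $\mathrm{Star}(\tau_i,\Sigma)$, $V\cdot\Sigma=v_1\cdots v_k\cdot\Sigma$; $V$ is the center. Maps: a map of complexes $f\colon\Sigma\to\Sigma'$ assigns to each $\sigma$ a cone $\sigma'\in\Sigma'$ and a linear map $f_{\sigma,\sigma'}\colon\sigma\to\sigma'$ with $f(N_\sigma)\subseteq N_{\sigma'}$, $f(\mathrm{int}\,\sigma)\subset\mathrm{int}\,\sigma'$, compatible with faces. It is a local isomorphism if all $f_{\sigma,\sigma'}$ are isomorphisms, and a regular local projection if for each $\sigma$ there is a decomposition $\sigma=\sigma'\times\tau$ with $\tau$ regular for which $f_{\sigma,\sigma'}$ is the projection to the first factor. *)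

(* Defs.v *)
From HB Require Import structures.
From mathcomp Require Import all_boot all_order all_algebra.
From mathcomp Require Import finmap.
From mathcomp Require Import all_classical.

Set Implicit Arguments.
Unset Strict Implicit.
Unset Printing Implicit Defensive.

Import Order.TTheory GRing.Theory Num.Theory.
Local Open Scope classical_set_scope.
Local Open Scope ring_scope.

(** ** Rational cones

   A lattice of rank n is Z^n, the set of integral row vectors of Q^n.
   A cone is a set of vectors of Q^n, and need not span Q^n; its own lattice is
   the saturated sublattice [lattice C] of Z^n cut out by its linear span.
   For a cone of maximal dimension [lattice C] is Z^n. *)

Section Cones.
Variable n : nat.
Implicit Types (A B C F L : set 'rV[rat]_n) (s t : seq 'rV[rat]_n).
Implicit Types (v w x y : 'rV[rat]_n).

Definition integral : set 'rV[rat]_n := [set v | v \is a mxOver Num.int].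

Definition cone_gen s : set 'rV[rat]_n :=
  [set x | exists2 c : 'I_(size s) -> rat,
             (forall i, 0 <= c i) & x = \sum_i c i *: s`_i].

Definition ray v : set 'rV[rat]_n := cone_gen [:: v].

Definition rational_cone C : Prop :=
  exists2 s, (forall v, v \in s -> integral v) & C = cone_gen s.

Definition strictly_convex C : Prop := forall x, C x -> C (- x) -> x = 0.

Definition msum A B : set 'rV[rat]_n := [set x + y | x in A & y in B].

(* The linear span of a cone C is C - C. *)
Definition lspan C : set 'rV[rat]_n := [set x - y | x in C & y in C].

Definition lattice C : set 'rV[rat]_n := integral `&` lspan C.

Definition face F C : Prop :=
  exists2 u : 'cV[rat]_n, (forall x, C x -> 0 <= (x *m u) 0 0) &
    F = [set x | C x /\ (x *m u) 0 0 = 0].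

(* Topological interior of C in its linear span. *)
Definition relint C : set 'rV[rat]_n :=
  [set x | C x /\ exists2 e : rat, 0 < e &
     forall y, lspan C y -> (forall j, `|y 0 j| < e) -> C (x + y)].

Definition primitive v : Prop :=
  [/\ integral v, v != 0 &
      forall (k : nat) w, integral w -> v = w *+ k -> k = 1%N].

Definition primitive_on_ray w v : Prop :=
  primitive v /\ exists2 k : nat, (0 < k)%N & w = v *+ k.

Definition vertex C v : Prop := primitive v /\ face (ray v) C.

Definition zbasis s L : Prop :=
  free s /\
  L = [set x | exists c : 'I_(size s) -> int, x = \sum_i (c i)%:~R *: s`_i].

Definition regular C : Prop :=
  exists s t, zbasis (s ++ t) (lattice C) /\ C = cone_gen s.

(* C = A x B, as cones with lattices. *)
Definition is_product C A B : Prop :=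
  [/\ rational_cone A, rational_cone B, C = msum A B,
      lspan A `&` lspan B = [set 0] &
      lattice C = msum (lattice A) (lattice B)].

Definition irreducible C : Prop :=
  ~ exists A B, [/\ is_product C A B, regular B & B <> [set 0]].

Definition minimal_point C : set 'rV[rat]_n :=
  [set v | [/\ C v, integral v, v != 0, ~ vertex C v &
     ~ exists x y, [/\ C x, integral x & x != 0] /\
                   [/\ C y, integral y, y != 0 & v = x + y]]].

Definition minimal_internal C : set 'rV[rat]_n :=
  [set v | [/\ relint C v, integral v &
     ~ exists x y, [/\ relint C x, integral x & x != 0] /\
                   [/\ C y, integral y, y != 0 & v = x + y]]].

(* The set [minimal_internal C] is finite for every strictly convex rational
   cone C, so that this is an honest sum. *)
Definition barycenter C : 'rV[rat]_n := \sum_(v \in minimal_internal C) v.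

End Cones.
Arguments integral : clear implicits.

Definition saturated n (L M : set 'rV[rat]_n) : Prop :=
  L `<=` M /\
  forall (y : 'rV[rat]_n) (k : nat), M y -> (0 < k)%N -> L (y *+ k) -> L y.

Definition lin m n (A : 'M[rat]_(m, n)) (x : 'rV[rat]_m) : 'rV[rat]_n := x *m A.

(** ** Conical complexes *)

(* [cinc t s] is the matrix of the face inclusion i_{t,s}; it is meaningful only
   when t <= s.  The uniqueness in [cfaces] is what makes the support the disjoint
   union of the relative interiors. *)
Record conical_complex := ConicalComplex {
  cdisp : Order.disp_t;
  cidx :> finPOrderType cdisp;
  crk : cidx -> nat;
  cone : forall s : cidx, set 'rV[rat]_(crk s);
  cinc : forall t s : cidx, 'M[rat]_(crk t, crk s);
  cone_rational : forall s, rational_cone (@cone s);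
  cone_strictly_convex : forall s, strictly_convex (@cone s);
  cone_full_dim : forall s, lspan (@cone s) = setT;
  cinc_inj : forall t s : cidx, (t <= s)%O -> injective (lin (cinc t s));
  cinc_face : forall t s : cidx, (t <= s)%O ->
    face (lin (cinc t s) @` @cone t) (@cone s);
  cinc_saturated : forall t s : cidx, (t <= s)%O ->
    saturated (lin (cinc t s) @` integral (crk t)) (integral (crk s));
  cfaces : forall (s : cidx) (F : set 'rV[rat]_(crk s)), face F (@cone s) ->
    exists! t : cidx, (t <= s)%O /\ F = lin (cinc t s) @` @cone t;
  cinc_comp : forall t s d : cidx, (t <= s)%O -> (s <= d)%O ->
    cinc t d = cinc t s *m cinc s d
}.
Arguments cone {_} s : rename.
Arguments cinc {_} t s : rename.

(* A point of |S| is the pair (s, v) formed by the unique cone s with v in int s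
   and by the vector v. *)
Definition cpoint (S : conical_complex) : Type := {s : S & 'rV[rat]_(crk s)}.
HB.instance Definition _ (S : conical_complex) := Choice.on (cpoint S).

Definition support_of (S : conical_complex) (S0 : set S) : set (cpoint S) :=
  [set p | S0 (tag p) /\ relint (cone (tag p)) (tagged p)].

Definition support (S : conical_complex) : set (cpoint S) := support_of setT.
Arguments support : clear implicits.

Definition Reg (S : conical_complex) : set S := [set s | regular (cone s)].
Arguments Reg : clear implicits.

Definition sing (S : conical_complex) : set S :=
  [set s | irreducible (cone s) /\ ~ regular (cone s)].
Arguments sing : clear implicits.

(** ** Subdivisions

   All iterated star subdivisions of S share the support |S|.  A cone of such a
   subdivision is recorded as a pair (s, C) where s is the smallest cone of S
   containing it, i.e. C is a cone in Q^(crk s) with int C in int s.  A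
   subdivision is a set of such pairs: its order is [cell_face], the lattice of
   (s, C) is [lattice C], and its face inclusions are the restrictions of the
   maps [cinc]. *)

Section Subdivisions.
Variable S : conical_complex.

Definition cell : Type := {s : S & set 'rV[rat]_(crk s)}.

Definition to_cell (s : S) : cell := existT _ s (cone s).

Definition cells_of : set cell := range to_cell.

Implicit Types (K : set cell) (p : cpoint S) (c d e t : cell).

Definition cell_points c (A : set 'rV[rat]_(crk (tag c))) : set (cpoint S) :=
  [set existT _ (tag c) v | v in A].

Definition cell_int c : set (cpoint S) := cell_points (relint (tagged c)).

Definition cell_face c d : Prop :=
  (tag c <= tag d)%O /\
  face (lin (cinc (tag c) (tag d)) @` tagged c) (tagged d).

Definition Star t K : set cell := [set c | K c /\ cell_face t c].

Definition Link t K : set cell :=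
  [set c | [/\ K c, (exists2 d, Star t K d & cell_face c d) & ~ Star t K c]].

(* e is the cone <p> + c, formed inside d.  The cone d has to be mentioned: in a
   complex that is not a fan, the cell containing p in its interior and c may be
   faces of several cones that have no common face containing both of them.
   The second condition says that [tag e] is the smallest cone of S containing e;
   hence e is determined by p, c, d. *)
Definition is_join p c d e : Prop :=
  [/\ (tag e <= tag d)%O,
      relint (tagged e) `<=` relint (cone (tag e)) &
      lin (cinc (tag e) (tag d)) @` tagged e =
        msum (ray (lin (cinc (tag p) (tag d)) (tagged p)))
             (lin (cinc (tag c) (tag d)) @` tagged c)].

Definition star_at t p K : set cell :=
  (K `\` Star t K) `|`
  [set e | exists c d, [/\ Link t K c, Star t K d, cell_face c d & is_join p c d e]].

(* p . K: there is exactly one cell t of K with p in int t. *)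
Definition star_subdivision p K : set cell :=
  [set e | exists t, [/\ K t, cell_int t p & star_at t p K e]].

Definition is_center K (V : set (cpoint S)) : Prop :=
  [/\ finite_set V,
      (forall p, V p ->
         primitive (tagged p) /\ exists2 t, K t & cell_int t p) &
      forall p q t u, V p -> V q -> p <> q -> K t -> K u ->
        cell_int t p -> cell_int u q -> Star t K `&` Star u K = set0].

(* V . K = v_1 ... v_k . K; for a center the order of the v_i is irrelevant since
   their stars are disjoint. *)
Definition center_subdivision K (V : set (cpoint S)) : set cell :=
  foldr star_subdivision K (fset_set V).

(* The i-th complex of the sequence of star subdivisions with centers Vs. *)
Definition subdivided (Vs : seq (set (cpoint S))) (i : nat) : set cell :=
  foldl center_subdivision cells_of (take i Vs).

Definition in_irreducible_face K p : Prop :=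
  exists2 c, K c /\ irreducible (tagged c) & cell_int c p.

Definition is_minimal_point K p : Prop :=
  exists2 c, K c & cell_points (minimal_point (tagged c)) p.

(* Barycenters are taken primitive on their rays, as every center of a star
   subdivision is. *)
Definition is_irreducible_barycenter K p : Prop :=
  exists2 c, K c /\ irreducible (tagged c) &
    cell_points [set v | primitive_on_ray (barycenter (tagged c)) v] p.

Definition regular_cells K : Prop := forall c, K c -> regular (tagged c).

End Subdivisions.

(** ** Maps of complexes *)

Record cmap (S S' : conical_complex) := CMap {
  fidx :> S -> S';
  fmx : forall s : S, 'M[rat]_(crk s, crk (fidx s));
  cmap_cone : forall s, lin (fmx s) @` cone s `<=` cone (fidx s);
  cmap_lattice : forall s, lin (fmx s) @` integral (crk s) `<=` integral _;
  cmap_int : forall s, lin (fmx s) @` relint (cone s) `<=` relint (cone (fidx s));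
  cmap_mono : forall t s : S, (t <= s)%O -> (fidx t <= fidx s)%O;
  cmap_faces : forall t s : S, (t <= s)%O ->
    cinc t s *m fmx s = fmx t *m cinc (fidx t) (fidx s)
}.

Section Maps.
Variables (S S' : conical_complex) (f : cmap S S').

Definition fpoint (p : cpoint S) : cpoint S' :=
  existT _ (f (tag p)) (lin (fmx f (tag p)) (tagged p)).

Definition surjective_cmap : Prop := support S' `<=` fpoint @` support S.

(* f restricts to an isomorphism, as cones with lattices, from the cone
   A in Q^(crk s) onto the cone f(s). *)
Definition iso_from (s : S) (A : set 'rV[rat]_(crk s)) : Prop :=
  [/\ {in lspan A &, injective (lin (fmx f s))},
      lin (fmx f s) @` A = cone (f s) &
      lin (fmx f s) @` lattice A = lattice (cone (f s))].

Definition iso_at (s : S) : Prop := iso_from (cone s).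

Definition local_isomorphism : Prop := forall s, iso_at s.

Definition regular_local_projection : Prop :=
  forall s, exists A B,
    [/\ is_product (cone s) A B, regular B, iso_from A &
        forall x, B x -> lin (fmx f s) x = 0].

(* Transform of a center.  If f is the projection s' x B -> s' near a cone, then a
   point v in int t', t' a face of s', transforms to (v, 0), which lies in the
   interior of the face t' x 0 of s' x B; this is the only face that f maps
   isomorphically onto t'.  For a local isomorphism this is the preimage of V'
   in the support. *)
Definition pullback (V' : set (cpoint S')) : set (cpoint S) :=
  [set p | [/\ support S p, iso_at (tag p) & V' (fpoint p)]].

End Maps.

Definition is_desingularization (S : conical_complex)
    (Vs : seq (set (cpoint S))) : Prop :=
  (forall i, (i < size Vs)%N -> is_center (subdivided Vs i) (nth set0 Vs i)) /\
  regular_cells (subdivided Vs (size Vs)).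

(* Main.v *)
From HB Require Import structures.
Require Import Defs.
From mathcomp Require Import all_boot all_order all_algebra.
From mathcomp Require Import finmap.
From mathcomp Require Import all_classical.
From mathcomp Require Import ring lra.

(** The centers are chosen in two stages, each of which depends on the complex only.

    In the first stage, for k descending from the largest rank, the complex is
    subdivided at the barycenters of its irreducible singular cones of rank k.  A
    cone is the product of its largest irreducible face and of a regular cone, so two
    irreducible singular cones of the largest remaining rank never lie in a common
    remaining cone ([max_sing_unique]), and their stars are disjoint.  At the end each cone is
    the join of barycenters with an original cone that has no irreducible singular
    face, hence is regular ([no_sing_regular]): all cones are simplicial, and the
    generators that are not points of earlier centers form part of a basis of the
    lattice ([phase1_simplicial]).

    In the second stage the complex is subdivided at minimal points.  A cone contains
    at most one point of each earlier center, so its generators outside the regular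
    part are ordered by the time of their creation, and this makes a canonical choice
    possible.  Minimal points have coordinates in [0, 1); two of them in a common cone
    with the same coordinates along the earlier centers differ by an integral vector
    whose coordinates lie in (-1, 1) along part of a basis and vanish elsewhere, so
    they are equal ([next_separated]).  Hence the minimal points whose coordinates are
    lexicographically largest have disjoint stars.  Subdividing at one of them
    replaces a simplex by simplices whose volumes are multiplied by its coordinates,
    so the process stops ([step_terminates]), and a complex without minimal points is
    regular ([cand_exists]).

    All centers lie in irreducible cones of the original complex: neither irreducible
    barycenters nor minimal points have a component along a regular factor, so every
    subdivision on the way is compatible with the product decompositions of the
    original cones ([loc_splits], [cand_irreducible]).  These cones are singular since
    a regular cone has no irreducible singular face and is never subdivided
    ([loc_regular]).

    For functoriality, a local isomorphism or regular local projection is an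
    isomorphism on every irreducible cone, hence wherever there are centers, and
    identifies the fans induced on such a cone and on its image ([loc_pullback]).  It
    therefore matches minimal points and their coordinates.  The selection only
    compares coordinates along the earlier centers in their order, and a center with
    empty pullback contributes nothing to it, so it can be dropped
    ([next_pullback], [next_nonempty_centers]).

    Throughout, a subdivision is described by the family of fans that it induces on
    the cones of the complex; [center_cells] shows that star subdivisions of the
    complex are star subdivisions of these fans. *)

Set Implicit Arguments.
Unset Strict Implicit.
Unset Printing Implicit Defensive.

Import Order.TTheory GRing.Theory Num.Theory.
Local Open Scope classical_set_scope.
Local Open Scope ring_scope.

(** * Finitely generated cones *)

Definition ev n (u : 'cV[rat]_n) (x : 'rV[rat]_n) : rat := (x *m u) 0 0.

Section Ev.
Variable n : nat.
Implicit Types (u w : 'cV[rat]_n) (x y : 'rV[rat]_n).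

Lemma evD u x y : ev u (x + y) = ev u x + ev u y.
Proof. by rewrite /ev mulmxDl mxE. Qed.

Lemma evN u x : ev u (- x) = - ev u x.
Proof. by rewrite /ev mulNmx mxE. Qed.

Lemma evB u x y : ev u (x - y) = ev u x - ev u y.
Proof. by rewrite evD evN. Qed.

Lemma evZ u a x : ev u (a *: x) = a * ev u x.
Proof. by rewrite /ev -scalemxAl mxE. Qed.

Lemma ev0 u : ev u 0 = 0.
Proof. by rewrite /ev mul0mx mxE. Qed.

Lemma ev0u x : ev 0 x = 0.
Proof. by rewrite /ev mulmx0 mxE. Qed.

Lemma evDu u w x : ev (u + w) x = ev u x + ev w x.
Proof. by rewrite /ev mulmxDr mxE. Qed.

Lemma evNu u x : ev (- u) x = - ev u x.
Proof. by rewrite /ev mulmxN mxE. Qed.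

Lemma evZu a u x : ev (a *: u) x = a * ev u x.
Proof. by rewrite /ev -scalemxAr mxE. Qed.

Lemma ev_sum I (r : seq I) (P : pred I) (F : I -> 'rV[rat]_n) u :
  ev u (\sum_(i <- r | P i) F i) = \sum_(i <- r | P i) ev u (F i).
Proof. by rewrite /ev mulmx_suml summxE. Qed.

Lemma ev_sumu I (r : seq I) (P : pred I) (F : I -> 'cV[rat]_n) x :
  ev (\sum_(i <- r | P i) F i) x = \sum_(i <- r | P i) ev (F i) x.
Proof. by rewrite /ev mulmx_sumr summxE. Qed.

End Ev.

Definition evE := (evD, evN, evB, evZ, ev0, ev0u, evDu, evNu, evZu).

Lemma ev_mul m n (A : 'M[rat]_(m, n)) (u : 'cV_n) (x : 'rV_m) :
  ev u (x *m A) = ev (A *m u) x.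
Proof. by rewrite /ev mulmxA. Qed.

Section ConvexCones.
Variable n : nat.
Implicit Types (C D F : set 'rV[rat]_n) (s : seq 'rV[rat]_n) (u : 'cV[rat]_n).
Implicit Types (v x y : 'rV[rat]_n).

Definition cvx C : Prop :=
  [/\ C 0, forall x y, C x -> C y -> C (x + y) &
      forall a x, 0 <= a -> C x -> C (a *: x)].

Lemma cone_nil : cone_gen [::] = [set (0 : 'rV[rat]_n)].
Proof.
apply/seteqP; split=> x /=.
  by case=> c _ ->; rewrite big_ord0.
by move=> ->; exists (fun=> 0) => //; rewrite big_ord0.
Qed.

Lemma cone_consP v s x :
  cone_gen (v :: s) x <-> exists2 a, 0 <= a & cone_gen s (x - a *: v).
Proof.
split.
  case=> c c0 ->; exists (c ord0) => //.
  exists (fun i => c (lift ord0 i)) => //.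
  by rewrite big_ord_recl /= addrC addKr.
case=> a a0 [c c0 e].
exists (fun i : 'I_(size (v :: s)) => if unlift ord0 i is Some j then c j else a).
  by move=> i; case: (unlift _ _).
rewrite big_ord_recl /= unlift_none.
have -> : x = a *: v + (x - a *: v) by rewrite addrC subrK.
rewrite e; congr (_ + _).
by apply: eq_bigr => i _; rewrite liftK.
Qed.

Lemma cone_gen_ind (Q : set 'rV[rat]_n) s : cvx Q ->
  {in s, forall v, Q v} -> cone_gen s `<=` Q.
Proof.
move=> [Q0 QD QZ]; elim: s => [|v s IH] Qs x.
  by rewrite cone_nil => ->.
case/cone_consP=> a a0 h.
rewrite -(subrK (a *: v) x); apply: QD; last by apply/QZ/Qs/mem_head.
by apply: IH h => w ws; apply: Qs; rewrite inE ws orbT.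
Qed.

Lemma cvx_cone_gen s : cvx (cone_gen s).
Proof.
split.
- by exists (fun=> 0) => //; rewrite big1 // => i _; rewrite scale0r.
- move=> x y [c c0 ->] [d d0 ->]; exists (fun i => c i + d i).
    by move=> i; apply: addr_ge0.
  by rewrite -big_split; apply: eq_bigr => i _; rewrite scalerDl.
- move=> a x a0 [c c0 ->]; exists (fun i => a * c i).
    by move=> i; apply: mulr_ge0.
  by rewrite scaler_sumr; apply: eq_bigr => i _; rewrite scalerA.
Qed.

Lemma mem_cone_gen s v : v \in s -> cone_gen s v.
Proof.
elim: s => // w s IH; rewrite inE => /predU1P[->|/IH h]; apply/cone_consP.
  by exists 1 => //; rewrite scale1r subrr; case: (cvx_cone_gen s).
by exists 0 => //; rewrite scale0r subr0.
Qed.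

Lemma cone_sub s C : cvx C -> {in s, forall v, C v} -> cone_gen s `<=` C.
Proof. exact: cone_gen_ind. Qed.

Lemma eq_cone_gen s t : s =i t -> cone_gen s = cone_gen t.
Proof.
move=> e; apply/seteqP; split; apply: cone_sub; try exact: cvx_cone_gen.
  by move=> v; rewrite e; apply: mem_cone_gen.
by move=> v; rewrite -e; apply: mem_cone_gen.
Qed.

Lemma cone_subset s t : {subset s <= t} -> cone_gen s `<=` cone_gen t.
Proof.
move=> st; apply: cone_sub; first exact: cvx_cone_gen.
by move=> v /st; apply: mem_cone_gen.
Qed.

Lemma rayP v x : ray v x <-> exists2 a, 0 <= a & x = a *: v.
Proof.
rewrite /ray; split=> [/cone_consP[a a0]|[a a0 ->]].
  by rewrite cone_nil => /subr0_eq; exists a.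
by apply/cone_consP; exists a => //; rewrite cone_nil subrr.
Qed.

Lemma ray_self v : ray v v.
Proof. by apply/rayP; exists 1; rewrite ?scale1r. Qed.

Lemma cvx_ray v : cvx (ray v). Proof. exact: cvx_cone_gen. Qed.

Lemma cone_cons v s : cone_gen (v :: s) = msum (ray v) (cone_gen s).
Proof.
apply/seteqP; split=> x.
  case/cone_consP=> a a0 h; exists (a *: v); first by apply/rayP; exists a.
  by exists (x - a *: v) => //; rewrite addrC subrK.
case=> _ /rayP[a a0 ->] [y ys <-]; apply/cone_consP; exists a => //.
by rewrite addrC addKr.
Qed.

Lemma cone_cat s t : cone_gen (s ++ t) = msum (cone_gen s) (cone_gen t).
Proof.
elim: s => [|v s IH] /=.
  rewrite cone_nil; apply/seteqP; split=> x.
    by move=> h; exists 0 => //; exists x; rewrite ?add0r.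
  by case=> _ -> [y ht <-]; rewrite add0r.
rewrite !cone_cons IH; apply/seteqP; split=> x.
  case=> a av [_ [b bs [c ct <-]] <-]; exists (a + b); last by exists c; rewrite ?addrA.
  by exists a => //; exists b.
case=> _ [a av [b bs <-]] [c ct <-]; exists a => //.
by exists (b + c); rewrite ?addrA //; exists b => //; exists c.
Qed.

Lemma cvx_lspan C x : cvx C -> C x -> lspan C x.
Proof. by case=> C0 _ _ Cx; exists x => //; exists 0; rewrite ?subr0. Qed.

Lemma ev_ge0 s u : {in s, forall v, 0 <= ev u v} ->
  forall x, cone_gen s x -> 0 <= ev u x.
Proof.
move=> h; apply: (@cone_sub s (fun x => 0 <= ev u x)) => //.
split=> /=; rewrite ?ev0 //.
  by move=> x y; rewrite evD; apply: addr_ge0.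
by move=> a x; rewrite evZ; apply: mulr_ge0.
Qed.

(** A sum of nonnegative terms vanishes only if every term does. *)
Lemma face_filter s u : {in s, forall v, 0 <= ev u v} ->
  [set x | cone_gen s x /\ ev u x = 0] =
  cone_gen [seq v <- s | ev u v == 0].
Proof.
move=> h; apply/seteqP; split=> x.
  case; elim: s h x => [|v s IH] h x.
    by rewrite cone_nil => ->.
  case/cone_consP=> a a0 xs; rewrite -{1}(subrK (a *: v) x) evD evZ => e.
  have hs : {in s, forall w, 0 <= ev u w}.
    by move=> w ws; apply: h; rewrite inE ws orbT.
  have v0 : 0 <= ev u v by apply: h; rewrite mem_head.
  have := ev_ge0 hs xs => e1.
  have e2 : 0 <= a * ev u v by apply: mulr_ge0.
  have /IH - /(_ hs) IHx : cone_gen s (x - a *: v) by [].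
  have e3 : ev u (x - a *: v) = 0 by lra.
  have /eqP : a * ev u v = 0 by lra.
  rewrite mulf_eq0 /= => /orP[/eqP az|->].
    move: (IHx e3); rewrite az scale0r subr0 => k.
    by case: ifP => _ //; apply/cone_consP; exists 0; rewrite ?scale0r ?subr0.
  by apply/cone_consP; exists a => //; apply: IHx.
move=> hx; split.
  by apply: cone_subset hx => v; rewrite mem_filter => /andP[].
move: x hx; apply: (@cone_sub _ (fun x => ev u x = 0)).
  split=> /=; rewrite ?ev0 //.
    by move=> x y; rewrite evD => -> ->; rewrite addr0.
  by move=> a x _; rewrite evZ => ->; rewrite mulr0.
by move=> v; rewrite mem_filter => /andP[/eqP].
Qed.

Lemma exists_between (lo hi : seq rat) :
  {in lo & hi, forall a b, a <= b} -> {in hi, forall b, 0 <= b} ->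
  exists2 c, 0 <= c & {in lo, forall a, a <= c} /\ {in hi, forall b, c <= b}.
Proof.
elim: lo => [|a lo IH] h h0; first by exists 0.
case: IH => // [x y xl yh|c c0 [cl ch]]; first by apply: h; rewrite // inE xl orbT.
exists (Num.max a c); first by rewrite le_max c0 orbT.
split=> x; last by move=> xh; rewrite ge_max ch // h ?mem_head.
by rewrite inE le_max => /predU1P[->|/cl ->]; rewrite ?lexx ?orbT.
Qed.

(** Fourier-Motzkin elimination: adding a generator [v] to a cone cut out by the
    inequalities [us] keeps those that are nonnegative on [v] and combines every
    remaining one with every strictly positive one so as to vanish on [v]. *)
Lemma cone_ineqs s : exists us : seq 'cV[rat]_n,
  forall x, cone_gen s x <-> {in us, forall u, 0 <= ev u x}.
Proof.
elim: s => [|v s [us IH]].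
  exists ([seq delta_mx j 0 | j : 'I_n] ++ [seq - delta_mx j 0 | j : 'I_n]) => x.
  rewrite cone_nil; split=> [-> u _|h]; first by rewrite ev0.
  have evd j : ev (delta_mx j 0) x = x 0 j by rewrite /ev -colE mxE.
  apply/rowP=> j; rewrite mxE; apply/eqP; rewrite eq_le; apply/andP; split.
    have := h (- delta_mx j 0); rewrite mem_cat evNu evd oppr_ge0; apply.
    by apply/orP; right; apply/mapP; exists j; rewrite ?mem_enum.
  have := h (delta_mx j 0); rewrite mem_cat evd; apply.
  by apply/orP; left; apply/mapP; exists j; rewrite ?mem_enum.
pose cmb u w := ev u v *: w - ev w v *: u.
exists ([seq u <- us | 0 <= ev u v] ++
        [seq cmb u w | u <- [seq u <- us | 0 < ev u v],
                       w <- [seq w <- us | ev w v < 0]]) => x; split.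
  case/cone_consP=> a a0 /IH h u; rewrite mem_cat => /orP[|/allpairsP[[u1 u2] /= []]].
    rewrite mem_filter => /andP[uv /h]; rewrite evB evZ => k.
    by have := mulr_ge0 a0 uv; lra.
  rewrite !mem_filter => /andP[p1 i1] /andP[p2 i2] ->.
  move: (h _ i1) (h _ i2); rewrite /cmb !evE => k1 k2.
  have := mulr_ge0 (ltW p1) k2; have p2' : 0 <= - ev u2 v by lra.
  have := mulr_ge0 p2' k1; nra.
move=> h; apply/cone_consP.
pose lo := [seq ev w x / ev w v | w <- us & ev w v < 0].
pose hi := [seq ev u x / ev u v | u <- us & 0 < ev u v].
have lo_hi u w : u \in us -> w \in us -> 0 < ev u v -> ev w v < 0 ->
    ev w x / ev w v <= ev u x / ev u v.
  move=> iu iw pu nw; have := h (cmb u w).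
  rewrite mem_cat orbC allpairs_f ?mem_filter ?pu ?nw // => /(_ isT).
  rewrite /cmb !evE => k; rewrite ler_ndivrMr // mulrAC ler_pdivrMr //; lra.
case: (@exists_between lo hi).
- move=> _ _ /mapP[w + ->] /mapP[u + ->]; rewrite !mem_filter => /andP[nw iw] /andP[pu iu].
  exact: lo_hi.
- move=> _ /mapP[u + ->]; rewrite mem_filter => /andP[pu iu]; apply: divr_ge0 (ltW pu).
  by apply: h; rewrite mem_cat mem_filter iu (ltW pu).
move=> a a0 [alo ahi]; exists a => //; apply/IH => u iu; rewrite evB evZ subr_ge0.
have [uv|uv|uv] := ltrgt0P (ev u v).
- by rewrite -ler_pdivlMr //; apply: ahi; apply/mapP; exists u; rewrite ?mem_filter ?uv.
- by rewrite -ler_ndivrMr //; apply: alo; apply/mapP; exists u; rewrite ?mem_filter ?uv.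
by rewrite uv mulr0; apply: h; rewrite mem_cat mem_filter iu uv lexx.
Qed.

End ConvexCones.

Section Faces.
Variable n : nat.
Implicit Types (C D F G : set 'rV[rat]_n) (s : seq 'rV[rat]_n) (u : 'cV[rat]_n).
Implicit Types (v x y : 'rV[rat]_n).

(** Integrality of the generators is left out, since the convex geometry of a cone does
    not see it. *)
Definition fgcone C : Prop := exists s, C = cone_gen s.

Lemma rational_fg C : rational_cone C -> fgcone C.
Proof. by case=> s _ ->; exists s. Qed.

Lemma fg_cvx C : fgcone C -> cvx C.
Proof. by case=> s ->; apply: cvx_cone_gen. Qed.

Lemma face_subset F C : face F C -> F `<=` C.
Proof. by case=> u _ -> x []. Qed.

Lemma face_refl C : face C C.
Proof.
exists 0 => [x _|]; first by rewrite mulmx0 mxE.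
by apply/seteqP; split=> [x Cx|x []] //; split; rewrite // mulmx0 mxE.
Qed.

Lemma face_extreme F C x y : face F C -> C x -> C y -> F (x + y) -> F x.
Proof.
case=> u h -> Cx Cy [_ e]; split=> //.
have := h _ Cx; have := h _ Cy; move: e; rewrite -!/(ev _ _) evD; lra.
Qed.

Lemma face_cvx F C : cvx C -> face F C -> cvx F.
Proof.
case=> C0 CD CZ [u h ->]; split.
- by split=> //; rewrite mul0mx mxE.
- move=> x y [Cx ex] [Cy ey]; split; first exact: CD.
  by rewrite -!/(ev _ _) evD /ev ex ey addr0.
- move=> a x a0 [Cx ex]; split; first exact: CZ.
  by rewrite -!/(ev _ _) evZ /ev ex mulr0.
Qed.

(** The functional can be kept. *)
Lemma face_restrict F C D : face F D -> F `<=` C -> C `<=` D -> face F C.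
Proof.
case=> u h -> FC CD; exists u => [x /CD|]; first exact: h.
by apply/seteqP; split=> x; [move=> Fx; split; [exact: FC|case: Fx]|case=> /CD].
Qed.

Lemma face_fg F C : fgcone C -> face F C -> fgcone F.
Proof.
case=> s -> [u h ->]; exists [seq v <- s | ev u v == 0].
by apply: face_filter => v vs; apply/h/mem_cone_gen.
Qed.

Lemma face_rational F C : rational_cone C -> face F C -> rational_cone F.
Proof.
case=> s si -> [u h ->]; exists [seq v <- s | ev u v == 0].
  by move=> v; rewrite mem_filter => /andP[_ /si].
by apply: face_filter => v vs; apply/h/mem_cone_gen.
Qed.

(** The points of the relative interior are the order units of the cone: a small
    positive multiple of any vector of the cone can be subtracted from them. In this
    form the relative interior is handled without reference to the metric. *)
Lemma relint_sub C x y : cvx C -> relint C x -> C y ->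
  exists2 e : rat, 0 < e & C (x - e *: y).
Proof.
move=> cC [Cx [e e0 h]] Cy.
pose M := 1 + \sum_j `|y 0 j|.
have M0 : 0 < M by apply: ltr_pwDl => //; apply: sumr_ge0.
exists (e / M); first exact: divr_gt0.
apply: h => [|j].
  case: cC => C0 _ CZ; exists 0 => //; exists ((e / M) *: y); last by rewrite sub0r.
  by apply: CZ => //; apply/ltW/divr_gt0.
rewrite !mxE normrN normrM (gtr0_norm (divr_gt0 e0 M0)) mulrAC ltr_pdivrMr //.
rewrite ltr_pM2l // /M (bigD1 j) //=.
have : 0 <= \sum_(i < n | i != j) `|y 0 i| by apply: sumr_ge0.
lra.
Qed.

End Faces.

Section RelativeInterior.
Variable n : nat.
Implicit Types (C D F G : set 'rV[rat]_n) (s : seq 'rV[rat]_n) (u : 'cV[rat]_n).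
Implicit Types (v x y : 'rV[rat]_n).

Lemma relint_subset C x : relint C x -> C x. Proof. by case. Qed.

Lemma cvx_sub_scale C x y (e a : rat) :
  cvx C -> 0 < e -> C x -> C y -> C (x - e *: y) -> a <= e -> C (x - a *: y).
Proof.
move=> [C0 CD CZ] e0 Cx Cy Ce ae.
have [a0|a0] := leP a 0.
  by rewrite -scaleNr; apply: CD => //; apply: CZ; rewrite ?oppr_ge0.
have -> : x - a *: y = (1 - a / e) *: x + (a / e) *: (x - e *: y).
  rewrite scalerBr scalerA divfK ?gt_eqF // addrA -scalerDl subrK scale1r //.
apply: CD; apply: CZ => //; last by apply/ltW/divr_gt0.
by rewrite subr_ge0 ler_pdivrMr ?mul1r.
Qed.

Lemma lspan_cone_gen s y : lspan (cone_gen s) y ->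
  exists c : 'I_(size s) -> rat, y = \sum_i c i *: s`_i.
Proof.
case=> _ [c _ ->] [_ [d _ ->] <-]; exists (fun i => c i - d i).
by rewrite -sumrB; apply: eq_bigr => i _; rewrite scalerBl.
Qed.

(** A vector of the span is a combination of the generators with coefficients bounded
    in terms of its entries, so a ball around an order unit is reached by moving a
    bounded distance along each of the finitely many generators. *)
Lemma relint_intro C x : fgcone C -> C x ->
  (forall y, C y -> exists2 e : rat, 0 < e & C (x - e *: y)) -> relint C x.
Proof.
move=> [s ->] Cx h; split=> //.
have cC := cvx_cone_gen s; have [C0 CD CZ] := cC.
have [e0 e0p he0] : exists2 e : rat, 0 < e &
    {in s, forall v, cone_gen s (x - e *: v)}.
  have : {subset s <= s} by [].
  move: {1 3}s; elim=> [_|v t IH st]; first by exists 1.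
  have [w wt|e e_gt0 he] := IH; first by apply: st; rewrite inE wt orbT.
  have vs : v \in s by apply: st; rewrite mem_head.
  have [e' e'0 he'] := h _ (mem_cone_gen vs).
  exists (Num.min e e'); first by rewrite lt_min e_gt0.
  move=> w; rewrite inE => /predU1P[->|wt].
    by apply: (cvx_sub_scale cC e'0) => //; [exact: mem_cone_gen|rewrite ge_min lexx orbT].
  apply: (cvx_sub_scale cC e_gt0) => //; [|exact: he|by rewrite ge_min lexx].
  by apply/mem_cone_gen/st; rewrite inE wt orbT.
pose k : rat := (size s).+1%:R.
have k0 : 0 < k by rewrite ltr0n.
pose A : 'M[rat]_(size s, n) := \matrix_(i < size s) s`_i.
pose P := pinvmx A.
pose M := 1 + \sum_i \sum_j `|P j i|.
have M0 : 0 < M by apply: ltr_pwDl => //; apply: sumr_ge0 => i _; apply: sumr_ge0.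
exists (e0 / k / M) => [|y ly yM]; first by rewrite !divr_gt0.
have yA : (y <= A)%MS.
  have [c ->] := lspan_cone_gen ly.
  apply: summx_sub => i _; apply: scalemx_sub.
  by have -> : s`_i = row i A by [rewrite rowK]; apply: row_sub.
pose d := y *m P.
have yE : y = \sum_i d 0 i *: s`_i.
  rewrite -(mulmxKpV yA) -/P -/d mulmx_sum_row.
  by apply: eq_bigr => i _; rewrite rowK.
have dle i : - d 0 i * k <= e0.
  have : `|d 0 i| <= e0 / k.
    rewrite mxE; apply: le_trans (ler_norm_sum _ _ _) _.
    apply: (@le_trans _ _ (\sum_j e0 / k / M * `|P j i|)).
      by apply: ler_sum => j _; rewrite normrM ler_wpM2r // ltW.
    rewrite -mulr_sumr mulrAC ler_pdivrMr // ler_wpM2l //.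
      exact/ltW/divr_gt0.
    rewrite /M [X in _ <= 1 + X](bigD1 i) //=.
    have : 0 <= \sum_(i0 < size s | i0 != i) \sum_j `|P j i0|.
      by apply: sumr_ge0 => ? _; apply: sumr_ge0.
    lra.
  rewrite ler_pdivlMr // => kd; apply: le_trans kd.
  by rewrite ler_wpM2r ?(ltW k0) //; have := ler_norm (- d 0 i); rewrite normrN.
have -> : x + y = k^-1 *: x + \sum_i k^-1 *: (x - (- d 0 i * k) *: s`_i).
  rewrite yE; under [in RHS]eq_bigr => i _.
    rewrite scalerBr scalerA mulrC -mulrA divff ?gt_eqF // mulr1 scaleNr opprK; over.
  rewrite big_split /= sumr_const card_ord addrA -mulrS -scaler_nat scalerA.
  by rewrite divff ?gt_eqF // scale1r.
apply: (CD); first by apply: (CZ) => //; rewrite invr_ge0 ltW.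
apply: (big_ind (cone_gen s)) => [//||i _]; first exact: CD.
apply: CZ; first by rewrite invr_ge0 ltW.
have si : s`_i \in s by apply: mem_nth.
apply: (cvx_sub_scale cC e0p) => //; [exact: mem_cone_gen|exact: he0].
Qed.

Lemma relint_face_sub C F D x : cvx C -> cvx D -> relint C x -> C `<=` D ->
  face F D -> F x -> C `<=` F.
Proof.
move=> cC cD rx CD fF Fx y Cy.
have [e e0 h] := relint_sub cC rx Cy.
have [_ _ CZ] := cC; have [_ _ FZ] := face_cvx cD fF.
have /(FZ e^-1) : F (e *: y).
  apply: (face_extreme (y := x - e *: y) fF).
  - by apply/CD/CZ => //; apply: ltW.
  - exact: CD.
  by rewrite addrC subrK.
by rewrite scalerA mulVf ?gt_eqF // scale1r; apply; rewrite invr_ge0 ltW.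
Qed.

(** The face is cut out by the sum of those defining inequalities of the cone that are
    equalities at [x]. *)
Lemma min_face C x : fgcone C -> C x -> exists2 F, face F C & relint F x.
Proof.
move=> fC Cx; have [s Cs] := fC.
have [us usP] := cone_ineqs s.
have us0 u y : u \in us -> C y -> 0 <= ev u y by move=> iu; rewrite Cs => /usP; apply.
pose U : 'cV[rat]_n := \sum_(u <- us | ev u x == 0) u.
have evU y : ev U y = \sum_(u <- us | ev u x == 0) ev u y by rewrite ev_sumu.
pose F := [set y | C y /\ (y *m U) 0 0 = 0].
have fF : face F C.
  exists U => // y Cy; rewrite -/(ev _ _) evU big_seq_cond.
  by apply: sumr_ge0 => u /andP[iu _]; apply: us0.
have Fx : F x.
  split=> //; rewrite -/(ev _ _) evU; apply: big1 => u /eqP //.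
exists F => //; apply: relint_intro => // [|y [Cy Uy]]; first exact: face_fg fF.
have yz u : u \in us -> ev u x = 0 -> ev u y = 0.
  move=> iu ux; move: Uy; rewrite -/(ev _ _) evU => /eqP.
  rewrite big_seq_cond psumr_eq0; last by move=> w /andP[iw _]; apply: us0.
  by move/allP=> /(_ u iu); rewrite iu ux eqxx => /eqP.
have [e e0 he] : exists2 e : rat, 0 < e & {in us, forall u, 0 <= ev u (x - e *: y)}.
  have : {subset us <= us} by [].
  move: {1 3}us; elim=> [_|u t IH st]; first by exists 1.
  have [w wt|e e_gt0 he] := IH; first by apply: st; rewrite inE wt orbT.
  have iu : u \in us by apply: st; rewrite mem_head.
  have [ux|ux] := eqVneq (ev u x) 0.
    exists e => // w; rewrite inE => /predU1P[->|/he //].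
    by rewrite evB evZ ux (yz _ iu ux) mulr0 subr0.
  have x0 : 0 < ev u x by rewrite lt0r ux us0.
  have y0 := us0 _ _ iu Cy.
  exists (Num.min e (ev u x / (1 + ev u y))).
    by rewrite lt_min e_gt0 divr_gt0 // ltr_pwDl.
  move=> w; rewrite inE evB evZ subr_ge0 => /predU1P[->|wt].
    apply: (@le_trans _ _ (ev u x / (1 + ev u y) * ev u y)).
      by rewrite ler_wpM2r // ge_min lexx orbT.
    rewrite mulrAC ler_pdivrMr ?ltr_pwDl // ler_wpM2l ?us0 //; lra.
  have := he _ wt; rewrite evB evZ subr_ge0; apply: le_trans.
  rewrite ler_wpM2r ?ge_min ?lexx // us0 //.
  by apply: st; rewrite inE wt orbT.
exists e => //; split; first by rewrite Cs; apply/usP.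
by rewrite -/(ev _ _) evB evZ [ev U y]Uy mulr0 subr0; case: Fx.
Qed.

Lemma relint_add C x y : fgcone C -> relint C x -> C y -> relint C (x + y).
Proof.
move=> fC rx Cy; have cC := fg_cvx fC; have [C0 CD CZ] := cC.
apply: relint_intro => // [|z Cz]; first by apply: CD => //; case: rx.
have [e e0 he] := relint_sub cC rx Cz; exists e => //.
by rewrite addrAC; apply: CD.
Qed.

Lemma relint_scale C x a : fgcone C -> relint C x -> 0 < a -> relint C (a *: x).
Proof.
move=> fC rx a0; have cC := fg_cvx fC; have [C0 CD CZ] := cC.
apply: relint_intro => // [|z Cz]; first by apply: CZ; [exact: ltW|case: rx].
have [e e0 he] := relint_sub cC rx Cz; exists (a * e); first exact: mulr_gt0.
by rewrite -scalerA -scalerBr; apply: CZ (ltW a0) _.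
Qed.

Lemma relint_sum_gens s : relint (cone_gen s) (\sum_(v <- s) v).
Proof.
have cC := cvx_cone_gen s; have [C0 CD CZ] := cC.
apply: relint_intro; first by exists s.
  by rewrite big_seq; apply: (big_ind (cone_gen s)) => [//|//|v]; apply: mem_cone_gen.
move=> y [c c0 ->].
pose M := 1 + \sum_i c i; have M0 : 0 < M by apply: ltr_pwDl => //; apply: sumr_ge0.
exists M^-1; first by rewrite invr_gt0.
rewrite (big_nth 0) big_mkord scaler_sumr -sumrB.
apply: (big_ind (cone_gen s)) => [//||i _]; first exact: CD.
rewrite scalerA -{1}[s`_i]scale1r -scalerBl.
apply: CZ; last exact/mem_cone_gen/mem_nth.
rewrite subr_ge0 mulrC ler_pdivrMr // mul1r /M (bigD1 i) //=.
have : 0 <= \sum_(i0 < size s | i0 != i) c i0 by apply: sumr_ge0.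
lra.
Qed.

Lemma relint_nonempty C : fgcone C -> exists x, relint C x.
Proof. by case=> s ->; eexists; apply: relint_sum_gens. Qed.

Lemma relint_ray_add C p x : fgcone C -> relint (msum (ray p) C) x ->
  exists2 a : rat, 0 < a & exists2 z, relint C z & x = a *: p + z.
Proof.
move=> [s ->] rx; have [z rz] := relint_nonempty (ex_intro _ s erefl).
have cC := cvx_cone_gen s; have [C0 CD CZ] := cC.
rewrite -cone_cons in rx.
have /(relint_sub (cvx_cone_gen _) rx) [e e0] : cone_gen (p :: s) (p + z).
  rewrite cone_cons; exists p; first exact: ray_self.
  by exists z => //; case: rz.
rewrite cone_cons => -[_ /rayP[b b0 ->] [y ys E]].
exists (b + e); first by rewrite ltr_wpDl.
exists (e *: z + y).
  by apply: relint_add => //; [exists s|apply: relint_scale => //; exists s].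
have -> : x = b *: p + y + e *: (p + z) by rewrite E subrK.
by rewrite scalerDr scalerDl -!addrA; congr (_ + _); rewrite addrCA [y + _]addrC.
Qed.

End RelativeInterior.

(** * Integral vectors *)

Section Integral.
Variable n : nat.
Implicit Types (C : set 'rV[rat]_n) (s : seq 'rV[rat]_n) (u : 'cV[rat]_n).
Implicit Types (v x y : 'rV[rat]_n).

Lemma integralP x : integral n x <-> forall j, x 0 j \is a Num.int.
Proof.
split=> [/mxOverP h j|h]; first exact: h.
by apply/mxOverP => i j; rewrite ord1.
Qed.

Lemma integral0 : integral n 0.
Proof. by apply/integralP => j; rewrite mxE rpred0. Qed.

Lemma integralD x y : integral n x -> integral n y -> integral n (x + y).
Proof.
move=> /integralP hx /integralP hy; apply/integralP => j.
by rewrite mxE rpredD.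
Qed.

Lemma integralZ a x : a \is a Num.int -> integral n x -> integral n (a *: x).
Proof.
by move=> ia /integralP hx; apply/integralP => j; rewrite mxE rpredM.
Qed.

Lemma integralB x y : integral n x -> integral n y -> integral n (x - y).
Proof.
move=> hx hy; apply: integralD => //; rewrite -scaleN1r.
by apply: integralZ => //; rewrite rpredN rpred1.
Qed.

Lemma integralMn x k : integral n x -> integral n (x *+ k).
Proof. by move=> hx; rewrite -scaler_nat; apply: integralZ. Qed.

Definition intu u : Prop := forall j, u j 0 \is a Num.int.

Lemma ev_int u x : intu u -> integral n x -> ev u x \is a Num.int.
Proof.
move=> hu /integralP hx; rewrite /ev mxE.
by apply: rpred_sum => j _; rewrite rpredM.
Qed.

Lemma intu_ev u : (forall x, integral n x -> ev u x \is a Num.int) -> intu u.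
Proof.
move=> h j; have -> : u j 0 = ev u (delta_mx 0 j) by rewrite /ev -rowE mxE.
by apply/h/integralP => i; rewrite mxE rpred_nat.
Qed.

Lemma scale_int_seq (r : seq rat) :
  exists2 k : nat, (0 < k)%N & {in r, forall a, a *+ k \is a Num.int}.
Proof.
elim: r => [|a r [k k0 h]]; first by exists 1%N.
exists (k * `|denq a|)%N; first by rewrite muln_gt0 k0 absz_gt0 denq_neq0.
have da : a *+ `|denq a| \is a Num.int.
  by rewrite -mulr_natr natr_absz gtr0_norm ?denq_gt0 // -numqE intr_int.
move=> b; rewrite inE => /predU1P[->|/h hb].
  by rewrite mulnC mulrnA rpredMn.
by rewrite mulrnA rpredMn.
Qed.

Lemma scale_integral x : exists2 k : nat, (0 < k)%N & integral n (x *+ k).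
Proof.
have [k k0 h] := scale_int_seq [seq x 0 j | j : 'I_n]; exists k => //.
apply/integralP => j; rewrite mulmxnE; apply: h.
by apply/mapP; exists j; rewrite ?mem_enum.
Qed.

Lemma scale_intu u : exists2 k : nat, (0 < k)%N & intu (u *+ k).
Proof.
have [k k0 h] := scale_int_seq [seq u j 0 | j : 'I_n]; exists k => // j.
by rewrite mulmxnE; apply: h; apply/mapP; exists j; rewrite ?mem_enum.
Qed.

Lemma finite_integral_bounded (M : nat) :
  finite_set [set x | integral n x /\ forall j, `|x 0 j| <= M%:R].
Proof.
pose g (f : {ffun 'I_n -> 'I_(M + M).+1}) : 'rV[rat]_n :=
  \row_j ((f j)%:R - M%:R).
apply: sub_finite_set (finite_image g (finite_finset (X := setT))).
move=> x [/integralP ix bx].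
exists [ffun j => inord (absz (Num.floor (x 0 j + M%:R)))] => //.
apply/rowP => j; rewrite mxE ffunE.
have := bx j; rewrite ler_norml => /andP[b1 b2].
have i0 : x 0 j + M%:R \is a Num.int by rewrite rpredD ?ix ?rpred_nat.
have p0 : 0 <= x 0 j + M%:R by lra.
have e : (absz (Num.floor (x 0 j + M%:R)))%:R = x 0 j + M%:R.
  by rewrite natr_absz ger0_norm ?floor_ge0 // floorK.
rewrite inordK ?e ?addrK // ltnS -(ler_nat rat) e natrD; lra.
Qed.

Lemma finite_integral_box s :
  finite_set [set x | integral n x /\ exists2 c : 'I_(size s) -> rat,
    (forall i, 0 <= c i <= 1) & x = \sum_i c i *: s`_i].
Proof.
pose B : rat := \sum_(i < size s) \sum_j `|s`_i 0 j|.
have B0 : 0 <= B by apply: sumr_ge0 => i _; apply: sumr_ge0.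
apply: sub_finite_set (finite_integral_bounded (Num.bound B)).
move=> x [ix [c c01 xE]]; split=> // j; apply: le_trans (ltW (archi_boundP B0)).
rewrite xE summxE; apply: le_trans (ler_norm_sum _ _ _) _.
apply: ler_sum => i _; rewrite mxE normrM.
have /andP[c0 c1] := c01 i; rewrite (ger0_norm c0).
apply: (@le_trans _ _ (1 * `|s`_i 0 j|)); first by rewrite ler_wpM2r.
by rewrite mul1r (bigD1 j) //= lerDl sumr_ge0.
Qed.

(** The sum of the inequalities that define the cone vanishes at a point of the cone only
    if its opposite belongs to the cone as well. *)
Lemma positive_functional C : fgcone C -> strictly_convex C ->
  exists2 u, intu u & forall x, C x -> x != 0 -> 0 < ev u x.
Proof.
move=> [s ->] sc; have [us usP] := cone_ineqs s.
pose U := \sum_(u <- us) u; have [k k0 hk] := scale_intu U.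
exists (U *+ k) => // x Cx x0; have /usP h := Cx.
rewrite -scaler_nat evZu mulr_gt0 ?ltr0n // lt0r ev_sumu.
rewrite big_seq sumr_ge0 ?andbT => [|w /h //].
rewrite psumr_eq0 => [|w /h //]; apply/negP => /allP e.
case/eqP: x0; apply: sc => //; apply/usP => w iw.
by have /implyP/(_ iw)/eqP ew := e w iw; rewrite evN ew oppr0.
Qed.

Lemma min_integral (Q : set 'rV[rat]_n) u : intu u -> Q !=set0 ->
  (forall x, Q x -> integral n x /\ 0 <= ev u x) ->
  exists2 x, Q x & forall y, Q y -> ev u x <= ev u y.
Proof.
move=> iu [x0 Qx0] hQ.
pose m x := absz (Num.floor (ev u x)).
have mE x : Q x -> (m x)%:R = ev u x.
  by case/hQ => ix ux; rewrite natr_absz ger0_norm ?floor_ge0 // floorK // ev_int.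
have ex : exists k, `[< exists2 x, Q x & m x = k >].
  by exists (m x0); apply/asboolP; exists x0.
case: (ex_minnP ex) => k /asboolP[x Qx <-] h; exists x => // y Qy.
rewrite -!mE // ler_nat; apply: h; apply/asboolP; by exists y.
Qed.

Lemma relint0 C x : fgcone C -> strictly_convex C -> relint C 0 -> C x -> x = 0.
Proof.
move=> fC sc r0 Cx; have cC := fg_cvx fC; have [_ _ CZ] := cC.
have [e e0 h] := relint_sub cC r0 Cx.
have : e *: x = 0 by apply: sc; [exact: CZ (ltW e0) Cx|rewrite -sub0r].
by move/eqP; rewrite scaler_eq0 gt_eqF // => /eqP.
Qed.

Lemma cone_gen_nonzero s : cone_gen [seq v <- s | v != 0] = cone_gen s.
Proof.
apply/seteqP; split; apply: cone_sub; try exact: cvx_cone_gen.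
  by move=> v; rewrite mem_filter => /andP[_ ]; apply: mem_cone_gen.
move=> v vs; have [->|v0] := eqVneq v 0; first by case: (cvx_cone_gen [seq v <- s | v != 0]).
by apply: mem_cone_gen; rewrite mem_filter v0.
Qed.

(** An interior vector in which some generator has a coefficient larger than 1 remains
    interior when that generator is subtracted. So minimal internal vectors have
    coefficients in [0, 1], which leaves finitely many. *)
Lemma minimal_internal_finite C : rational_cone C -> strictly_convex C ->
  finite_set (minimal_internal C).
Proof.
case=> s0 si0 ->; rewrite -cone_gen_nonzero; set s := [seq v <- s0 | _].
have si v : v \in s -> integral n v /\ v != 0.
  by rewrite mem_filter => /andP[v0 /si0].
move: s si => s si sc.
apply: sub_finite_set (finite_integral_box s) => x [rx ix dec]; split=> //.
have fC : fgcone (cone_gen s) by exists s.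
have [C0 CD CZ] := cvx_cone_gen s.
have sumE : \sum_(v <- s) v = \sum_(i < size s) s`_i by rewrite (big_nth 0) big_mkord.
have [e e0 [c c0 xE]] := relint_sub (cvx_cone_gen s) rx (relint_subset (relint_sum_gens s)).
have {}xE : x = \sum_i (c i + e) *: s`_i.
  rewrite -(subrK (e *: \sum_(v <- s) v) x) xE sumE scaler_sumr -big_split /=.
  by apply: eq_bigr => i _; rewrite scalerDl.
exists (fun i => c i + e) => // i; apply/andP; split; first exact: addr_ge0 (c0 i) (ltW e0).
rewrite leNgt; apply/negP => c1; apply: dec.
have ins : s`_i \in s by apply: mem_nth.
have [isi si0'] := si _ ins.
have ry : relint (cone_gen s) (x - s`_i).
  pose e' := Num.min e (c i + e - 1).
  have e'0 : 0 < e' by rewrite lt_min e0 subr_gt0.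
  have -> : x - s`_i = e' *: (\sum_(v <- s) v) +
      \sum_j (c j + e - (j == i)%:R - e') *: s`_j.
    rewrite xE sumE scaler_sumr -big_split /= (bigD1 i) //= addrAC [RHS](bigD1 i) //=.
    congr (_ + _); first by rewrite eqxx -scalerDl [e' + _]addrC subrK scalerBl scale1r.
    by apply: eq_bigr => j /negPf ->; rewrite subr0 -scalerDl [e' + _]addrC subrK.
  apply: relint_add => //; first by apply: relint_scale => //; apply: relint_sum_gens.
  exists (fun j => c j + e - (j == i)%:R - e') => // j; rewrite subr_ge0 ge_min.
  have [->|_] := eqVneq j i; first by rewrite lexx orbT.
  by rewrite subr0 lerDr c0.
exists (x - s`_i), s`_i; split.
  split=> //; first exact: integralB.
  apply/eqP => z; rewrite z in ry.
  by case/eqP: si0'; apply: relint0 ry (mem_cone_gen ins).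
by split=> //; [exact: mem_cone_gen|rewrite subrK].
Qed.

(** An interior integral vector with the smallest value under a positive functional
    cannot be decomposed. *)
Lemma minimal_internal_nonempty C : rational_cone C -> strictly_convex C ->
  minimal_internal C !=set0.
Proof.
move=> rC sc; have fC := rational_fg rC.
have [u iu pu] := positive_functional fC sc.
have u0 x : C x -> 0 <= ev u x.
  by move=> Cx; have [->|x0] := eqVneq x 0; rewrite ?ev0 // ltW // pu.
have [|x [rx ix]|x [rx ix] mx] := @min_integral [set x | relint C x /\ integral n x] u iu.
- case: rC => s si ->; exists (\sum_(v <- s) v); split; first exact: relint_sum_gens.
  by rewrite big_seq; apply: (big_ind (integral n)) => [|x y|v /si //];
    [exact: integral0|exact: integralD].
- by split=> //; apply: u0; case: rx.
exists x; split=> // -[y [z [[ry iy y0] [Cz iz z0 xE]]]].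
have := mx y (conj ry iy); have := pu z Cz z0; rewrite xE evD; lra.
Qed.

Lemma barycenterP C : rational_cone C -> strictly_convex C ->
  relint C (barycenter C) /\ integral n (barycenter C).
Proof.
move=> rC sc; have fC := rational_fg rC.
have fm := minimal_internal_finite rC sc.
have [x mx] := minimal_internal_nonempty rC sc.
rewrite /barycenter fsbig_finite //.
pose l := enum_fset (fset_set (minimal_internal C)); rewrite -/l.
have xl : x \in l by change (x \in fset_set (minimal_internal C)); rewrite in_fset_set // inE.
have h y : y \in l -> relint C y /\ integral n y.
  move=> yl; have : y \in fset_set (minimal_internal C) by [].
  by rewrite in_fset_set // inE => -[].
move: l h xl => l h xl.
elim: l h x xl {mx} => // y l IH h x _; rewrite big_cons.
have [ry iy] := h y (mem_head _ _).
case: l IH h => [|z l] IH h; first by rewrite big_nil /= addr0.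
have [|rz iz] := IH _ z (mem_head _ _); first by move=> w wl; apply: h; rewrite inE wl orbT.
by split; [apply: relint_add => //; exact: relint_subset rz|exact: integralD].
Qed.

(** The positive integers k for which v / k is integral are bounded by the absolute value
    of any nonzero entry of [v]; the largest one gives the primitive vector. *)
Lemma primitive_exists v : integral n v -> v != 0 -> exists w, primitive_on_ray v w.
Proof.
move=> iv v0.
have [j vj] : exists j, v 0 j != 0.
  apply: contrapT => h; case/eqP: v0; apply/rowP => j; rewrite mxE.
  by apply: contrapT => /eqP vj; apply: h; exists j.
pose Q k := `[< exists2 w, integral n w & v = w *+ k >].
have ex : exists k, Q k by exists 1%N; apply/asboolP; exists v.
have Qk k : Q k -> (k <= Num.bound (v 0%R j))%N.
  case/asboolP=> w /integralP iw e; rewrite -(ler_nat rat).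
  apply: (@le_trans _ _ `|v 0 j|); last first.
    rewrite ltW // /Num.bound; have := archi_boundP (normr_ge0 (v 0 j)).
    by rewrite /Num.bound normr_id.
  move: vj; rewrite e mulmxnE -[w 0 j *+ k]mulr_natr mulf_eq0 negb_or => /andP[w0 _].
  rewrite normrM normr_nat ler_peMl //.
  by rewrite norm_intr_ge1.
case: (ex_maxnP ex Qk) => k /asboolP[w iw vE] mk.
have k0 : (0 < k)%N by rewrite lt0n; apply: contraNneq v0 => k0; rewrite vE k0 mulr0n.
exists w; split; last by exists k.
split=> //; first by apply: contraNneq v0 => w0; rewrite vE w0 mul0rn.
move=> k' w' iw' wE.
have k'0 : (0 < k')%N.
  by rewrite lt0n; apply: contraNneq v0 => z; rewrite vE wE z mulr0n mul0rn.
have /mk : Q (k' * k)%N by apply/asboolP; exists w' => //; rewrite mulrnA -wE.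
rewrite -{2}[k]mul1n leq_pmul2r // => k'1.
by apply/eqP; rewrite eqn_leq k'1.
Qed.

(** By a Bezout relation between the numerator and the denominator d of [a], the vector
    v / d is integral, whence d = 1. *)
Lemma primitive_ray_int v x a : primitive v -> integral n x -> x = a *: v ->
  a \is a Num.int.
Proof.
move=> [iv v0 pv] ix xE; rewrite Qint_def.
have /coprimezP[[r t] /= rt] := coprime_num_den a.
have d0 : (denq a)%:~R != 0 :> rat by rewrite intr_eq0 denq_neq0.
pose w := r%:~R *: x + t%:~R *: v.
have iw : integral n w by apply: integralD; apply: integralZ; rewrite ?intr_int.
have vE : v = w *+ `|denq a|.
  rewrite -scaler_nat natr_absz gtr0_norm ?denq_gt0 // /w xE scalerA -scalerDl scalerA.
  rewrite -{1}[v]scale1r; congr (_ *: _).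
  have : (r * numq a + t * denq a)%:~R = 1 :> rat by rewrite rt.
  rewrite rmorphD !rmorphM /= numqE => e1; rewrite -[LHS]e1; ring.
by rewrite -(gtz0_abs (denq_gt0 a)) (pv _ _ iw vE).
Qed.

End Integral.

(** * Simplicial and regular cones *)

Lemma int_lt1 (a : rat) : a \is a Num.int -> 0 <= a -> a < 1 -> a = 0.
Proof. by case/intrP => m ->; rewrite ler0z ltrz1; case: m => [[|k]|k]. Qed.

Section Simplicial.
Variable n : nat.
Implicit Types (C : set 'rV[rat]_n) (s t : seq 'rV[rat]_n) (u : 'cV[rat]_n).
Implicit Types (v w x y : 'rV[rat]_n) (c d : 'rV[rat]_n -> rat).

(** Coefficients are indexed by vectors rather than by positions, so that passing to a
    sublist does not renumber them. *)
Definition comb s c : 'rV[rat]_n := \sum_(v <- s) c v *: v.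

Lemma comb_ord s c : comb s c = \sum_(i < size s) c s`_i *: s`_i.
Proof. by rewrite /comb (big_nth 0) big_mkord. Qed.

Lemma ord_comb s (a : 'I_(size s) -> rat) : uniq s ->
  exists2 c, forall i : 'I_(size s), c s`_i = a i & \sum_i a i *: s`_i = comb s c.
Proof.
move=> us; pose c v := if insub (index v s) is Some i then a i else 0.
have ca (i : 'I_(size s)) : c s`_i = a i.
  rewrite /c index_uniq //; case: insubP => [j _ e|]; last by rewrite ltn_ord.
  by congr a; apply: val_inj.
by exists c => //; rewrite comb_ord; apply: eq_bigr => i _; rewrite ca.
Qed.

Lemma eq_comb s c d : {in s, c =1 d} -> comb s c = comb s d.
Proof. by move=> e; apply: eq_big_seq => v vs; rewrite e. Qed.

Lemma combD s c d : comb s c + comb s d = comb s (fun v => c v + d v).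
Proof. by rewrite /comb -big_split; apply: eq_bigr => v _; rewrite scalerDl. Qed.

Lemma combB s c d : comb s c - comb s d = comb s (fun v => c v - d v).
Proof. by rewrite /comb -sumrB; apply: eq_bigr => v _; rewrite scalerBl. Qed.

Lemma combZ s c a : a *: comb s c = comb s (fun v => a * c v).
Proof. by rewrite /comb scaler_sumr; apply: eq_bigr => v _; rewrite scalerA. Qed.

Lemma comb_cat s t c : comb (s ++ t) c = comb s c + comb t c.
Proof. exact: big_cat. Qed.

Lemma comb_indic s v : uniq s -> v \in s -> comb s (fun w => (w == v)%:R) = v.
Proof.
move=> us vs; rewrite /comb (bigD1_seq v) //= eqxx scale1r big1 ?addr0 //.
by move=> w /negPf ->; rewrite scale0r.
Qed.

Lemma comb_filter (P : pred 'rV[rat]_n) s c :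
  {in s, forall v, ~~ P v -> c v = 0} -> comb s c = comb [seq v <- s | P v] c.
Proof.
move=> h; rewrite /comb big_filter [RHS]big_mkcond /=; apply: eq_big_seq => v vs.
by case: ifP => // /negbT /h -> //; rewrite scale0r.
Qed.

Lemma cone_gen_comb s c : {in s, forall v, 0 <= c v} -> cone_gen s (comb s c).
Proof.
move=> c0; exists (fun i => c s`_i); last exact: comb_ord.
by move=> i; apply/c0/mem_nth.
Qed.

Lemma cone_gen_combP s x : uniq s -> cone_gen s x ->
  exists2 c, {in s, forall v, 0 <= c v} & x = comb s c.
Proof.
move=> us [a a0 ->]; have [c ca ->] := ord_comb a us; exists c => // v vs.
have vi : (index v s < size s)%N by rewrite index_mem.
by rewrite -(nth_index 0 vs) (ca (Ordinal vi)).
Qed.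

Lemma comb_span s c : comb s c \in <<s>>%VS.
Proof.
rewrite /comb big_seq; apply: memv_suml => v vs; apply: memvZ; exact: memv_span.
Qed.

Lemma span_comb s x : uniq s -> x \in <<s>>%VS -> exists c, x = comb s c.
Proof.
move=> us xs; have xE := @coord_span _ _ _ (in_tuple s) x xs.
have [c _ e] := ord_comb (fun i => coord (in_tuple s) i x) us.
by exists c; rewrite -e.
Qed.

Lemma cone_gen_span s x : cone_gen s x -> x \in <<s>>%VS.
Proof.
case=> a _ ->; apply: memv_suml => i _; apply: memvZ; apply: memv_span.
exact: mem_nth.
Qed.

Lemma lspan_span s : lspan (cone_gen s) = [set x | x \in <<s>>%VS].
Proof.
apply/seteqP; split=> x /=.
  by case=> y /cone_gen_span hy [z /cone_gen_span hz <-]; apply: memvB.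
move=> xs; rewrite (@coord_span _ _ _ (in_tuple s) x xs) /=.
pose a i := coord (in_tuple s) i x.
exists (\sum_(i < size s) Num.max (a i) 0 *: s`_i).
  by exists (fun i => Num.max (a i) 0) => // i; rewrite le_max lexx orbT.
exists (\sum_(i < size s) (Num.max (a i) 0 - a i) *: s`_i).
  exists (fun i => Num.max (a i) 0 - a i) => // i.
  by rewrite subr_ge0 le_max lexx.
by rewrite -sumrB; apply: eq_bigr => i _; rewrite -scalerBl subKr.
Qed.

Lemma linear_form_ev (phi : {linear 'rV[rat]_n -> rat^o}) :
  exists u, forall x, ev u x = phi x.
Proof.
exists (\col_j phi (delta_mx 0 j)) => x.
rewrite /ev mxE [in RHS](row_sum_delta x) linear_sum; apply: eq_bigr => j _.
by rewrite mxE linearZ.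
Qed.

Lemma dual_free s v : free s -> v \in s ->
  exists u, ev u v = 1 /\ {in s, forall w, w != v -> ev u w = 0}.
Proof.
move=> fs vs; have vi : (index v s < size s)%N by rewrite index_mem.
have [u uE] := linear_form_ev (coord (in_tuple s) (Ordinal vi)).
have e w : w \in s -> ev u w = (index w s == index v s)%:R.
  move=> ws; have wi : (index w s < size s)%N by rewrite index_mem.
  rewrite uE -[w in LHS](nth_index 0 ws).
  exact: (@coord_free _ _ _ (in_tuple s) (Ordinal wi) (Ordinal vi) fs).
exists u; split; first by rewrite e // eqxx.
move=> w ws wv; rewrite e //; case: eqP => // /(congr1 (nth 0 s)).
by rewrite !nth_index // => /eqP; rewrite (negPf wv).
Qed.

Lemma ev_comb u s c : ev u (comb s c) = \sum_(w <- s) c w * ev u w.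
Proof. by rewrite ev_sum; apply: eq_bigr => w _; rewrite evZ. Qed.

Lemma ev_dual_comb s v u c : uniq s -> v \in s -> ev u v = 1 ->
  {in s, forall w, w != v -> ev u w = 0} -> ev u (comb s c) = c v.
Proof.
move=> us vs u1 u0; rewrite ev_comb (bigD1_seq v) //= u1 mulr1.
rewrite big_seq_cond big1 ?addr0 // => w /andP[ws wv].
by rewrite u0 // mulr0.
Qed.

Lemma free_comb_inj s c d : free s -> comb s c = comb s d -> {in s, c =1 d}.
Proof.
move=> fs e v vs; have us := free_uniq fs; have [u [u1 u0]] := dual_free fs vs.
by rewrite -(ev_dual_comb c us vs u1 u0) e (ev_dual_comb d us vs u1 u0).
Qed.

Lemma free_filter (P : pred 'rV[rat]_n) s : free s -> free [seq v <- s | P v].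
Proof.
have /permPl p := perm_filterC P s.
by rewrite -(perm_free p); apply: catl_free.
Qed.

Lemma free_cone_sc s : free s -> strictly_convex (cone_gen s).
Proof.
move=> fs x; have us := free_uniq fs.
case/(cone_gen_combP us) => c c0 -> /(cone_gen_combP us)[d d0 e].
have e0 : comb s (fun v => c v + d v) = comb s (fun=> 0).
  by rewrite -combD -e subrr /comb big1 // => v _; rewrite scale0r.
rewrite (@eq_comb _ _ (fun=> 0)); first by rewrite /comb big1 // => v _; rewrite scale0r.
move=> v vs; have := free_comb_inj fs e0 vs; have := c0 v vs; have := d0 v vs; lra.
Qed.

Lemma free_functional s (a : 'rV[rat]_n -> rat) : free s ->
  exists u, {in s, forall v, ev u v = a v}.
Proof.
move=> fs; have us := free_uniq fs.
have : {subset s <= s} by [].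
have : uniq s by [].
move: {1 2 4}s; elim=> [_ _|v t IH /= /andP[vt ut] st]; first by exists 0.
have vs : v \in s by apply: st; rewrite mem_head.
have [w wt|u hu] := IH ut; first by apply: st; rewrite inE wt orbT.
have [u1 [e1 e0]] := dual_free fs vs.
exists (u + (a v - ev u v) *: u1) => w; rewrite inE evDu evZu => /predU1P[->|wt].
  by rewrite e1 mulr1 addrC subrK.
rewrite e0 ?mulr0 ?addr0 ?hu //; first by apply: st; rewrite inE wt orbT.
by apply: contraNneq vt => <-.
Qed.

Lemma free_ray_face s v : free s -> v \in s -> face (ray v) (cone_gen s).
Proof.
move=> fs vs; have us := free_uniq fs.
have [u uE] := free_functional (fun w => (w != v)%:R) fs.
have u0 w : w \in s -> 0 <= ev u w by move=> /uE ->; apply: ler0n.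
exists u; first exact: (ev_ge0 u0).
rewrite /ray.
have -> : [:: v] = [seq w <- s | ev u w == 0].
  rewrite -(filter_pred1_uniq us vs).
  by apply: eq_in_filter => w /uE ->; rewrite /=; case: eqP.
exact/esym/face_filter.
Qed.

(** ** Unimodular families *)

(** For a family of integral vectors this is being part of a basis of the integral
    lattice of its span. *)
Definition unimod s : Prop :=
  [/\ free s, {in s, forall v, integral n v} &
      forall c, integral n (comb s c) -> {in s, forall v, c v \is a Num.int}].

Lemma integral_comb s c : {in s, forall v, integral n v} ->
  {in s, forall v, c v \is a Num.int} -> integral n (comb s c).
Proof.
move=> si ci; rewrite /comb big_seq; apply: (big_ind (integral n)).
- exact: integral0.
- exact: integralD.
by move=> v vs; apply: integralZ; [apply: ci|apply: si].
Qed.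

Lemma unimod_filter (P : pred 'rV[rat]_n) s : unimod s -> unimod [seq v <- s | P v].
Proof.
move=> [fs si h]; split.
- exact: free_filter.
- by move=> v; rewrite mem_filter => /andP[_ /si].
move=> c ic v; rewrite mem_filter => /andP[Pv vs].
pose d w := if P w then c w else 0.
have e : comb [seq v <- s | P v] c = comb s d.
  rewrite [RHS](@comb_filter P) => [|w _ /negPf]; last by rewrite /d => ->.
  by apply: eq_comb => w; rewrite mem_filter /d => /andP[->].
by rewrite e in ic; have := h _ ic v vs; rewrite /d Pv.
Qed.

Lemma regularP C : regular C <-> exists2 s, unimod s & C = cone_gen s.
Proof.
split.
  case=> s [t [[fst lat] CE]]; exists s => //.
  have fs := catl_free fst; have us := free_uniq fs.
  have inlat x : integral n x -> x \in <<s>>%VS -> lattice C x.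
    by move=> ix xs; split=> //; rewrite CE lspan_span.
  split=> //.
    move=> v vs.
    have : lattice C v.
      rewrite lat; pose k := index v (s ++ t).
      have kl : (k < size (s ++ t))%N by rewrite index_mem mem_cat vs.
      exists (fun i => (i == Ordinal kl)%:R).
      rewrite (bigD1 (Ordinal kl)) //= eqxx scale1r big1 ?addr0.
        by rewrite nth_index // mem_cat vs.
      by move=> i /negPf ->; rewrite scale0r.
    by case.
  move=> c ic v vs; have := inlat _ ic (comb_span s c); rewrite lat => -[a].
  have [d da ->] := ord_comb (fun i => (a i)%:~R : rat) (free_uniq fst) => E.
  pose c' w := if w \in s then c w else 0.
  have E2 : comb s c = comb (s ++ t) c'.
    rewrite comb_cat [comb t _]big_seq [X in _ + X]big1 ?addr0.
      by apply: eq_comb => w ws; rewrite /c' ws.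
    move=> w wt; rewrite /c' ifN ?scale0r //.
    apply: contraTN wt => ws.
    have := free_uniq fst; rewrite cat_uniq => /and3P[_ /hasPn h _].
    by apply/negP => /h; rewrite /= ws.
  have vst : v \in s ++ t by rewrite mem_cat vs.
  have := free_comb_inj fst (etrans (esym E2) E) vst; rewrite /c' vs => ->.
  have kl : (index v (s ++ t) < size (s ++ t))%N by rewrite index_mem.
  by rewrite -(nth_index 0 vst) (da (Ordinal kl)) intr_int.
case=> s [fs si h] CE; exists s, [::]; split=> //; rewrite cats0; split=> //.
have us := free_uniq fs.
apply/seteqP; split=> x.
  case=> ix; rewrite CE lspan_span => /(span_comb us)[c xE].
  rewrite xE in ix; have hc := h _ ix.
  exists (fun i => Num.floor (c s`_i)).
  by rewrite xE comb_ord; apply: eq_bigr => i _; rewrite floorK // hc ?mem_nth.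
case=> a ->; have [c ca ->] := ord_comb (fun i => (a i)%:~R : rat) us.
split; last by rewrite CE lspan_span /= comb_span.
apply: integral_comb => // v vs.
have kl : (index v s < size s)%N by rewrite index_mem.
by rewrite -(nth_index 0 vs) (ca (Ordinal kl)) intr_int.
Qed.

(** ** Minimal points of simplicial cones *)

(** From a vector with a coefficient at least 1 the corresponding generator can be
    subtracted; the result is nonzero since the vector is not a vertex. *)
Lemma minimal_coef_lt1 s c : free s -> {in s, forall v, primitive v} ->
  {in s, forall v, 0 <= c v} -> minimal_point (cone_gen s) (comb s c) ->
  {in s, forall v, c v < 1}.
Proof.
move=> fs ps c0 [Cx ix x0 nv dec] v vs; have us := free_uniq fs.
rewrite ltNge; apply/negP => c1.
have [iv v0 _] := ps v vs.
have yE : comb s c - v = comb s (fun w => c w - (w == v)%:R).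
  by rewrite -combB comb_indic.
have [y0|y0] := eqVneq (comb s c - v) 0.
  apply: nv; rewrite (subr0_eq y0); split; first exact: ps.
  exact: free_ray_face.
apply: dec; exists v, (comb s c - v); split; first by split=> //; exact: mem_cone_gen.
split=> //; [|exact: integralB|by rewrite addrC subrK].
rewrite yE; apply: cone_gen_comb => w ws; rewrite subr_ge0.
by have [->|_] := eqVneq w v; [|apply: c0].
Qed.

Lemma ray_swap v x : v != 0 -> ray x v -> ray v x.
Proof.
move=> v0 /rayP[a a0 vE]; apply/rayP; exists a^-1; first by rewrite invr_ge0.
rewrite vE scalerA mulVf ?scale1r //; apply: contraNneq v0 => z.
by rewrite vE z scale0r.
Qed.

(** A vertex would be an integral multiple of one of the generators. *)
Lemma box_not_vertex s c : free s -> {in s, forall v, primitive v} ->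
  {in s, forall v, 0 <= c v < 1} -> integral n (comb s c) ->
  ~ vertex (cone_gen s) (comb s c).
Proof.
move=> fs ps c01 ix [px fr]; have us := free_uniq fs.
have [_ x0 _] := px.
have [v vs cv] : exists2 v, v \in s & c v != 0.
  apply: contrapT => h; case/eqP: x0; rewrite /comb big_seq big1 // => v vs.
  have [->|cv] := eqVneq (c v) 0; first by rewrite scale0r.
  by case: h; exists v.
have rv : ray (comb s c) v.
  have {}cv : 0 < c v by rewrite lt0r cv; case/andP: (c01 v vs).
  have h : ray (comb s c) (c v *: v).
    apply: (face_extreme (y := comb s c - c v *: v) fr).
    - by case: (cvx_cone_gen s) => _ _; apply; [exact: ltW|exact: mem_cone_gen].
    - have -> : comb s c - c v *: v = comb s (fun w => c w - c v * (w == v)%:R).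
        by rewrite -combB -combZ comb_indic.
      apply: cone_gen_comb => w ws; have [->|_] := eqVneq w v; first by rewrite mulr1 subrr.
      by rewrite mulr0 subr0; case/andP: (c01 w ws).
    by rewrite addrC subrK; apply: ray_self.
  have [_ _ /(_ (c v)^-1 (c v *: v))] := cvx_ray (comb s c).
  by rewrite scalerA mulVf ?gt_eqF // scale1r; apply; rewrite ?invr_ge0 1?ltW.
have [_ v0 _] := ps v vs; have /rayP[a a0 xE] := ray_swap v0 rv.
have ai := primitive_ray_int (ps v vs) ix xE.
have xE' : comb s c = comb s (fun w => a * (w == v)%:R).
  by rewrite -combZ comb_indic.
have /andP[_] := c01 v vs.
have := free_comb_inj fs xE' vs; rewrite eqxx mulr1 => e; rewrite e => a1.
have az := int_lt1 ai a0 a1.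
by rewrite e az eqxx in cv.
Qed.

(** A simplicial cone that is not regular has a nonzero integral vector with
    coordinates in [0, 1), namely the fractional part of an integral vector with
    some fractional coordinate; one with the smallest value under a positive
    functional is indecomposable. *)
Lemma singular_minimal_point s : free s -> {in s, forall v, primitive v} ->
  ~ unimod s -> minimal_point (cone_gen s) !=set0.
Proof.
move=> fs ps ns; have us := free_uniq fs.
have si v : v \in s -> integral n v by move=> /ps[].
have [u iu pu] := positive_functional (ex_intro _ s erefl) (free_cone_sc fs).
pose Q := [set x | integral n x /\ x != 0 /\
  exists2 c, {in s, forall v, 0 <= c v < 1} & x = comb s c].
have QC x : Q x -> cone_gen s x.
  by move=> [_ [_ [c c01 ->]]]; apply: cone_gen_comb => v /c01 /andP[].
have [||x Qx mx] := @min_integral n Q u iu.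
- apply: contrapT => h; apply: ns; split=> // c ic v vs.
  apply: contrapT => cv; apply: h.
  exists (comb s (fun v => c v - (Num.floor (c v))%:~R)); split.
    rewrite -combB; apply: integralB => //; apply: integral_comb => [|w _]; first exact: si.
    exact: intr_int.
  split; last first.
    exists (fun v => c v - (Num.floor (c v))%:~R) => // w _.
    by rewrite subr_ge0 floor_le /=; have := floorD1_gt (c w); rewrite rmorphD /=; lra.
  apply/eqP => e; apply: cv.
  have e0 : comb s (fun v => c v - (Num.floor (c v))%:~R) = comb s (fun=> 0).
    by rewrite e /comb big1 // => w _; rewrite scale0r.
  by have /= /subr0_eq -> := free_comb_inj fs e0 vs; rewrite intr_int.
- move=> x Qx; split; first by case: Qx.
  by apply: ltW; apply: pu; [exact: QC|case: Qx => _ []].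
exists x; have [ix [x0 [c c01 xE]]] := Qx; split=> //; first exact: QC.
  by rewrite xE; apply: box_not_vertex; rewrite -?xE.
move=> [y [z [[Cy iy y0] [Cz iz z0 E]]]].
have := pu z Cz z0; suff : ev u x <= ev u y by rewrite E evD; lra.
apply: mx; split=> //; split=> //.
have [d d0 yE] := cone_gen_combP us Cy; have [e e0 zE] := cone_gen_combP us Cz.
exists d => // v vs; rewrite d0 //=.
have : comb s c = comb s (fun v => d v + e v) by rewrite -combD -xE -yE -zE.
move=> /(free_comb_inj fs) /(_ v vs) cE.
have := c01 v vs; have := e0 v vs; rewrite cE => ? /andP[_]; lra.
Qed.

Lemma unimod_primitive s v : unimod s -> v \in s -> primitive v.
Proof.
move=> [fs si h] vs; have us := free_uniq fs; split; first exact: si.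
  apply/eqP => v0; have := fs.
  by rewrite (perm_free (perm_to_rem vs)) free_cons v0 mem0v.
move=> k w iw vE.
have k0 : (0 < k)%N.
  rewrite lt0n; apply/eqP => k0; move: vE; rewrite k0 mulr0n => v0.
  by have := fs; rewrite (perm_free (perm_to_rem vs)) free_cons v0 mem0v.
have wE : w = comb s (fun x => k%:R^-1 * (x == v)%:R).
  rewrite -combZ comb_indic // vE -scaler_nat scalerA mulVf ?scale1r //.
  by rewrite pnatr_eq0 -lt0n.
rewrite wE in iw; have := h _ iw v vs; rewrite eqxx mulr1.
have k1 : 0 < k%:R :> rat by rewrite ltr0n.
move/intrP => [m mE].
have m0 : (0 < m) by rewrite -(ltr0z rat) -mE invr_gt0.
have : (1 : rat) <= m%:~R by rewrite ler1z -gtz0_ge1.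
by rewrite -mE invf_ge1 // -[1]/(1%:R) ler_nat => k2; apply/eqP; rewrite eqn_leq k2 k0.
Qed.

(** The coordinates would be integers in [0, 1). *)
Lemma unimod_no_minimal s x : unimod s -> ~ minimal_point (cone_gen s) x.
Proof.
move=> us mx; have [fs si h] := us; have Us := free_uniq fs.
have [Cx ix x0 _ _] := mx; have [c c0 xE] := cone_gen_combP Us Cx.
rewrite xE in mx ix; have c1 := minimal_coef_lt1 fs (fun v => unimod_primitive us) c0 mx.
case/eqP: x0; rewrite xE /comb big_seq big1 // => v vs.
by rewrite (int_lt1 (h _ ix v vs) (c0 v vs) (c1 v vs)) scale0r.
Qed.

Lemma minimal_points_finite s : free s -> {in s, forall v, primitive v} ->
  finite_set (minimal_point (cone_gen s)).
Proof.
move=> fs ps; have us := free_uniq fs.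
apply: sub_finite_set (finite_integral_box s) => x mx.
have [Cx ix _ _ _] := mx; split=> //; have [c c0 xE] := cone_gen_combP us Cx.
rewrite xE in mx *; have c1 := minimal_coef_lt1 fs ps c0 mx.
exists (fun i => c s`_i); last exact: comb_ord.
by move=> i; rewrite c0 ?ltW ?c1 // mem_nth.
Qed.

Lemma minimal_primitive C x : cvx C -> minimal_point C x -> primitive x.
Proof.
move=> [C0 CD CZ] [Cx ix x0 _ dec]; split=> // k w iw xE.
have k0 : (0 < k)%N by rewrite lt0n; apply: contraNneq x0 => z; rewrite xE z mulr0n.
have kn : (k%:R : rat) != 0 by rewrite pnatr_eq0 -lt0n.
have w0 : w != 0 by apply: contraNneq x0 => z; rewrite xE z mul0rn.
have Cw : C w.
  have -> : w = k%:R^-1 *: x by rewrite xE -scaler_nat scalerA mulVf // scale1r.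
  by apply: CZ => //; rewrite invr_ge0.
case: k xE k0 kn => // -[//|k] xE _ _; case: dec.
exists w, (w *+ k.+1); split=> //; split.
- by rewrite -scaler_nat; apply: CZ.
- exact: integralMn.
- by rewrite -scaler_nat scaler_eq0 negb_or w0 pnatr_eq0.
by rewrite xE mulrS.
Qed.

End Simplicial.

(** * Star subdivisions of fans *)

Section Fans.
Variable n : nat.
Implicit Types (C D F G : set 'rV[rat]_n) (Phi : set (set 'rV[rat]_n)).
Implicit Types (V W : set 'rV[rat]_n) (p q x y : 'rV[rat]_n).

(** The third clause makes the relative interiors disjoint, and makes any two cones meet
    in a common face. *)
Definition fan Phi : Prop :=
  [/\ forall C, Phi C -> rational_cone C,
      forall C F, Phi C -> face F C -> Phi F &
      forall C D x, Phi C -> Phi D -> relint C x -> D x -> face C D].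

(** The cone [d] takes the place of an element of the star of [p], and [c] that of an
    element of its link: in a fan, containing [p] is the same as having the cell of [p]
    as a face, and inclusion is the same as being a face. *)
Definition fstar V Phi : set (set 'rV[rat]_n) :=
  [set C | Phi C /\ forall p, V p -> ~ C p] `|`
  [set C | exists p c d, [/\ V p, Phi c, Phi d & d p] /\
     [/\ forall q, V q -> ~ c q, c `<=` d & C = msum (ray p) c]].

(** In a fan this says that distinct points of [V] have disjoint stars. *)
Definition separated V Phi : Prop :=
  forall C p q, Phi C -> V p -> V q -> C p -> C q -> p = q.

Lemma fan_eq Phi C D x : fan Phi -> Phi C -> Phi D -> relint C x -> relint D x ->
  C = D.
Proof.
move=> [_ _ h] PC PD rC rD; apply/seteqP; split; apply: face_subset.
  by apply: (h _ _ _ PC PD rC); case: rD.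
by apply: (h _ _ _ PD PC rD); case: rC.
Qed.

Lemma fan_subset_face Phi C D : fan Phi -> Phi C -> Phi D -> C `<=` D -> face C D.
Proof.
move=> [rat _ h] PC PD CD; have [x rx] := relint_nonempty (rational_fg (rat _ PC)).
by apply: (h _ _ _ PC PD rx); apply: CD; case: rx.
Qed.

Lemma msum_ray_sub p C D : cvx D -> D p -> C `<=` D -> msum (ray p) C `<=` D.
Proof.
move=> [_ DD DZ] Dp CD _ [_ /rayP[a a0 ->] [y Cy <-]].
by apply: DD; [exact: DZ|exact: CD].
Qed.

Lemma msum_ray_self p C : cvx C -> msum (ray p) C p.
Proof.
by case=> C0 _ _; exists p; [exact: ray_self|exists 0; rewrite ?addr0].
Qed.

Lemma msum_ray_incl p C : C `<=` msum (ray p) C.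
Proof.
move=> x Cx; exists 0; first by apply/rayP; exists 0; rewrite ?scale0r.
by exists x; rewrite ?add0r.
Qed.

Lemma msum_rational p C : integral n p -> rational_cone C ->
  rational_cone (msum (ray p) C).
Proof.
move=> ip [s si ->]; exists (p :: s); last by rewrite cone_cons.
by move=> v; rewrite inE => /predU1P[->|/si].
Qed.

Lemma relint_ray_intro C p z a : fgcone C -> relint C z -> 0 < a ->
  relint (msum (ray p) C) (a *: p + z).
Proof.
move=> fC rz a0; have cC := fg_cvx fC.
apply: relint_intro.
- by case: fC => s ->; exists (p :: s); rewrite cone_cons.
- by exists (a *: p); [apply/rayP; exists a => //; apply: ltW|exists z => //; case: rz].
move=> _ [_ /rayP[b b0 ->] [w Cw <-]].
have [e e0 he] := relint_sub cC rz Cw.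
have b1 : 0 < 1 + b by rewrite ltr_pwDl.
pose e' := Num.min e (a / (1 + b)).
have e'0 : 0 < e' by rewrite lt_min e0 divr_gt0.
exists e' => //; exists ((a - e' * b) *: p).
  apply/rayP; exists (a - e' * b) => //; rewrite subr_ge0.
  apply: (@le_trans _ _ (a / (1 + b) * b)).
    by rewrite ler_wpM2r // ge_min lexx orbT.
  rewrite mulrAC ler_pdivrMr // ler_wpM2l ?ltW //; lra.
exists (z - e' *: w).
  by apply: (cvx_sub_scale cC e0) => //; [case: rz|rewrite ge_min lexx].
by rewrite scalerDr scalerBl scalerA opprD addrACA.
Qed.

Lemma face_msum_ray p C F : cvx C -> face F (msum (ray p) C) ->
  (exists2 G, face G C & F = msum (ray p) G) \/ face F C.
Proof.
move=> cC [u h ->].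
have up : 0 <= ev u p by apply: h; apply: msum_ray_self.
have hC x : C x -> 0 <= ev u x by move=> Cx; apply: h; apply: msum_ray_incl.
have [u0|u0] := eqVneq (ev u p) 0; [left|right].
  exists [set x | C x /\ ev u x = 0]; first by exists u.
  apply/seteqP; split=> x.
    case=> -[_ /rayP[a a0 ->] [y Cy <-]]; rewrite -/(ev _ _) evD evZ u0 mulr0 add0r => uy.
    by exists (a *: p); [apply/rayP; exists a|exists y].
  case=> _ /rayP[a a0 ->] [y [Cy uy] <-]; split.
    by exists (a *: p); [apply/rayP; exists a|exists y].
  by rewrite -/(ev _ _) evD evZ u0 mulr0 add0r.
exists u => //; apply/seteqP; split=> x; last first.
  by case=> Cx ux; split=> //; apply: msum_ray_incl.
case=> -[_ /rayP[a a0 ->] [y Cy <-]]; rewrite -/(ev _ _) evD evZ => e.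
have az : a = 0.
  have := mulr_ge0 a0 up; have := hC y Cy => k1 k2.
  have /eqP : a * ev u p = 0 by lra.
  by rewrite mulf_eq0 (negPf u0) orbF => /eqP.
by split; [rewrite az scale0r add0r|rewrite -/(ev _ _) evD evZ].
Qed.

(** The smallest face of [d] containing [x] also contains [p], which has a positive
    coefficient in [x]. *)
Lemma fan_relint_ray Phi p c d x : fan Phi -> Phi c -> Phi d -> d p -> c `<=` d ->
  relint (msum (ray p) c) x ->
  exists G, [/\ Phi G, relint G x, G p & face G d].
Proof.
move=> [rat fac h] Pc Pd dp cd rx.
have fd := rational_fg (rat _ Pd); have cvd := fg_cvx fd; have [d0 dD dZ] := cvd.
have [a a0 [z rz xE]] := relint_ray_add (rational_fg (rat _ Pc)) rx.
have dz : d z by apply: cd; case: rz.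
have dx : d x by rewrite xE; apply: dD => //; apply: dZ => //; apply: ltW.
have [G fG rG] := min_face fd dx.
exists G; split=> //; first exact: fac fG.
have : G (a *: p).
  apply: (face_extreme (y := z) fG) => //; first by apply: dZ => //; apply: ltW.
  by rewrite -xE; case: rG.
have [_ _ GZ] := face_cvx cvd fG => /(GZ a^-1).
by rewrite scalerA mulVf ?gt_eqF // scale1r; apply; rewrite invr_ge0 ltW.
Qed.

(** Let an interior point x of a cone C of the star subdivision lie in another one, D. If
    C is a join with a point p of [V] and D is old, the cone of the fan containing x in
    its interior belongs to the star of p, so that D would too. If C is old and D is a
    join with q, then x has no component along q, since C is not in the star of q. If
    both are new, the two points coincide by separation, and the components of x along
    this point are compared: they must agree, since otherwise the link of the point
    would contain a cone of its star. *)
Lemma fan_fstar V Phi : fan Phi -> V `<=` integral n -> separated V Phi ->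
  fan (fstar V Phi).
Proof.
move=> fP iV sep; have [rat fac fan3] := fP.
have cv C : Phi C -> cvx C by move=> /rat/rational_fg/fg_cvx.
split.
- move=> C [[/rat //]|[p [c [d [[Vp Pc _ _] [_ _ ->]]]]]].
  by apply: msum_rational; [exact: iV|exact: rat].
- move=> C F [[PC VC] fF|[p [c [d [[Vp Pc Pd dp] [Vc cd ->]]]]]].
    by left; split; [exact: fac fF|move=> p /VC Cp /(face_subset fF)].
  move=> /(face_msum_ray (cv c Pc))[[G fG ->]|fF]; last first.
    by left; split; [exact: fac fF|move=> q /Vc cq /(face_subset fF)].
  right; exists p, G, d; split; split=> //; first exact: fac fG.
    by move=> q /Vc cq /(face_subset fG).
  by move=> y /(face_subset fG)/cd.
move=> C D x.
case=> [[PC VC]|[p [c [c' [[Vp Pc Pc' c'p] [Vc cc' ->]]]]]];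
  case=> [[PD VD]|[q [d [d' [[Vq Pd Pd' d'q] [Vd dd' ->]]]]]] rx Dx.
- exact: (fan3 _ _ _ PC PD rx Dx).
- have DD : msum (ray q) d `<=` d' by apply: msum_ray_sub => //; apply: cv.
  have fCd : face C d' by apply: (fan3 _ _ _ PC Pd' rx); apply: DD.
  apply: (face_restrict fCd) => //.
  case: Dx => _ /rayP[a a0 ->] [y dy xE].
  have az : a = 0.
    apply/eqP; rewrite eq_le a0 andbT leNgt; apply/negP => ap.
    have [_ _ dZ'] := cv _ Pd'.
    have : C (a *: q).
      apply: (face_extreme (y := y) fCd); [exact: dZ'|exact: dd'|].
      by rewrite xE; case: rx.
    have [_ _ CZ] := cv _ PC => /(CZ a^-1).
    rewrite scalerA mulVf ?gt_eqF // scale1r => h; apply: (VC q Vq); apply: h.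
    by rewrite invr_ge0 ltW.
  move: xE; rewrite az scale0r add0r => yx; rewrite yx in dy.
  by move=> z Cz; apply: msum_ray_incl; apply: (face_subset (fan3 _ _ _ PC Pd rx dy)).
- have [G [PG rG Gp fG]] := fan_relint_ray fP Pc Pc' c'p cc' rx.
  by case: (VD p Vp); apply: (face_subset (fan3 _ _ _ PG PD rG Dx)).
have [G [PG rG Gp fG]] := fan_relint_ray fP Pc Pc' c'p cc' rx.
have DD : msum (ray q) d `<=` d' by apply: msum_ray_sub => //; apply: cv.
have d'p : d' p by apply: (face_subset (fan3 _ _ _ PG Pd' rG (DD _ Dx))).
have pq : p = q by apply: sep d'p d'q.
move: pq Dx DD Vq d'q => <- Dx DD _ _.
have [a a0 [z rz xE]] := relint_ray_add (rational_fg (rat _ Pc)) rx.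
case: (Dx) => _ /rayP[b b0 ->] [y dy xE2].
have [c'0 c'D c'Z] := cv _ Pc'; have [d'0 d'D d'Z] := cv _ Pd'.
have cz : c z by case: rz.
have [ab|ab|ab] := ltgtP a b.
- have zE : z = (b - a) *: p + y.
    by rewrite scalerBl addrAC xE2 xE addrAC subrr add0r.
  have d'z : d' z by rewrite zE; apply: d'D; [apply: d'Z; rewrite ?subr_ge0 // ltW|apply: dd'].
  have fc := fan3 _ _ _ Pc Pd' rz d'z.
  have : c ((b - a) *: p).
    apply: (face_extreme (y := y) fc); last by rewrite -zE.
      by apply: d'Z; rewrite ?subr_ge0 // ltW.
    exact: dd'.
  have [_ _ cZ] := cv _ Pc => /(cZ (b - a)^-1).
  rewrite scalerA mulVf ?gt_eqF ?subr_gt0 // scale1r => h.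
  by case: (Vc p Vp); apply: h; rewrite invr_ge0 subr_ge0 ltW.
- have yE : y = (a - b) *: p + z.
    by rewrite scalerBl addrAC -xE -xE2 addrAC subrr add0r.
  have ry : relint (msum (ray p) c) y.
    by rewrite yE; apply: relint_ray_intro; rewrite ?subr_gt0 //; apply/rational_fg/rat.
  have [G' [PG' rG' G'p _]] := fan_relint_ray fP Pc Pc' c'p cc' ry.
  by case: (Vd p Vp); apply: (face_subset (fan3 _ _ _ PG' Pd rG' dy)).
have zy : z = y by apply: (addrI (a *: p)); rewrite -xE ab xE2.
rewrite zy in rz; have fcd := fan3 _ _ _ Pc Pd rz dy.
have cd := face_subset fcd.
(* A functional cutting out [c] from [d'], corrected by the one cutting out [d]
   so that it vanishes on [p], cuts out the join of [p] and [c] from that of [p]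
   and [d]. *)
have [u u0 cE] := fan3 _ _ _ Pc Pd' rz (dd' _ dy).
have [w w0 dE] := fan_subset_face fP Pd Pd' dd'.
rewrite -/(ev _ _) in u0 w0.
have wp : 0 < ev w p.
  rewrite lt0r w0 // andbT; apply/negP => /eqP wp0; apply: (Vd p Vp).
  by rewrite dE; split.
have dw v : d v -> ev w v = 0 by rewrite dE => -[].
pose u' := u - (ev u p / ev w p) *: w.
have u'p : ev u' p = 0 by rewrite /u' evDu evNu evZu divfK ?gt_eqF // subrr.
have u'd v : d v -> ev u' v = ev u v.
  by move=> dv; rewrite /u' evDu evNu evZu (dw v dv) mulr0 subr0.
exists u' => [_ [_ /rayP[s s0 ->] [v dv <-]]|].
  by rewrite -/(ev _ _) evD evZ u'p mulr0 add0r u'd // u0 //; apply: dd'.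
apply/seteqP; split=> v.
  case=> _ /rayP[s s0 ->] [v' cv' <-]; split.
    by exists (s *: p); [apply/rayP; exists s|exists v' => //; apply: cd].
  rewrite -/(ev _ _) evD evZ u'p mulr0 add0r u'd; last exact: cd.
  by move: cv'; rewrite cE => -[].
case=> -[_ /rayP[s s0 ->] [v' dv' <-]].
rewrite -/(ev _ _) evD evZ u'p mulr0 add0r u'd // => uv'.
exists (s *: p); first by apply/rayP; exists s.
by exists v' => //; rewrite cE; split=> //; apply: dd'.
Qed.

(** Faces are exposed by definition, so transitivity requires combining the two
    functionals; finitely many generators make this possible. *)
Lemma face_trans C F G : fgcone C -> face F C -> face G F -> face G C.
Proof.
case=> s ->{C} [u u0 ->] [w w0 ->].
rewrite -/(ev _ _) in u0.
(* A large multiple of [u] dominates [w] on the generators outside the face. *)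
have [M M0 hM] : exists2 M : rat, 0 < M &
    {in s, forall v, 0 < ev u v -> 0 < ev (M *: u + w) v}.
  elim: s {u0 w0} => [|v s [M M0 IH]]; first by exists 1.
  have [uv|uv] := ltP 0 (ev u v); last first.
    exists M => // x; rewrite inE => /predU1P[->|/IH //].
    by rewrite ltNge uv.
  exists (M + (`|ev w v| + 1) / ev u v); first by rewrite addr_gt0 ?divr_gt0 ?ltr_wpDl.
  move=> x; rewrite inE evDu evZu mulrDl => /predU1P[->|/IH h] ux.
    rewrite divfK ?gt_eqF //; have := ler_norm (- ev w v); rewrite normrN.
    have := mulr_gt0 M0 uv; lra.
  have := h ux; rewrite evDu evZu; set y := _ / _.
  have : 0 <= y * ev u x.
    by rewrite mulr_ge0 ?ltW // divr_gt0 // ltr_wpDl.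
  lra.
have hs v : v \in s -> 0 <= ev (M *: u + w) v /\
    (ev (M *: u + w) v = 0 <-> ev u v = 0 /\ ev w v = 0).
  move=> vs; have uv := u0 v (mem_cone_gen vs).
  have [uz|un] := eqVneq (ev u v) 0.
    have : 0 <= ev w v by apply: w0; split; first exact: mem_cone_gen.
    rewrite evDu evZu uz mulr0 add0r => wv; split=> //; split=> [//|[]//].
  have up : 0 < ev u v by rewrite lt0r un.
  have := hM v vs up => h; split; first exact: ltW.
  by split=> [h0|[h0]]; [move: h; rewrite h0 ltxx|rewrite h0 eqxx in un].
exists (M *: u + w).
  by apply: ev_ge0 => v /hs[].
have uf := face_filter (fun v vs => u0 v (mem_cone_gen vs)).
transitivity (cone_gen [seq v <- s | ev (M *: u + w) v == 0]); last first.
  by apply/esym/face_filter => v /hs[].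
rewrite [in LHS]uf.
have wf : {in [seq v <- s | ev u v == 0], forall v, 0 <= ev w v}.
  move=> v; rewrite mem_filter => /andP[/eqP uv vs]; apply: w0.
  by split; first exact: mem_cone_gen.
rewrite [LHS](face_filter wf) -filter_predI; congr (cone_gen _).
apply: eq_in_filter => v vs /=; have [_ h] := hs v vs.
by apply/andP/eqP => [[/eqP h1 /eqP h2]|/h[-> ->]]; [apply/h|split; apply/eqP].
Qed.

Lemma fan_faces C : rational_cone C -> fan [set F | face F C].
Proof.
move=> rC; have fC := rational_fg rC; have cC := fg_cvx fC; split.
- by move=> F fF; apply: face_rational fF.
- by move=> F G fF; apply: face_trans.
move=> F G x fF fG rF Gx; apply: (face_restrict fF); last exact: face_subset.
exact: (relint_face_sub (face_cvx cC fF) cC rF (face_subset fF) fG Gx).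
Qed.

Lemma fstar_set0 Phi : fstar set0 Phi = Phi.
Proof.
apply/seteqP; split=> C; first by case=> [[]//|[p [c [d [[]]]]]].
by left; split.
Qed.

(** This reduces the subdivision at a set of points with disjoint stars to subdivisions
    at single points. *)
Lemma fstar_setU1 p W Phi : fan Phi -> separated (p |` W) Phi -> ~ W p ->
  fstar [set p] (fstar W Phi) = fstar (p |` W) Phi.
Proof.
move=> [rat fac _] sep Wp.
have cv C : Phi C -> cvx C by move=> /rat/rational_fg/fg_cvx.
apply/seteqP; split=> C.
  case=> [[[[PC WC]|[q [c [d [[Wq Pc Pd dq] [Wc cd CE]]]]]] Cp]|].
  - by left; split=> // q [->|/WC //]; apply: Cp.
  - right; exists q, c, d; split; split=> //; first by right.
    move=> r [->|/Wc //] cp; apply: (Cp p) => //.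
    by rewrite CE; apply: msum_ray_incl.
  case=> _ [c [d [[-> sc sd dp] [nc cd ->]]]].
  case: sd dp cd => [[Pd Wd]|[q [d0 [d1 [[Wq Pd0 Pd1 d1q] [Wd d01 ->]]]]]] dp cd.
    case: sc nc cd => [[Pc Wc]|[q [c0 [c1 [[Wq Pc0 Pc1 c1q] [Wc c01 ->]]]]]] nc cd.
      by right; exists p, c, d; split; split=> //; [left|move=> r [->|/Wc]//; apply: nc].
    by case: (Wd q Wq); apply: cd; apply/msum_ray_self/cv.
  case: Wp; suff -> : p = q by [].
  apply: (sep d1) => //; [by left|by right|].
  exact: (msum_ray_sub (cv _ Pd1) d1q d01 dp).
case=> [[PC VC]|[q [c [d [[Vq Pc Pd dq] [Vc cd ->]]]]]].
  left; split; last by move=> _ ->; apply: VC; left.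
  by left; split=> // q Wq; apply: VC; right.
case: Vq dq => [->|Wq] dq.
  right; exists p, c, d; split; split=> //; last by move=> _ ->; apply: Vc; left.
    by left; split=> // r Wr; apply: Vc; right.
  left; split=> // r Wr dr; apply: Wp; suff -> : p = r by [].
  by apply: (sep d) => //; [left|right].
left; split.
  by right; exists q, c, d; split; split=> // r Wr; apply: Vc; right.
move=> _ -> /(msum_ray_sub (cv _ Pd) dq cd) dp; apply: Wp.
by rewrite (sep d p q) //; [left|right].
Qed.

Lemma fstar_refines V Phi C : fan Phi -> fstar V Phi C ->
  exists2 D, Phi D & C `<=` D.
Proof.
move=> [rat _ _] [[PC _]|[p [c [d [[_ Pc Pd dp] [_ cd ->]]]]]]; first by exists C.
exists d => //; apply: msum_ray_sub => //.
exact/fg_cvx/rational_fg/rat.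
Qed.

Lemma separated_fstar V W Phi : fan Phi -> separated W Phi -> separated W (fstar V Phi).
Proof.
move=> fP sep C p q /(fstar_refines fP)[D PD CD] Wp Wq /CD Dp /CD Dq.
exact: sep Dp Dq.
Qed.

Lemma fstar_finite V Phi : finite_set V -> finite_set Phi -> finite_set (fstar V Phi).
Proof.
move=> fV fP; rewrite /fstar finite_setU; split.
  by apply: sub_finite_set fP => C [].
apply: sub_finite_set (finite_image2 (fun p c => msum (ray p) c) fV fP).
by move=> C [p [c [d [[Vp Pc _ _] [_ _ ->]]]]]; exists p => //; exists c.
Qed.

End Fans.

(** * Linear images *)

Section LinearImages.
Variables m n : nat.
Implicit Types (M : 'M[rat]_(m, n)) (C F D : set 'rV[rat]_m) (s : seq 'rV[rat]_m).

Lemma linD M x y : lin M (x + y) = lin M x + lin M y.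
Proof. exact: mulmxDl. Qed.

Lemma linZ M a x : lin M (a *: x) = a *: lin M x.
Proof. by rewrite /lin scalemxAl. Qed.

Lemma linB M x y : lin M (x - y) = lin M x - lin M y.
Proof. exact: mulmxBl. Qed.

Lemma lin0 M : lin M 0 = 0. Proof. exact: mul0mx. Qed.

Lemma ev_lin M u x : ev u (lin M x) = ev (M *m u) x.
Proof. exact: ev_mul. Qed.

Lemma injective_linP M : injective (lin M) -> exists N, M *m N = 1%:M.
Proof.
move=> iM; suff /row_freeP : row_free M by [].
rewrite -kermx_eq0; apply/eqP/row_matrixP => i; rewrite row0.
apply: iM; rewrite /lin mul0mx -row_mul mulmx_ker row0 //.
Qed.

Lemma lin_cone_gen M s : lin M @` cone_gen s = cone_gen [seq lin M v | v <- s].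
Proof.
elim: s => [|v s IH] /=.
  by rewrite !cone_nil image_set1 lin0.
rewrite !cone_cons -IH; apply/seteqP; split.
  move=> _ [_ [_ /rayP[a a0 ->] [y ys <-]] <-].
  exists (a *: lin M v); first by apply/rayP; exists a.
  by exists (lin M y); [exists y|rewrite linD linZ].
move=> _ [_ /rayP[a a0 ->] [_ [y ys <-] <-]].
exists (a *: v + y); last by rewrite linD linZ.
by exists (a *: v); [apply/rayP; exists a|exists y].
Qed.

Lemma lin_fg M C : fgcone C -> fgcone (lin M @` C).
Proof. by case=> s ->; rewrite lin_cone_gen; eexists. Qed.

Lemma lin_fg_inj M C : injective (lin M) -> fgcone (lin M @` C) -> fgcone C.
Proof.
move=> iM [s sE].
have sC v : v \in s -> exists2 w, C w & lin M w = v.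
  move=> vs; have : (lin M @` C) v by rewrite sE; apply: mem_cone_gen.
  by case=> w; exists w.
have [t tE] : exists t, s = [seq lin M w | w <- t].
  elim: s sC {sE} => [|v s IH] sC; first by exists [::].
  have [|t ->] := IH; first by move=> w ws; apply: sC; rewrite inE ws orbT.
  by have [w _ <-] := sC v (mem_head _ _); exists (w :: t).
exists t; move: sE; rewrite tE -lin_cone_gen => E.
apply/seteqP; split=> x xC.
  have : (lin M @` C) (lin M x) by exists x.
  by rewrite E => -[y ty /iM <-].
have : (lin M @` cone_gen t) (lin M x) by exists x.
by rewrite -E => -[y ty /iM <-].
Qed.

Lemma image_injE M C x : injective (lin M) -> (lin M @` C) (lin M x) <-> C x.
Proof. by move=> iM; split=> [[y Cy /iM <-]//|Cx]; exists x. Qed.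

Lemma image_inj_sub M C D : injective (lin M) ->
  lin M @` C `<=` lin M @` D <-> C `<=` D.
Proof.
move=> iM; split=> h x; last by case=> y /h Dy <-; exists y.
by move=> Cx; apply/(image_injE D x iM)/h; exists x.
Qed.

Lemma image_inj_eq M C D : injective (lin M) ->
  lin M @` C = lin M @` D -> C = D.
Proof.
move=> iM e; apply/seteqP.
by split; apply/(image_inj_sub _ _ iM); rewrite e.
Qed.

Lemma relint_image M C x : injective (lin M) -> fgcone C ->
  relint (lin M @` C) (lin M x) <-> relint C x.
Proof.
move=> iM fC; have fMC := lin_fg M fC; split=> rx.
  apply: relint_intro => // [|y Cy]; first by apply/(image_injE _ _ iM); case: rx.
  have [e e0 h] := relint_sub (fg_cvx fMC) rx (imageP (lin M) Cy).
  by exists e => //; apply/(image_injE _ _ iM); rewrite linB linZ.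
apply: relint_intro => //; first by exists x => //; case: rx.
move=> _ [y Cy <-]; have [e e0 h] := relint_sub (fg_cvx fC) rx Cy.
by exists e => //; exists (x - e *: y) => //; rewrite linB linZ.
Qed.

(** An injective matrix has a right inverse, which transports functionals. *)
Lemma face_image M F C : injective (lin M) ->
  face (lin M @` F) (lin M @` C) <-> face F C.
Proof.
move=> iM; split=> -[u u0 FE].
  exists (M *m u); first by move=> x Cx; rewrite mulmxA; apply: u0; exists x.
  apply/seteqP; split=> x.
    move=> Fx; have : (lin M @` F) (lin M x) by exists x.
    by rewrite FE => -[/(image_injE _ _ iM)Cx]; rewrite /lin -mulmxA.
  move=> [Cx ux]; apply/(image_injE _ _ iM); rewrite FE; split; first by exists x.
  by rewrite /lin -mulmxA.
have [N MN] := injective_linP iM.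
exists (N *m u).
  by move=> _ [x Cx <-]; rewrite /lin mulmxA -(mulmxA x) MN mulmx1; apply: u0.
rewrite FE; apply/seteqP; split.
  by move=> _ [x [Cx ux] <-]; split; [exists x|rewrite /lin mulmxA -(mulmxA x) MN mulmx1].
move=> _ [[x Cx <-]]; rewrite /lin mulmxA -(mulmxA x) MN mulmx1 => ux.
by exists x.
Qed.

Lemma face_image_inv M (F : set 'rV[rat]_n) C : face F (lin M @` C) ->
  F = lin M @` [set x | C x /\ F (lin M x)].
Proof.
move=> fF; apply/seteqP; split; last by move=> _ [x [Cx Fx] <-].
by move=> x Fx; have [y Cy e] := face_subset fF Fx; exists y => //; split=> //; rewrite e.
Qed.

Lemma relint_relint_sub C D x : fgcone D -> cvx C -> C `<=` D ->
  relint C x -> relint D x -> relint C `<=` relint D.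
Proof.
move=> fD cC CD rC rD y ry.
have [e e0 h] := relint_sub cC ry (relint_subset rC).
rewrite -(subrK (e *: x) y) addrC; apply: relint_add => //; last exact: CD.
exact: relint_scale.
Qed.

Lemma lin_msum M C D : lin M @` msum C D = msum (lin M @` C) (lin M @` D).
Proof.
apply/seteqP; split.
  move=> _ [_ [x Cx [y Dy <-]] <-]; exists (lin M x); first by exists x.
  by exists (lin M y); [exists y|rewrite linD].
move=> _ [_ [x Cx <-] [_ [y Dy <-] <-]].
by exists (x + y); [exists x => //; exists y|rewrite linD].
Qed.

Lemma lin_ray M x : lin M @` ray x = ray (lin M x).
Proof. by rewrite /ray lin_cone_gen. Qed.

Lemma lin_comb M s c : lin M (comb s c) = \sum_(v <- s) c v *: lin M v.
Proof.
rewrite /comb; elim: s => [|v s IH]; first by rewrite !big_nil lin0.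
by rewrite !big_cons -IH linD linZ.
Qed.

Lemma free_lin M s : injective (lin M) -> free [seq lin M v | v <- s] = free s.
Proof.
move=> iM; elim: s => [|v s IH] /=; first by rewrite !nil_free.
rewrite !free_cons IH; congr (~~ _ && _).
have spE k (l : seq 'rV[rat]_k) x : x \in <<l>>%VS <-> lspan (cone_gen l) x.
  by rewrite lspan_span.
apply/idP/idP => /spE.
  rewrite -lin_cone_gen => -[_ [x sx <-] [_ [y sy <-]]]; rewrite -linB => /iM <-.
  by apply/spE; exists x => //; exists y.
case=> x sx [y sy <-]; apply/spE; rewrite -lin_cone_gen.
by exists (lin M x); [exists x|exists (lin M y); [exists y|rewrite linB]].
Qed.

End LinearImages.

(** ** Lattice embeddings *)

Section LatticeEmbeddings.
Variables m n : nat.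
Implicit Types (M : 'M[rat]_(m, n)) (C F : set 'rV[rat]_m) (x y : 'rV[rat]_m).

(** Both the inclusions of faces and the maps of complexes near irreducible cones are of
    this kind. *)
Definition lattice_inj M : Prop :=
  injective (lin M) /\ forall x, integral n (lin M x) <-> integral m x.

Lemma lin_neq0 M x : injective (lin M) -> (lin M x != 0) = (x != 0).
Proof. by move=> iM; rewrite -(inj_eq iM) lin0. Qed.

Lemma primitive_lin M x : lattice_inj M -> primitive (lin M x) <-> primitive x.
Proof.
move=> [iM intM]; split=> -[ix x0 hx].
  split; [exact/intM|by rewrite -(lin_neq0 _ iM)|move=> k w iw xE].
  apply: (hx k (lin M w)); first exact/intM.
  by rewrite xE -!scaler_nat linZ.
split; [exact/intM|by rewrite lin_neq0|move=> k w iw xE].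
have k0 : (k%:R : rat) != 0.
  rewrite pnatr_eq0; apply: contraNneq x0 => k0.
  by apply/eqP/iM; rewrite xE k0 mulr0n lin0.
have wE : w = lin M (k%:R^-1 *: x).
  by rewrite linZ xE -scaler_nat scalerA mulVf // scale1r.
apply: (hx k (k%:R^-1 *: x)); first by apply/intM; rewrite -wE.
by rewrite -scaler_nat scalerA divff // scale1r.
Qed.

Lemma vertex_lin M C x : lattice_inj M ->
  vertex (lin M @` C) (lin M x) <-> vertex C x.
Proof.
move=> lM; have [iM _] := lM; rewrite /vertex primitive_lin //.
by rewrite -lin_ray face_image.
Qed.

Lemma minimal_lin M C x : lattice_inj M ->
  minimal_point (lin M @` C) (lin M x) <-> minimal_point C x.
Proof.
move=> lM; have [iM intM] := lM.
have dec : (exists y z : 'rV[rat]_n, [/\ (lin M @` C) y, integral n y & y != 0] /\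
      [/\ (lin M @` C) z, integral n z, z != 0 & lin M x = y + z]) <->
    exists y z : 'rV[rat]_m, [/\ C y, integral m y & y != 0] /\
      [/\ C z, integral m z, z != 0 & x = y + z].
  split.
    move=> [_ [_ [[[y Cy <-] iy y0] [[z Cz <-] iz z0 xE]]]].
    exists y, z; rewrite -(lin_neq0 y iM) -(lin_neq0 z iM).
    split; split=> //; [exact/intM|exact/intM|].
    by apply: iM; rewrite linD.
  move=> [y [z [[Cy iy y0] [Cz iz z0 xE]]]]; exists (lin M y), (lin M z).
  rewrite !lin_neq0 // xE linD.
  by split; split=> //; exact/intM.
split=> -[Cx ix x0 nv nd]; split.
- exact/(image_injE _ _ iM).
- exact/intM.
- by rewrite -(lin_neq0 _ iM).
- by move/(vertex_lin _ _ lM).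
- by move/dec.
- by exists x.
- exact/intM.
- by rewrite lin_neq0.
- by move/(vertex_lin _ _ lM).
by move/dec.
Qed.

Lemma minimal_face C F x : fgcone C -> face F C -> F x ->
  minimal_point C x <-> minimal_point F x.
Proof.
move=> fC fF Fx; have sub := face_subset fF; split=> -[Cx ix x0 nv dec].
  split=> //; first by move=> [px fr]; apply: nv; split=> //; apply: face_trans fr.
  move=> [y [z [[/sub Cy iy y0] [/sub Cz iz z0 xE]]]]; apply: dec.
  by exists y, z.
split=> //; first exact: sub.
  move=> [px fr]; apply: nv; split=> //; apply: (face_restrict fr) => //.
  move=> _ /rayP[a a0 ->].
  by have [_ _ FZ] := face_cvx (fg_cvx fC) fF; apply: FZ.
move=> [y [z [[Cy iy y0] [Cz iz z0 xE]]]]; apply: dec; exists y, z; split; split=> //.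
  by apply: (face_extreme fF Cy Cz); rewrite -xE.
by apply: (face_extreme fF Cz Cy); rewrite addrC -xE.
Qed.

Lemma unimod_lin M (l : seq 'rV[rat]_m) : lattice_inj M ->
  unimod [seq lin M v | v <- l] <-> unimod l.
Proof.
move=> [iM intM]; have [N MN] := injective_linP iM.
have fl := free_lin l iM.
have ci c : lin M (comb l c) = comb [seq lin M v | v <- l] (fun w => c (lin N w)).
  rewrite lin_comb /comb big_map; apply: eq_bigr => v _.
  by rewrite /lin -mulmxA MN mulmx1.
split=> -[fr il hl]; split.
- by rewrite -fl.
- by move=> v vl; apply/intM/il/map_f.
- move=> c /intM; rewrite ci => /hl h v vl.
  by have := h _ (map_f _ vl); rewrite /lin -mulmxA MN mulmx1.
- by rewrite fl.
- by move=> _ /mapP[v vl ->]; apply/intM/il.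
move=> c; have -> : comb [seq lin M v | v <- l] c = lin M (comb l (fun v => c (lin M v))).
  by rewrite lin_comb /comb big_map.
by move=> /intM/hl h _ /mapP[v vl ->]; apply: h.
Qed.

End LatticeEmbeddings.

(** * Conical complexes *)

Section Complexes.
Variable S : conical_complex.
Implicit Types (s t d : S) (p q : cpoint S) (V : set (cpoint S)).

Definition emb t s (x : 'rV[rat]_(crk t)) : 'rV[rat]_(crk s) := lin (cinc t s) x.

Notation im s C := (emb s @` C).

Lemma cone_fg s : fgcone (cone s).
Proof. exact: rational_fg (cone_rational s). Qed.

Lemma cone_cvx s : cvx (cone s). Proof. exact: fg_cvx (cone_fg s). Qed.

Lemma emb_inj t s : (t <= s)%O -> injective (@emb t s).
Proof. exact: cinc_inj. Qed.

(** The matrix is idempotent by functoriality, and injective. *)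
Lemma cinc_id s : cinc s s = 1%:M.
Proof.
have e (x : 'rV_(crk s)) : emb s (emb s x) = emb s x.
  by rewrite /emb /lin -mulmxA -(cinc_comp (lexx s) (lexx s)).
apply/row_matrixP => i.
by rewrite [row i _]rowE [in RHS]rowE mulmx1; apply: (@emb_inj s s) => //; apply: e.
Qed.

Lemma emb_id s x : emb s x = x :> 'rV_(crk s).
Proof. by rewrite /emb /lin cinc_id mulmx1. Qed.

Lemma emb_comp t s d x : (t <= s)%O -> (s <= d)%O ->
  emb d (@emb t s x) = emb d x.
Proof. by move=> ts sd; rewrite /emb /lin -mulmxA -(cinc_comp ts sd). Qed.

Lemma image_emb_id s (C : set 'rV[rat]_(crk s)) : im s C = C.
Proof.
apply/seteqP; split=> [_ [x Cx <-]|x Cx]; first by rewrite emb_id.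
by exists x; rewrite ?emb_id.
Qed.

Lemma image_emb_comp t s d (C : set 'rV[rat]_(crk t)) : (t <= s)%O -> (s <= d)%O ->
  im d (im s C) = im d C.
Proof.
move=> ts sd; apply/seteqP; split.
  by move=> _ [_ [x Cx <-] <-]; exists x => //; rewrite emb_comp.
by move=> _ [x Cx <-]; exists (emb s x); [exists x|rewrite emb_comp].
Qed.

Lemma face_tag s F : face F (cone s) -> exists2 t, (t <= s)%O & F = im s (cone t).
Proof. by case/cfaces=> t [[ts FE] _]; exists t. Qed.

Lemma tag_unique t t' s : (t <= s)%O -> (t' <= s)%O ->
  im s (cone t) = im s (cone t') -> t = t'.
Proof.
move=> ts t's e; have [t0 [_ h]] := cfaces (cinc_face ts).
by rewrite -(h t) // -(h t').
Qed.

Lemma min_tag s x : cone s x -> exists t, [/\ (t <= s)%O &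
  exists2 y, relint (cone t) y & x = emb s y].
Proof.
move=> sx; have [F fF rx] := min_face (cone_fg s) sx.
have [t ts FE] := face_tag fF; exists t; split=> //.
have : F x by case: rx.
rewrite FE => -[y ty yx]; exists y => //.
by apply/(relint_image y (emb_inj ts) (cone_fg t)); rewrite -/(emb s _) yx -FE.
Qed.

Lemma relint_emb t s x : (t <= s)%O -> relint (cone t) x -> relint (im s (cone t)) (emb s x).
Proof. by move=> ts rx; apply/(relint_image x (emb_inj ts) (cone_fg t)). Qed.

(** A face of [d] containing an interior point of another one contains all of it, and the
    faces of [d] determine their indices. *)
Lemma tag_le t s d x : (t <= d)%O -> (s <= d)%O -> relint (cone t) x ->
  im d (cone s) (emb d x) -> (t <= s)%O.
Proof.
move=> td sd rx sx.
have ft : face (im d (cone t)) (cone d) := cinc_face td.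
have fs : face (im d (cone s)) (cone d) := cinc_face sd.
have cd := cone_cvx d.
have sub : im d (cone t) `<=` im d (cone s).
  exact: (relint_face_sub (face_cvx cd ft) cd (relint_emb td rx) (face_subset ft) fs sx).
have fts := face_restrict ft sub (face_subset fs).
have E := face_image_inv fts.
have : face [set y | cone s y /\ im d (cone t) (emb d y)] (cone s).
  by apply/(face_image _ _ (emb_inj sd)); rewrite -E.
case/face_tag => t' t's E'.
suff -> : t = t' by [].
apply: (tag_unique td (le_trans t's sd)); rewrite E.
by rewrite -(image_emb_comp _ t's sd) -E'.
Qed.

Lemma relint_tag_unique t s d x y : (t <= d)%O -> (s <= d)%O -> relint (cone t) x ->
  relint (cone s) y -> emb d x = emb d y -> t = s.
Proof.
move=> td sd rx ry e; apply/eqP; rewrite eq_le; apply/andP; split.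
  by apply: (tag_le td sd rx); rewrite e; exists y => //; case: ry.
by apply: (tag_le sd td ry); rewrite -e; exists x => //; case: rx.
Qed.

Lemma emb_integral t s x : (t <= s)%O ->
  integral (crk s) (emb s x) <-> integral (crk t) x.
Proof.
move=> ts; have [sub sat] := cinc_saturated ts; split=> ix; last first.
  by apply: sub; exists x.
have [k k0 ik] := scale_integral x.
have [|y iy yx] := sat (emb s x) k ix k0.
  by exists (x *+ k) => //; rewrite -[x *+ k]scaler_nat linZ scaler_nat.
by rewrite -(emb_inj ts yx).
Qed.

Lemma emb_lattice_inj t s : (t <= s)%O -> lattice_inj (cinc t s).
Proof. by move=> ts; split; [exact: emb_inj|move=> x; exact: emb_integral]. Qed.

(** ** Families of fans

   A subdivision of the complex is described by the fans that it induces on all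
   the cones at once; in this form subdividing at a point is the star subdivision
   of each fan at the image of the point. *)

Definition ffamily := forall s : S, set (set 'rV[rat]_(crk s)).
Implicit Types Phi : ffamily.

(** The last clause says that the fan on a face is the restriction of the fan on the
    cone. *)
Definition coherent Phi : Prop :=
  [/\ forall s, fan (Phi s),
      forall s C, Phi s C -> C `<=` cone s &
      forall t s (C : set 'rV[rat]_(crk t)), (t <= s)%O -> C `<=` cone t ->
        Phi t C <-> Phi s (im s C)].

Definition cells Phi : set (cell S) :=
  [set c | Phi (tag c) (tagged c) /\ relint (tagged c) `<=` relint (cone (tag c))].

Definition trace s V : set 'rV[rat]_(crk s) :=
  [set x | exists2 p, V p & (tag p <= s)%O /\ x = emb s (tagged p)].

Arguments trace s V : clear implicits.

Definition starF V Phi : ffamily := fun s => fstar (trace s V) (Phi s).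

Definition ipoints : set (cpoint S) :=
  [set p | relint (cone (tag p)) (tagged p) /\ integral _ (tagged p)].

Lemma trace_integral s V : V `<=` ipoints -> trace s V `<=` integral _.
Proof.
by move=> iV _ [p Vp [ps ->]]; apply/emb_integral => //; case: (iV p Vp).
Qed.

(** By [tag_le], the cone of a point that is visible in a face of [s] is itself a face of
    that face. *)
Lemma trace_emb t s V x : V `<=` ipoints -> (t <= s)%O -> cone t x ->
  trace s V (emb s x) <-> trace t V x.
Proof.
move=> iV ts tx; split=> -[p Vp [ps E]]; last first.
  exists p => //; split; first exact: le_trans ts.
  by rewrite E emb_comp.
have [rp _] := iV p Vp.
have pt : (tag p <= t)%O by apply: (tag_le ps ts rp); rewrite -E; exists x.
by exists p => //; split=> //; apply: (emb_inj ts); rewrite E emb_comp.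
Qed.

(** The tag of the cell is the smallest face of [s] containing an interior point of [C]. *)
Lemma coherent_cells Phi s C : coherent Phi -> Phi s C ->
  exists t (C0 : set 'rV[rat]_(crk t)),
    [/\ (t <= s)%O, cells Phi (existT _ t C0) & C = im s C0].
Proof.
move=> [fP sub comp] PC; have [rat fac fan3] := fP s.
have fC := rational_fg (rat _ PC); have cC := fg_cvx fC.
have [x rx] := relint_nonempty fC.
have [t [ts [y ry xE]]] := min_tag (sub _ _ PC _ (relint_subset rx)).
have ft : face (im s (cone t)) (cone s) := cinc_face ts.
have Ct : C `<=` im s (cone t).
  apply: (relint_face_sub cC (cone_cvx s) rx _ ft); first exact: sub.
  by exists y => //; case: ry.
pose C0 := [set z | cone t z /\ C (emb s z)].
have CE : C = im s C0.
  apply/seteqP; split; last by move=> _ [z [_ Cz] <-].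
  by move=> z Cz; have [w tw e] := Ct z Cz; exists w => //; split=> //; rewrite e.
have C0t : C0 `<=` cone t by move=> z [].
exists t, C0; split=> //; split; first by apply/(comp _ _ _ ts C0t); rewrite -CE.
have fC0 : fgcone C0 by apply: (lin_fg_inj (emb_inj ts)); rewrite -/(emb s) -CE.
apply: (@relint_relint_sub _ _ _ y (cone_fg t) (fg_cvx fC0) C0t) => //.
by apply/(relint_image _ (emb_inj ts) fC0); rewrite -/(emb s) -CE -/(emb s y) -xE.
Qed.

Lemma coherent_trace_face Phi t s D : coherent Phi -> (t <= s)%O -> Phi s D ->
  Phi s (D `&` im s (cone t)).
Proof.
move=> [fP sub _] ts PD; have [_ fac _] := fP s; apply: (fac _ _ PD).
have [u u0 FE] : face (im s (cone t)) (cone s) := cinc_face ts.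
exists u; first by move=> x /(sub _ _ PD)/u0.
rewrite FE; apply/seteqP; split=> x; first by case=> Dx [_ ux].
by case=> Dx ux; split=> //; split=> //; apply: sub Dx.
Qed.

Lemma preimage_embE t s (D : set 'rV[rat]_(crk s)) : D `<=` im s (cone t) ->
  exists2 C, C `<=` cone t & D = im s C.
Proof.
move=> Dt; exists [set x | cone t x /\ D (emb s x)]; first by move=> x [].
apply/seteqP; split; last by move=> _ [z [_ Cz] <-].
by move=> z Cz; have [w tw e] := Dt z Cz; exists w => //; split=> //; rewrite e.
Qed.

(** A new cone contained in the face [t] has its center and its link in [t]; the cone
    [d] of the star may be replaced by its intersection with [t]. *)
Lemma coherent_starF V Phi : coherent Phi -> V `<=` ipoints ->
  (forall s, separated (trace s V) (Phi s)) -> coherent (starF V Phi).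
Proof.
move=> cP iV sep; have [fP sub comp] := cP; split.
- by move=> s; apply: fan_fstar => //; apply: trace_integral.
- by move=> s C /(fstar_refines (fP s))[D /sub DD CD] x /CD/DD.
move=> t s C ts Ct; have inj := emb_inj ts.
have cv s' D : Phi s' D -> cvx D.
  by case: (fP s') => rat _ _ /rat/rational_fg/fg_cvx.
split.
  case=> [[PC VC]|[p [c [d [[Vp Pc Pd dp] [Vc cd CE]]]]]].
    left; split; first exact/(comp t s).
    by move=> _ /[swap] -[x Cx <-] /(trace_emb iV ts (Ct _ Cx))/VC.
  have dt := sub _ _ Pd; have ct := sub _ _ Pc.
  right; exists (emb s p), (im s c), (im s d); split; split.
  - by apply/(trace_emb iV ts) => //; apply: dt.
  - exact/(comp t s).
  - exact/(comp t s).
  - by exists p.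
  - by move=> _ /[swap] -[x cx <-] /(trace_emb iV ts (ct _ cx))/Vc.
  - by apply/(image_inj_sub _ _ inj).
  - by rewrite CE lin_msum lin_ray.
case=> [[PC VC]|[p' [c' [d' [[Vp Pc Pd dp] [Vc cd CE]]]]]].
  left; split; first exact/(comp t s).
  move=> x Vx Cx; apply: (VC (emb s x)); last by exists x.
  by apply/(trace_emb iV ts) => //; apply: Ct.
have [p tp pE] : im s (cone t) p'.
  have : (im s C) p' by rewrite CE; apply/msum_ray_self/(cv s).
  by case=> x /Ct tx <-; exists x.
have c't : c' `<=` im s (cone t).
  move=> x cx; have : (im s C) x by rewrite CE; apply: msum_ray_incl.
  by case=> y /Ct ty <-; exists y.
have [c ct cE] := preimage_embE c't.
have [d dt dE] := @preimage_embE t s (d' `&` im s (cone t)) (@subIsetr _ _ _).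
right; exists p, c, d; split; split.
- by apply/(trace_emb iV ts tp); rewrite pE.
- by apply/(comp t s) => //; rewrite -cE.
- by apply/(comp t s) => //; rewrite -dE; apply: coherent_trace_face.
- apply/(image_injE _ _ inj); rewrite -/(emb s) -dE -/(emb s p) pE; split=> //.
  by rewrite -pE; exists p.
- move=> q Vq cq; apply: (Vc (emb s q)); first by apply/(trace_emb iV ts) => //; apply: ct.
  by rewrite cE; exists q.
- apply/(image_inj_sub _ _ inj); rewrite -/(emb s) -dE -cE => x cx.
  by split; [exact: cd|exact: c't].
by apply: (image_inj_eq inj); rewrite lin_msum lin_ray -/(emb s) -/(emb s p) pE -cE.
Qed.

End Complexes.
Arguments trace {S} s V _.
Arguments ipoints S _ : clear implicits.


Notation im s C := (emb s @` C).

Section StarOfCells.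
Variable S : conical_complex.
Implicit Types (s t d : S) (p q : cpoint S) (V : set (cpoint S)) (c e : cell S).
Implicit Types Phi : ffamily S.

Lemma point_inj s p q : (tag p <= s)%O -> (tag q <= s)%O ->
  relint (cone (tag p)) (tagged p) -> relint (cone (tag q)) (tagged q) ->
  emb s (tagged p) = emb s (tagged q) -> p = q.
Proof.
case: p q => [t x] [t' y] /= ts t's rx ry e.
have tt := relint_tag_unique ts t's rx ry e.
move: y t's ry e; rewrite -tt => y _ _ e.
by rewrite (emb_inj ts e).
Qed.

Lemma cell_intP c p : cell_int c p ->
  exists2 C, c = existT _ (tag p) C & relint C (tagged p).
Proof. by case: c => t C [v rv <-]; exists C. Qed.

Lemma cell_int_intro p (T : set 'rV[rat]_(crk (tag p))) :
  relint T (tagged p) -> cell_int (existT _ (tag p) T) p.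
Proof. by case: p T => s x T rx; exists x. Qed.

Lemma eq_cells Phi Psi : (forall s, Phi s = Psi s) -> cells Phi = cells Psi.
Proof. by move=> e; rewrite /cells; apply/seteqP; split=> c /=; rewrite e. Qed.

Lemma cells_sub Phi c : coherent Phi -> cells Phi c -> tagged c `<=` cone (tag c).
Proof. by move=> [_ sub _] [Pc _]; apply: sub. Qed.

Lemma cells_im Phi s c : coherent Phi -> cells Phi c -> (tag c <= s)%O ->
  Phi s (im s (tagged c)).
Proof.
move=> cP Kc cs; have [_ _ comp] := cP; apply/(comp _ _ _ cs); last by case: Kc.
exact: cells_sub Kc.
Qed.

Lemma cells_relint Phi c : coherent Phi -> cells Phi c ->
  exists2 x, relint (tagged c) x & relint (cone (tag c)) x.
Proof.
move=> [fP _ _] [Pc rc]; have [rat _ _] := fP (tag c).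
by have [x rx] := relint_nonempty (rational_fg (rat _ Pc)); exists x => //; apply: rc.
Qed.

Lemma cells_intro Phi p T : coherent Phi -> Phi (tag p) T -> relint T (tagged p) ->
  relint (cone (tag p)) (tagged p) -> cells Phi (existT _ (tag p) T).
Proof.
move=> [fP sub _] PT rT rp; split=> //=.
apply: (relint_relint_sub (cone_fg _) _ (sub _ _ PT) rT rp).
by case: (fP (tag p)) => rat _ _; apply/fg_cvx/rational_fg/rat.
Qed.

(** Membership in the star is read off in any cone [s] that contains the cell: it means
    that the cell contains the point. *)
Lemma cell_mem_star Phi s p T c : coherent Phi -> relint (cone (tag p)) (tagged p) ->
  Phi (tag p) T -> relint T (tagged p) -> cells Phi c ->
  (tag c <= s)%O -> (tag p <= s)%O ->
  im s (tagged c) (emb s (tagged p)) <-> cell_face (existT _ (tag p) T) c.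
Proof.
move=> cP rp PT rT Kc cs ps; have [fP sub comp] := cP; split.
  move=> h; have pc : (tag p <= tag c)%O.
    by apply: (tag_le ps cs rp); case: h => x /(cells_sub cP Kc) cx <-; exists x.
  split=> //=; have [_ _ fan3] := fP (tag c).
  have cp : tagged c (emb (tag c) (tagged p)).
    by case: h => x cx; rewrite -(emb_comp _ pc cs) => /(emb_inj cs) <-.
  apply: (fan3 _ _ (emb (tag c) (tagged p))) => //.
  - by apply/(comp _ _ _ pc) => //; apply: sub.
  - by case: Kc.
  have [rat _ _] := fP (tag p).
  by apply/(relint_image _ (emb_inj pc) (rational_fg (rat _ PT))).
case=> /= pc /face_subset h; exists (emb (tag c) (tagged p)).
  by apply: h; exists (tagged p) => //; case: rT.
by rewrite emb_comp.
Qed.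

Lemma cell_face_sub Phi c e : coherent Phi -> cells Phi c -> cells Phi e ->
  (tag c <= tag e)%O -> im (tag e) (tagged c) `<=` tagged e -> cell_face c e.
Proof.
move=> cP Kc Ke ce sub; split=> //; have [fP _ _] := cP.
by apply: (fan_subset_face (fP _)) => //; [apply: cells_im|case: Ke].
Qed.

Lemma trace_set1 s p x : trace s [set p] x <-> (tag p <= s)%O /\ x = emb s (tagged p).
Proof. by split=> [[_ -> []//]|[ps ->]]; exists p. Qed.

(** A new cell is formed inside a cell [d] of the star whose cone may be larger than the
    smallest cone containing the new cell. Intersecting [d] with the latter gives a
    cone of the star inside it; conversely a cone that contains the new one and lies in
    [s] has [s] as its smallest cone. *)
Lemma star_cells Phi p T : coherent Phi -> relint (cone (tag p)) (tagged p) ->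
  Phi (tag p) T -> relint T (tagged p) ->
  star_subdivision p (cells Phi) = cells (starF [set p] Phi).
Proof.
move=> cP rp PT rT; have [fP sub comp] := cP.
pose t : cell S := existT _ (tag p) T.
have fgP s C : Phi s C -> fgcone C by case: (fP s) => rat _ _ /rat/rational_fg.
have cvP s C : Phi s C -> cvx C by move=> /fgP/fg_cvx.
have Kt : cells Phi t by apply: cells_intro.
apply/seteqP; split=> e.
  case=> t' [Kt' /cell_intP[T' tE rT']].
  have TT : T' = T.
    by apply: (fan_eq (fP (tag p)) _ PT rT' rT); move: Kt'; rewrite tE => -[].
  rewrite {t' Kt'}tE {}TT {T' rT'} -/t => -[[Ke nS]|].
    split; last by case: Ke.
    left; split; first by case: Ke.
    move=> x /trace_set1[pe ->] ex; apply: nS; split=> //.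
    by apply/(cell_mem_star cP rp PT rT Ke (lexx _) pe); rewrite image_emb_id.
  case=> c [d [[Kc _ nSc] [Kd Sd] fcd [ed re E]]].
  have pd : (tag p <= tag d)%O by case: Sd.
  have dp : tagged d (emb (tag d) (tagged p)).
    by move/(cell_mem_star cP rp PT rT Kd (lexx _) pd): Sd; rewrite image_emb_id.
  have cd : (tag c <= tag d)%O by case: fcd.
  have cdd : im (tag d) (tagged c) `<=` tagged d by case: fcd => _ /face_subset.
  have [Pd _] := Kd; have [Pc _] := Kc.
  have {}E : im (tag d) (tagged e) =
      msum (ray (emb (tag d) (tagged p))) (im (tag d) (tagged c)) by [].
  have Ed : im (tag d) (tagged e) `<=` tagged d.
    by rewrite E; apply: msum_ray_sub => //; apply: cvP Pd.
  have fgE : fgcone (tagged e).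
    apply: (lin_fg_inj (emb_inj ed)); rewrite -/(emb _) E.
    have [s sE] := fgP _ _ (cells_im cP Kc cd).
    by exists (emb (tag d) (tagged p) :: s); rewrite cone_cons -sE.
  have Es : im (tag d) (tagged e) `<=` im (tag d) (cone (tag e)).
    have [x rx] := relint_nonempty fgE.
    apply: (@relint_face_sub _ _ _ (cone (tag d)) (emb (tag d) x)).
    - exact/fg_cvx/lin_fg.
    - exact: cone_cvx.
    - exact/(relint_image _ (emb_inj ed)).
    - by move=> y /Ed/(sub _ _ Pd).
    - exact: cinc_face.
    by exists x => //; case: (re x rx).
  have Ep : im (tag d) (tagged e) (emb (tag d) (tagged p)).
    by rewrite E; apply/msum_ray_self/(cvP _ _ (cells_im cP Kc cd)).
  have pe : (tag p <= tag e)%O by apply: (tag_le pd ed rp); apply: Es.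
  have ce : (tag c <= tag e)%O.
    have [x rx rx'] := cells_relint cP Kc.
    apply: (tag_le cd ed rx'); apply: Es; rewrite E; apply: msum_ray_incl.
    by exists x => //; case: rx.
  split=> //; right.
  have [D Ds DE] := @preimage_embE _ (tag e) _
    (tagged d `&` im (tag d) (cone (tag e))) (@subIsetr _ _ _).
  have PD : Phi (tag e) D.
    by apply/(comp _ _ _ ed Ds); rewrite -DE; apply: coherent_trace_face.
  have inj := emb_inj ed.
  exists (emb (tag e) (tagged p)), (im (tag e) (tagged c)), D; split; split.
  - exact/trace_set1.
  - exact: cells_im.
  - by [].
  - apply/(image_injE _ _ inj); rewrite -/(emb _) -DE -/(emb _ (emb _ _)) emb_comp //.
    by split=> //; apply: Es.
  - move=> _ /trace_set1[_ ->] /(cell_mem_star cP rp PT rT Kc ce pe) h.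
    by apply: nSc.
  - apply/(image_inj_sub _ _ inj); rewrite -/(emb _) -DE image_emb_comp // => x cx.
    split; first exact: cdd.
    by apply: Es; rewrite E; apply: msum_ray_incl.
  apply: (image_inj_eq inj); rewrite -/(emb _) E lin_msum lin_ray.
  by rewrite -/(emb (tag d)) image_emb_comp // -/(emb (tag d) (emb _ _)) emb_comp.
case: e => s E [/= PE rE]; exists t; split=> //.
  exact: cell_int_intro.
case: PE => [[PE nE]|[_ [c1 [d1 [[/trace_set1[ps ->] Pc Pd dp] [nc cd EE]]]]]].
  left; split=> // -[Ke Sd]; have [/= ps _] := Sd.
  apply: (nE (emb s (tagged p))); first exact/trace_set1.
  by have := (cell_mem_star cP rp PT rT Ke (lexx s) ps).2 Sd; rewrite image_emb_id.
have [tc [c [cs Kc cE]]] := coherent_cells cP Pc.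
have [td [d [ds Kd dE]]] := coherent_cells cP Pd.
have Ed1 : E `<=` d1 by rewrite EE; apply: msum_ray_sub => //; apply: cvP Pd.
have sd : (s <= td)%O.
  have fgE : fgcone E.
    by have [v vE] := fgP _ _ Pc; exists (emb s (tagged p) :: v); rewrite EE cone_cons vE.
  have [x rx] := relint_nonempty fgE.
  apply: (tag_le (lexx s) ds (rE x rx)); rewrite emb_id.
  by have := Ed1 _ (relint_subset rx); rewrite dE => -[y /(cells_sub cP Kd) dy <-]; exists y.
have tds : td = s by apply/eqP; rewrite eq_le ds sd.
move: d ds Kd dE {sd}; rewrite {td}tds => d _ Kd; rewrite image_emb_id => dE.
have Sd : cell_face t (existT _ s d).
  by apply/(cell_mem_star cP rp PT rT Kd (lexx s) ps); rewrite image_emb_id /= -dE.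
have fcd : cell_face (existT _ tc c) (existT _ s d).
  by apply: (cell_face_sub cP Kc Kd) => //=; rewrite -cE -dE.
right; exists (existT _ tc c), (existT _ s d); split=> //.
  split=> //; first by exists (existT _ s d).
  move=> [_ Sc]; apply: (nc (emb s (tagged p))); first exact/trace_set1.
  by rewrite cE; apply/(cell_mem_star cP rp PT rT Kc cs ps).
by split=> //=; rewrite -/(emb s) image_emb_id EE cE.
Qed.

Lemma foldr_star_cells Phi l : coherent Phi -> uniq l ->
  (forall p, p \in l -> ipoints S p /\ exists2 T, Phi (tag p) T & relint T (tagged p)) ->
  (forall s, separated (trace s [set` l]) (Phi s)) ->
  foldr (@star_subdivision S) (cells Phi) l = cells (starF [set` l] Phi).
Proof.
move=> cP; have [fP sub comp] := cP; elim: l => [_ _ _|p l IH /= /andP[pl ul] hl sep].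
  apply: eq_cells => s; rewrite /starF -[LHS](fstar_set0 (Phi s)); congr (fstar _ _).
  by apply/seteqP; split=> // x [p].
have tl s : trace s [set` l] `<=` trace s [set` p :: l].
  by move=> x [q /= ql h]; exists q => //=; rewrite inE ql orbT.
have sepl s : separated (trace s [set` l]) (Phi s).
  by move=> C x y PC /tl Vx /tl Vy; apply: (sep s).
have hl' q : q \in l -> ipoints S q /\ exists2 T, Phi (tag q) T & relint T (tagged q).
  by move=> ql; apply: hl; rewrite inE ql orbT.
rewrite {}IH //; have [[rp ip] [T PT rT]] := hl p (mem_head _ _).
have il : [set` l] `<=` ipoints S by move=> q /hl'[].
have ntr s : (tag p <= s)%O -> ~ trace s [set` l] (emb s (tagged p)).
  move=> ps [q /= ql [qs e]]; have [[rq _] _] := hl' q ql.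
  by move: pl; rewrite (point_inj ps qs rp rq e) ql.
have trp : trace (tag p) [set` p :: l] (tagged p).
  by exists p; rewrite /= ?mem_head // emb_id.
rewrite (@star_cells _ p T) //; first last.
- left; split=> // x xl Tx; apply: (ntr (tag p)) => //; rewrite emb_id.
  suff -> : tagged p = x by [].
  by apply: (sep _ T) => //; [apply: tl|case: rT].
- exact: coherent_starF.
apply: eq_cells => s; rewrite /starF.
have trE : trace s [set` p :: l] = trace s [set p] `|` trace s [set` l].
  apply/seteqP; split=> x.
    case=> q /=; rewrite inE => /predU1P[->|ql] h; first by left; exists p.
    by right; exists q.
  by case=> [[_ -> h]|/tl//]; exists p => //=; rewrite mem_head.
have [ps|nps] := boolP (tag p <= s)%O; last first.
  have e0 : trace s [set p] = set0.
    by apply/seteqP; split=> // x /trace_set1[ps]; rewrite ps in nps.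
  by rewrite trE e0 set0U fstar_set0.
have e1 : trace s [set p] = [set emb s (tagged p)].
  by apply/seteqP; split=> x; [case/trace_set1|move=> ->; apply/trace_set1].
rewrite trE e1 fstar_setU1 //; last exact: ntr.
by rewrite -e1 -trE.
Qed.

(** The centers are subdivided one point after the other, but since their stars are
    disjoint the outcome is described by a single formula. *)
Lemma center_cells Phi V : coherent Phi -> finite_set V -> V `<=` ipoints S ->
  (forall p, V p -> exists2 T, Phi (tag p) T & relint T (tagged p)) ->
  (forall s, separated (trace s V) (Phi s)) ->
  center_subdivision (cells Phi) V = cells (starF V Phi).
Proof.
move=> cP fV iV hV sep; rewrite /center_subdivision -{2}(fset_setK fV).
have inV p : p \in fset_set V -> V p by rewrite in_fset_set // inE.
apply: foldr_star_cells => //; first exact: fset_uniq.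
  by move=> p /inV Vp; split; [apply: iV|apply: hV].
by rewrite fset_setK.
Qed.

End StarOfCells.

(** * Splitting off a regular ray *)

Section Splittings.
Variable n : nat.
Implicit Types (C A B : set 'rV[rat]_n) (s : seq 'rV[rat]_n) (u : 'cV[rat]_n).
Implicit Types (v x : 'rV[rat]_n).

(** [C] is the product of its face [u = 0] and of the ray of [v], compatibly with
    the lattices. *)
Definition splits C v u : Prop :=
  [/\ C v, integral n v, intu u, ev u v = 1 &
      forall x, C x -> 0 <= ev u x /\ C (x - ev u x *: v)].

Lemma splits_reducible C v u : rational_cone C -> lspan C = setT ->
  splits C v u -> ~ irreducible C.
Proof.
move=> rC fC [Cv iv iu uv hC]; apply.
have cC := fg_cvx (rational_fg rC); have [_ CD CZ] := cC.
have fA : face [set x | C x /\ ev u x = 0] C by exists u => // x /hC[].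
have ru x : lspan (ray v) x -> x = ev u x *: v.
  case=> _ /rayP[a _ ->] [_ /rayP[b _ ->] <-].
  by rewrite evB !evZ uv !mulr1 scalerBl.
have la x : lspan [set x | C x /\ ev u x = 0] (x - ev u x *: v).
  have : lspan C x by rewrite fC.
  case=> y Cy [z Cz <-]; have [_ h1] := hC y Cy; have [_ h2] := hC z Cz.
  exists (y - ev u y *: v); first by split; rewrite // evB evZ uv mulr1 subrr.
  exists (z - ev u z *: v); first by split; rewrite // evB evZ uv mulr1 subrr.
  by rewrite evB scalerBl !opprD !opprK !addrA; congr (_ + _); rewrite addrAC.
have la0 x : lspan [set x | C x /\ ev u x = 0] x -> ev u x = 0.
  by case=> y [_ y0] [z [_ z0] <-]; rewrite evB y0 z0 subrr.
exists [set x | C x /\ ev u x = 0], (ray v); split; last first.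
- move=> r0; have : ray v v := ray_self v.
  by rewrite r0 => /= v0; move: uv; rewrite v0 ev0.
- apply/regularP; exists [:: v] => //; split.
  + by rewrite seq1_free; apply: contra_eq_neq uv => ->; rewrite ev0 eq_sym oner_neq0.
  + by move=> w; rewrite inE => /eqP ->.
  move=> c; rewrite /comb big_seq1 => ic w; rewrite inE => /eqP ->.
  by have := ev_int iu ic; rewrite evZ uv mulr1.
split.
- exact: face_rational fA.
- by exists [:: v] => // w; rewrite inE => /eqP ->.
- apply/seteqP; split=> x.
    move=> Cx; have [u0 h] := hC x Cx; exists (x - ev u x *: v).
      by split; rewrite // evB evZ uv mulr1 subrr.
    by exists (ev u x *: v); [apply/rayP; exists (ev u x)|rewrite subrK].
  case=> y [Cy _] [_ /rayP[a a0 ->] <-]; apply: CD => //; exact: CZ.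
- apply/seteqP; split=> x.
    by case=> /la0 x0 /ru; rewrite x0 scale0r.
  have [C0 _ _] := cC.
  move=> ->; split; first by exists 0; [|exists 0]; rewrite ?subr0 //; split=> //; exact: ev0.
  exists 0; last exists 0; rewrite ?subr0 //;
    by apply/rayP; exists 0; rewrite ?scale0r.
apply/seteqP; split=> x.
  case=> ix _; have iux := ev_int iu ix.
  exists (x - ev u x *: v).
    by split; [apply: integralB => //; apply: integralZ|exact: la].
  exists (ev u x *: v); last by rewrite subrK.
  split; first exact: integralZ.
  have [u0|u0] := leP 0 (ev u x).
    exists (ev u x *: v); first by apply/rayP; exists (ev u x).
    by exists 0; [apply/rayP; exists 0; rewrite ?scale0r|rewrite subr0].
  exists 0; first by apply/rayP; exists 0; rewrite ?scale0r.
  exists ((- ev u x) *: v); last by rewrite sub0r scaleNr opprK.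
  by apply/rayP; exists (- ev u x); rewrite // oppr_ge0 ltW.
case=> y [iy _] [z [iz _] <-]; split; first exact: integralD.
by rewrite fC.
Qed.

(** The vector is an element of a basis generating the regular factor, and the functional
    is the corresponding coordinate. It is integral since the lattice is the direct sum
    of those of the factors. *)
Lemma reducible_splits C : rational_cone C -> lspan C = setT ->
  ~ irreducible C -> exists v u, splits C v u.
Proof.
move=> rC fC /contrapT[A [B [[[s sA AE] rB CE ldir lat] regB B0]]].
have [bs ub BE] := (regularP B).1 regB; have [fb ib hb] := ub.
have Ub := free_uniq fb.
have cA : cvx A by rewrite AE; apply: cvx_cone_gen.
have cB : cvx B by rewrite BE; apply: cvx_cone_gen.
have [b bin] : exists b, b \in bs.
  case: bs BE {ub fb ib hb Ub} => [|b bs] BE; last by exists b; rewrite mem_head.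
  by case: B0; rewrite BE cone_nil.
pose X := vbasis <<s>>%VS.
have sX : (<<X>> = <<s>>)%VS by apply: span_basis; apply: vbasisP.
have fX : free X by apply: basis_free; apply: vbasisP.
have fXb : free (X ++ bs).
  rewrite cat_free fX fb /=; apply/directv_addP.
  apply/eqP; rewrite -subv0; apply/subvP => x /memv_capP[xX xb].
  have : (lspan A `&` lspan B) x.
    by rewrite AE BE !lspan_span; split=> //=; rewrite -sX.
  by rewrite ldir => ->; rewrite mem0v.
have [u uE] := free_functional (fun w => (w == b)%:R) fXb.
have u0A x : lspan A x -> ev u x = 0.
  rewrite AE lspan_span /= -sX => /(span_comb (free_uniq fX))[c ->].
  rewrite ev_comb big_seq big1 // => w wX.
  rewrite uE ?mem_cat ?wX //; case: eqP => [wb|]; last by rewrite mulr0.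
  by have := free_uniq fXb; rewrite cat_uniq => /and3P[_ /hasPn/(_ b bin) /=]; rewrite -wb wX.
have ub1 : ev u b = 1 by rewrite uE ?eqxx // mem_cat bin orbT.
have ubc c : ev u (comb bs c) = c b.
  apply: ev_dual_comb => // w wb /negPf nb.
  by rewrite uE ?nb // mem_cat wb orbT.
have latC x : integral n x -> lattice C x by move=> ix; split=> //; rewrite fC.
have [A0 AD AZ] := cA; have [B0' BD BZ] := cB.
exists b, u; split=> //.
- rewrite CE; exists 0 => //; exists b; last by rewrite add0r.
  by rewrite BE; apply: mem_cone_gen.
- exact: ib.
- apply: intu_ev => x /latC; rewrite lat => -[a [_ /u0A a0] [z [iz lz] <-]].
  move: lz; rewrite evD a0 add0r BE lspan_span /= => /(span_comb Ub)[c zE].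
  by rewrite zE in iz *; rewrite ubc; apply: hb.
move=> x; rewrite CE => -[a Aa [y By <-]].
have a0 : ev u a = 0 by apply: u0A; apply: cvx_lspan.
rewrite evD a0 add0r; move: By; rewrite BE => /(cone_gen_combP Ub)[c c0 ->].
rewrite ubc; split; first exact: c0.
exists a => //; exists (comb bs c - c b *: b); last by rewrite addrA.
have -> : comb bs c - c b *: b = comb bs (fun w => c w - c b * (w == b)%:R).
  by rewrite -combB -combZ comb_indic.
apply: cone_gen_comb => w wb.
rewrite subr_ge0; have [->|_] := eqVneq w b; first by rewrite mulr1.
by rewrite mulr0 c0.
Qed.

End Splittings.

(** * Sequences of centers *)

Section Sequences.
Variable S : conical_complex.
Implicit Types (s t d : S) (p q : cpoint S) (V : set (cpoint S)).
Implicit Types (Vs : seq (set (cpoint S))).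

Definition base : ffamily S := fun s => [set F | face F (cone s)].

Arguments base s : clear implicits.

(** The fans induced on the cones by the subdivision with centers [Vs]. *)
Definition loc Vs : ffamily S := foldl (fun Phi V => starF V Phi) base Vs.

Arguments loc Vs s : clear implicits.

Lemma loc_rcons Vs V : loc (rcons Vs V) = starF V (loc Vs).
Proof. exact: foldl_rcons. Qed.

Lemma coherent_base : coherent base.
Proof.
split.
- by move=> s; apply: fan_faces; apply: cone_rational.
- by move=> s C; apply: face_subset.
move=> t s C ts Ct; split=> fC.
  apply: (face_trans (cone_fg s) (cinc_face ts)).
  exact/(face_image _ _ (emb_inj ts)).
apply/(face_image _ _ (emb_inj ts)); apply: (face_restrict fC).
  exact/(image_inj_sub _ _ (emb_inj ts)).
exact: face_subset (cinc_face ts).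
Qed.

Lemma cells_base : cells base = @cells_of S.
Proof.
apply/seteqP; split=> [[s C] [/= fC rC]|_ [s _ <-]]; last by split=> //; apply: face_refl.
exists s => //; rewrite /to_cell; suff -> : cone s = C by [].
have [x rx] := relint_nonempty (face_fg (cone_fg s) fC).
apply/seteqP; split; last exact: face_subset fC.
apply: (relint_face_sub (cone_cvx s) (cone_cvx s) (rC x rx) _ fC) => //.
by case: rx.
Qed.

(** The second clause is stronger than what star subdivisions require: [loc_splits] and
    [loc_regular] depend on it. *)
Definition centered Vs V : Prop :=
  [/\ finite_set V, V `<=` support_of (sing S),
      forall p, V p -> primitive (tagged p),
      forall p, V p -> exists2 T, loc Vs (tag p) T & relint T (tagged p) &
      forall s, separated (trace s V) (loc Vs s)].

Definition stagewise (P : seq (set (cpoint S)) -> set (cpoint S) -> Prop) Vs : Prop :=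
  forall i, (i < size Vs)%N -> P (take i Vs) (nth set0 Vs i).

Lemma stagewise_rcons P Vs V :
  stagewise P (rcons Vs V) <-> stagewise P Vs /\ P Vs V.
Proof.
split=> [h|[h hV]].
  split=> [i iV|]; last first.
    have := h (size Vs); rewrite size_rcons ltnSn nth_rcons ltnn eqxx.
    by rewrite -cats1 take_size_cat //; apply.
  have := h i; rewrite size_rcons ltnW // nth_rcons iV -cats1 takel_cat 1?ltnW //.
  by apply.
move=> i; rewrite size_rcons ltnS leq_eqVlt => /predU1P[->|iV].
  by rewrite nth_rcons ltnn eqxx -cats1 take_size_cat.
by rewrite nth_rcons iV -cats1 takel_cat 1?ltnW //; apply: h.
Qed.

Definition admissible : seq (set (cpoint S)) -> Prop := stagewise centered.

Lemma admissible_rcons Vs V :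
  admissible (rcons Vs V) <-> admissible Vs /\ centered Vs V.
Proof. exact: stagewise_rcons. Qed.

Lemma centered_ipoints Vs V : centered Vs V -> V `<=` ipoints S.
Proof. by move=> [_ sV pV _ _] p Vp; split; [case: (sV p Vp)|case: (pV p Vp)]. Qed.

Lemma admissible_coherent Vs : admissible Vs -> coherent (loc Vs).
Proof.
elim/last_ind: Vs => [_|Vs V IH /admissible_rcons[/IH cP cV]]; first exact: coherent_base.
rewrite loc_rcons; apply: coherent_starF => //; first exact: centered_ipoints cV.
by case: cV.
Qed.

Lemma admissible_cells Vs : admissible Vs ->
  foldl (@center_subdivision S) (@cells_of S) Vs = cells (loc Vs).
Proof.
elim/last_ind: Vs => [_|Vs V IH /admissible_rcons[adm cV]]; first exact/esym/cells_base.
rewrite foldl_rcons IH // loc_rcons; have [fV _ _ TV sepV] := cV.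
by apply: center_cells => //; [apply: admissible_coherent|apply: centered_ipoints cV].
Qed.

Lemma admissible_take Vs i : admissible Vs -> admissible (take i Vs).
Proof.
move=> adm j; rewrite size_take_min leq_min => /andP[ji jV].
by rewrite nth_take // take_takel 1?ltnW //; apply: adm.
Qed.

Lemma subdividedE Vs i : admissible Vs -> subdivided Vs i = cells (loc (take i Vs)).
Proof. by move=> adm; apply/admissible_cells/admissible_take. Qed.

Lemma centered_is_center Vs V : admissible Vs -> centered Vs V ->
  is_center (cells (loc Vs)) V.
Proof.
move=> adm cV; have cP := admissible_coherent adm.
have iV := centered_ipoints cV; have [fV sV pV TV sepV] := cV.
split=> // [p Vp|].
  split; first exact: pV.
  have [T PT rT] := TV p Vp; exists (existT _ (tag p) T); last exact: cell_int_intro.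
  by apply: cells_intro => //; case: (iV p Vp).
move=> p q t u Vp Vq pq Kt Ku /cell_intP[T tE rT] /cell_intP[U uE rU].
apply/seteqP; split=> // e [[Ke Se] [_ Se']].
rewrite tE in Se Kt; rewrite uE in Se' Ku.
have [pe qe] := (proj1 Se, proj1 Se'); case: pq.
have [[rp _] [rq _]] := (iV p Vp, iV q Vq).
apply: (point_inj pe qe rp rq); apply: (sepV (tag e) (tagged e)).
- by case: Ke.
- by exists p.
- by exists q.
- have := (cell_mem_star cP rp Kt.1 rT Ke (lexx _) pe).2 Se; by rewrite image_emb_id.
by have := (cell_mem_star cP rq Ku.1 rU Ke (lexx _) qe).2 Se'; rewrite image_emb_id.
Qed.

(** ** Regular faces and splittings in a complex *)

Lemma unimod_emb t s (l : seq 'rV[rat]_(crk t)) : (t <= s)%O ->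
  unimod [seq emb s v | v <- l] <-> unimod l.
Proof. by move=> ts; apply/unimod_lin/emb_lattice_inj. Qed.

Lemma preimage_seq t s (l : seq 'rV[rat]_(crk s)) : (t <= s)%O ->
  {in l, forall v, im s (cone t) v} ->
  exists2 k, {in k, forall v, cone t v} & l = [seq emb s v | v <- k].
Proof.
move=> ts; elim: l => [_|v l IH h]; first by exists [::].
have [|k hk ->] := IH; first by move=> w wl; apply: h; rewrite inE wl orbT.
have [w tw <-] := h v (mem_head _ _); exists (w :: k) => //.
by move=> x; rewrite inE => /predU1P[->|/hk].
Qed.

Lemma regular_face t s : (t <= s)%O -> regular (cone s) -> regular (cone t).
Proof.
move=> ts /regularP[l ul sE].
have [u u0] : face (im s (cone t)) (cone s) := cinc_face ts.
have ul0 : {in l, forall v, 0 <= ev u v}.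
  by move=> v vl; apply: u0; rewrite sE; apply: mem_cone_gen.
rewrite {1}sE => E; have {E} : im s (cone t) = cone_gen [seq v <- l | ev u v == 0].
  by rewrite E; apply: face_filter.
set l' := [seq v <- l | _] => E.
have ul' : unimod l' by apply: unimod_filter.
have [k hk kE] : exists2 k, {in k, forall v, cone t v} & l' = [seq emb s v | v <- k].
  by apply: preimage_seq => // v vl; rewrite E; apply: mem_cone_gen.
apply/regularP; exists k; first by apply/(unimod_emb _ ts); rewrite -kE.
apply: (image_inj_eq (emb_inj ts)); rewrite -/(emb s) E kE.
by rewrite -lin_cone_gen.
Qed.

(** If the functional does not vanish on the face [t], then [t] contains a positive
    multiple of [v] by extremality, so that the product decomposition restricts to it. *)
Lemma splits_restrict t s v u x : (t <= s)%O -> splits (cone s) v u -> cone t x ->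
  ev u (emb s x) != 0 -> exists2 v', emb s v' = v & splits (cone t) v' (cinc t s *m u).
Proof.
move=> ts [sv iv iu uv hs] tx ux0; have inj := emb_inj ts.
have fF : face (im s (cone t)) (cone s) := cinc_face ts.
have cF := face_cvx (cone_cvx s) fF; have [_ _ FZ] := cF.
have sub y : cone t y -> cone s (emb s y) by move=> ty; apply: (face_subset fF); exists y.
have [ux hx] := hs _ (sub x tx).
have [v' tv' v'E] : im s (cone t) v.
  have : im s (cone t) (ev u (emb s x) *: v).
    apply: (face_extreme (y := emb s x - ev u (emb s x) *: v) fF) => //.
      by case: (cone_cvx s) => _ _; apply.
    by rewrite addrC subrK; exists x.
  move/(FZ (ev u (emb s x))^-1); rewrite scalerA mulVf // scale1r; apply.
  by rewrite invr_ge0.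
have evE y : ev (cinc t s *m u) y = ev u (emb s y) by rewrite -ev_lin.
exists v' => //; split=> //.
- by apply/(emb_integral _ ts); rewrite v'E.
- by apply: intu_ev => x0 ix0; rewrite evE; apply: ev_int => //; apply/(emb_integral _ ts).
- by rewrite evE v'E.
move=> y ty; have [uy hy] := hs _ (sub y ty); rewrite evE; split=> //.
apply/(image_injE _ _ inj); rewrite linB linZ -/(emb s y) -/(emb s v') v'E.
apply: (face_extreme (y := ev u (emb s y) *: v) fF) => //.
  by case: (cone_cvx s) => _ _; apply.
by rewrite subrK; exists y.
Qed.

Lemma cone_irreducible s : irreducible (cone s) <-> ~ exists v u, splits (cone s) v u.
Proof.
split=> [irr [v [u h]]|h].
  exact: (splits_reducible (cone_rational s) (cone_full_dim s) h).
apply: contrapT => nirr; apply: h.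
exact: (reducible_splits (cone_rational s) (cone_full_dim s) nirr).
Qed.

(** Centers in irreducible cones preserve product decompositions: their points have
    no component along a regular factor. *)
Lemma loc_splits Vs s v u C : admissible Vs -> splits (cone s) v u -> loc Vs s C ->
  forall x, C x -> C (x - ev u x *: v) /\ (ev u x != 0 -> C v).
Proof.
move=> adm sp; elim/last_ind: Vs adm C => [_ C fC x Cx|Vs V IH].
  have [sv _ _ _ hs] := sp; have cC := face_cvx (cone_cvx s) fC; have [_ _ CZ] := cC.
  have [ux hx] := hs x (face_subset fC Cx).
  have svx : cone s (ev u x *: v) by case: (cone_cvx s) => _ _; apply.
  split; first by apply: (face_extreme (y := ev u x *: v) fC); rewrite ?subrK.
  move=> ux0; have : C (ev u x *: v).
    by apply: (face_extreme (y := x - ev u x *: v) fC); rewrite // addrC subrK.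
  move/(CZ (ev u x)^-1); rewrite scalerA mulVf // scale1r; apply.
  by rewrite invr_ge0.
move=> /admissible_rcons[adm cV] C; rewrite loc_rcons; have {}IH := IH adm.
case=> [[/IH//]|[_ [c [d [[[p Vp [ps ->]] lc ld _] [_ _ ->]]]]]].
have up : ev u (emb s (tagged p)) = 0.
  have [_ sV _ _ _] := cV; have [[irr _] rp] := sV p Vp.
  apply/eqP/negPn/negP => /(splits_restrict ps sp (relint_subset rp))[v' _ sp'].
  by case/cone_irreducible: irr; exists v', (cinc (tag p) s *m u).
move=> _ [_ /rayP[a a0 ->] [y cy <-]].
rewrite evD evZ up mulr0 add0r; have [h1 h2] := IH c lc y cy; split.
  exists (a *: emb s (tagged p)); first by apply/rayP; exists a.
  by exists (y - ev u y *: v); rewrite ?addrA.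
by move/h2; apply: msum_ray_incl.
Qed.

(** A regular cone has no irreducible singular faces, so no center meets it. *)
Lemma loc_regular Vs s : admissible Vs -> regular (cone s) -> loc Vs s = base s.
Proof.
move=> adm rs; elim/last_ind: Vs adm => [//|Vs V IH] /admissible_rcons[/IH e cV].
rewrite loc_rcons /starF e; suff -> : trace s V = set0 by rewrite fstar_set0.
apply/seteqP; split=> // x [p Vp [ps _]].
by have [_ /(_ p Vp)[[_ nr] _] _ _ _] := cV; case: nr; apply: (regular_face ps).
Qed.

End Sequences.
Arguments loc {S} Vs s _.
Arguments base {S} s _.


(** * Barycentric subdivision *)

Section Gens.
Variable n : nat.
Implicit Types (C : set 'rV[rat]_n) (s ws fs : seq 'rV[rat]_n) (u : 'cV[rat]_n).
Implicit Types (v p x : 'rV[rat]_n).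

Lemma ev_span0 u s x : {in s, forall v, ev u v = 0} -> x \in <<s>>%VS -> ev u x = 0.
Proof.
move=> h xs; rewrite (@coord_span _ _ _ (in_tuple s) x xs) ev_sum big1 // => i _.
by rewrite evZ h ?mulr0 // mem_nth.
Qed.

Lemma cone_gen_face s u : {in s, forall v, 0 <= ev u v} ->
  face (cone_gen [seq v <- s | ev u v == 0]) (cone_gen s).
Proof. by move=> u0; exists u; [exact: (ev_ge0 u0)|exact/esym/face_filter]. Qed.

Lemma fan_face_gens Phi c d p s : fan Phi -> Phi c -> Phi d -> c `<=` d ->
  d = cone_gen s -> d p -> ~ c p ->
  exists u, [/\ {in s, forall v, 0 <= ev u v},
    c = cone_gen [seq v <- s | ev u v == 0] &
    p \notin <<[seq v <- s | ev u v == 0%R]>>%VS].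
Proof.
move=> fP Pc Pd cd dE dp cp; have [u u0 cE] := fan_subset_face fP Pc Pd cd.
have us v : v \in s -> 0 <= ev u v by move=> vs; apply: u0; rewrite dE; apply: mem_cone_gen.
exists u; split=> //; first by rewrite cE dE; apply: face_filter.
apply/negP => ps; apply: cp; rewrite cE; split=> //.
by apply: (ev_span0 _ ps) => v; rewrite mem_filter => /andP[/eqP].
Qed.

(** Linear independence of [ws] modulo the span of [fs], for generators [fs] that may be
    linearly dependent. *)
Fixpoint indep_over ws fs : bool :=
  if ws is w :: ws' then (w \notin <<ws' ++ fs>>%VS) && indep_over ws' fs else true.

Lemma indep_over_filter (P : pred 'rV[rat]_n) ws fs : indep_over ws fs ->
  indep_over [seq v <- ws | P v] [seq v <- fs | P v].
Proof.
elim: ws => //= w ws IH /andP[wn /IH h]; case: ifP => //= _; rewrite h andbT.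
apply: contra wn; apply/subvP; apply: sub_span => v; rewrite !mem_cat !mem_filter.
by case/orP=> /andP[_ ->]; rewrite ?orbT.
Qed.

Lemma indep_over_free ws fs : free fs -> free (ws ++ fs) = indep_over ws fs.
Proof. by move=> ff; elim: ws => //= w ws IH; rewrite free_cons IH. Qed.

Lemma eq_span_indep ws fs fs' : <<fs>>%VS = <<fs'>>%VS ->
  indep_over ws fs = indep_over ws fs'.
Proof. by move=> e; elim: ws => //= w ws ->; rewrite !span_cat e. Qed.

Lemma eq_cone_span s s' : cone_gen s = cone_gen s' -> <<s>>%VS = <<s'>>%VS.
Proof.
have sub r r' : cone_gen r = cone_gen r' -> (<<r>> <= <<r'>>)%VS.
  move=> e; apply/span_subvP => v vr; apply: cone_gen_span.
  by rewrite -e; apply: mem_cone_gen.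
by move=> e; apply/eqP; rewrite eqEsubv !sub.
Qed.

(** The functional separates the coordinate along [v] from those along [l]. *)
Lemma splits_unimod C v u l : cvx C -> splits C v u -> unimod l ->
  [set x | C x /\ ev u x = 0] = cone_gen l ->
  unimod (v :: l) /\ C = cone_gen (v :: l).
Proof.
move=> [_ CD CZ] [Cv iv iu uv hC] [fl il hl] lE.
have l0 w : w \in l -> ev u w = 0 by move=> /mem_cone_gen; rewrite -lE => -[].
have vl : v \notin <<l>>%VS.
  by apply/negP => /(ev_span0 l0); rewrite uv => /eqP; rewrite oner_eq0.
split.
  split; first by rewrite free_cons vl.
    by move=> w; rewrite inE => /predU1P[->|/il].
  move=> c; rewrite /comb big_cons -/(comb l c) => ic.
  have lc : ev u (comb l c) = 0 by apply: (ev_span0 l0); apply: comb_span.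
  have cv : c v \is a Num.int.
    by have := ev_int iu ic; rewrite evD evZ uv lc mulr1 addr0.
  move=> w; rewrite inE => /predU1P[-> //|]; apply: hl.
  rewrite -[comb l c](addKr (c v *: v)) addrC; apply: integralB => //.
  exact: integralZ.
rewrite cone_cons -lE; apply/seteqP; split=> x.
  move=> Cx; have [ux hx] := hC x Cx; exists (ev u x *: v).
    by apply/rayP; exists (ev u x).
  exists (x - ev u x *: v); last by rewrite addrC subrK.
  by split; rewrite // evB evZ uv mulr1 subrr.
by case=> _ /rayP[a a0 ->] [y [Cy _] <-]; apply: CD => //; apply: CZ.
Qed.

Lemma primitive_on_ray_unique v w w' :
  primitive_on_ray v w -> primitive_on_ray v w' -> w = w'.
Proof.
move=> [pw [k k0 vE]] [pw' [k' k'0 vE']].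
have kn : (k%:R : rat) != 0 by rewrite pnatr_eq0 -lt0n.
have kn' : (k'%:R : rat) != 0 by rewrite pnatr_eq0 -lt0n.
have e : k%:R *: w = k'%:R *: w' by rewrite !scaler_nat -vE -vE'.
have wE : w = (k'%:R / k%:R) *: w'.
  by rewrite mulrC -scalerA -e scalerA mulVf // scale1r.
have wE' : w' = (k%:R / k'%:R) *: w.
  by rewrite mulrC -scalerA e scalerA mulVf // scale1r.
have [iw w0 _] := pw; have [iw' w0' _] := pw'.
have ge1 a : a \is a Num.int -> 0 < a -> 1 <= a :> rat.
  by case/intrP => m ->; rewrite ltr0z ler1z gtz0_ge1.
have h1 := ge1 _ (primitive_ray_int pw' iw wE) (divr_gt0 _ _).
have h2 := ge1 _ (primitive_ray_int pw iw' wE') (divr_gt0 _ _).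
move: h1 h2; rewrite !ltr0n => /(_ k'0 k0) + /(_ k0 k'0).
rewrite !ler_pdivlMr ?ltr0n // !mul1r => h1 h2.
have kk : k%:R = k'%:R :> rat by apply/eqP; rewrite eq_le h1 h2.
by rewrite wE kk divff // scale1r.
Qed.

End Gens.

Section Barycenters.
Variable S : conical_complex.
Implicit Types (s t d : S) (p q : cpoint S) (V : set (cpoint S)).
Implicit Types (Vs : seq (set (cpoint S))).

Definition sing_bary (k : nat) : set (cpoint S) :=
  [set p | [/\ sing S (tag p), crk (tag p) = k &
               primitive_on_ray (barycenter (cone (tag p))) (tagged p)]].

Lemma bary_relint k p : sing_bary k p -> relint (cone (tag p)) (tagged p).
Proof.
case=> _ _ [_ [m m0 bE]].
have [rb _] := barycenterP (cone_rational (tag p)) (@cone_strictly_convex _ (tag p)).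
have mn : (m%:R : rat) != 0 by rewrite pnatr_eq0 -lt0n.
have -> : tagged p = m%:R^-1 *: barycenter (cone (tag p)).
  by rewrite bE -scaler_nat scalerA mulVf // scale1r.
by apply: relint_scale => //; [apply: cone_fg|rewrite invr_gt0 ltr0n].
Qed.

Lemma bary_unique k p q : sing_bary k p -> sing_bary k q -> tag p = tag q -> p = q.
Proof.
case: p q => [s x] [s' y] [_ _ /= px] [_ _ /= py] e.
move: y py; rewrite -e => y py.
by rewrite (primitive_on_ray_unique px py).
Qed.

Lemma bary_exists s : sing S s -> exists2 p, sing_bary (crk s) p & tag p = s.
Proof.
move=> ss; have [irr nreg] := ss.
have [rb ib] := barycenterP (cone_rational s) (@cone_strictly_convex _ s).
have [|v pv] := primitive_exists ib; last by exists (existT _ s v).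
apply/eqP => b0; rewrite b0 in rb; apply: nreg; apply/regularP; exists [::].
  split=> //; first exact: nil_free.
rewrite cone_nil; apply/seteqP; split=> x; last by move=> ->; case: (cone_cvx s).
exact: (relint0 (cone_fg s) (@cone_strictly_convex _ s) rb).
Qed.

(** If the ranks were equal, the functional cutting out [t] would vanish on the span of
    [s]. *)
Lemma crk_lt t s : (t <= s)%O -> t != s -> (crk t < crk s)%N.
Proof.
move=> ts ne; have [N MN] := injective_linP (emb_inj ts).
have rf : row_free (cinc t s) by apply/row_freeP; exists N.
rewrite ltn_neqAle -(eqP rf) rank_leq_col andbT (eqP rf); apply: contra ne => /eqP e.
have full : row_full (cinc t s) by rewrite /row_full (eqP rf) e.
apply/eqP/(tag_unique ts (lexx s)); rewrite image_emb_id.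
have [u u0 E] : face (im s (cone t)) (cone s) := cinc_face ts.
rewrite E; apply/seteqP; split=> x; first by case.
move=> sx; split=> //.
have /submxP[y ->] : (x <= cinc t s)%MS by apply: submx_full.
have : lspan (cone t) y by rewrite cone_full_dim.
case=> a ta [b tb <-].
have z c : cone t c -> ev u (c *m cinc t s) = 0.
  move=> tc; have : im s (cone t) (emb s c) by exists c.
  by rewrite E => -[].
by rewrite mulmxBl -/(ev _ _) evB !z // subrr.
Qed.

(** An irreducible face has no component along a ray that splits off, so it lies in the
    facet opposite to the ray. *)
Lemma reducible_facet t : ~ irreducible (cone t) -> exists t1 v u,
  [/\ (t1 <= t)%O, (crk t1 < crk t)%N, splits (cone t) v u,
      [set x | cone t x /\ ev u x = 0] = im t (cone t1) &
      forall d, (d <= t)%O -> irreducible (cone d) -> (d <= t1)%O].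
Proof.
move=> nirr.
have [v [u sp]] := reducible_splits (cone_rational t) (cone_full_dim t) nirr.
have [tv _ _ uv hs] := sp.
have fF : face [set x | cone t x /\ ev u x = 0] (cone t) by exists u => // x /hs[].
have [t1 t1t E] := face_tag fF; exists t1, v, u; split=> //.
  apply: crk_lt => //; apply/eqP => e; move: E; rewrite e image_emb_id => E.
  have : cone t v by []. rewrite -E => -[_]; rewrite uv => /eqP; by rewrite oner_eq0.
move=> d dt irr; have [x rx] := relint_nonempty (cone_fg d).
apply: (tag_le dt t1t rx); rewrite -E; split.
  by apply: (face_subset (cinc_face dt)); exists x => //; case: rx.
apply/eqP/negPn/negP => /(splits_restrict dt sp (relint_subset rx))[v' _ sp'].
by case/cone_irreducible: irr; exists v', (cinc d t *m u).
Qed.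

(** Descending along facets as in [reducible_facet], one reaches an irreducible face of [t]
    that still contains [d] and [d']; being of rank at most [k], it is equal to both. *)
Lemma max_sing_unique k t d d' :
  (forall e, (e <= t)%O -> sing S e -> (crk e <= k)%N) ->
  (d <= t)%O -> (d' <= t)%O -> sing S d -> sing S d' -> crk d = k -> crk d' = k ->
  d = d'.
Proof.
have [m] := ubnP (crk t); elim: m t => // m IH t tm hk dt d't sd sd' kd kd'.
have [irr|nirr] := pselect (irreducible (cone t)).
  have st : sing S t.
    by split=> // rt; case: sd => _; apply; apply: regular_face rt.
  have eqt e : (e <= t)%O -> crk e = k -> e = t.
    move=> et ke; apply/eqP/negPn/negP => /(crk_lt et); rewrite ke.
    by rewrite ltnNge hk.
  by rewrite (eqt d) // (eqt d').
have [t1 [v [u [t1t c1 _ _ h1]]]] := reducible_facet nirr.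
apply: (IH t1) => //.
- by rewrite -ltnS; apply: leq_trans tm.
- by move=> e et1; apply: hk; apply: le_trans t1t.
- by apply: h1 => //; case: sd.
- by apply: h1 => //; case: sd'.
Qed.

(** The same descent ends in an irreducible face, which must be regular; the rays split off
    on the way complete a basis. *)
Lemma no_sing_regular t : (forall e, (e <= t)%O -> ~ sing S e) -> regular (cone t).
Proof.
have [m] := ubnP (crk t); elim: m t => // m IH t tm ns.
have [irr|nirr] := pselect (irreducible (cone t)).
  by apply: contrapT => nreg; apply: (ns t).
have [t1 [v [u [t1t c1 sp E _]]]] := reducible_facet nirr.
have /regularP[l ul lE] : regular (cone t1).
  apply: IH; first by rewrite -ltnS; apply: leq_trans tm.
  by move=> e et1; apply: ns; apply: le_trans t1t.
have [|ul' tE] := splits_unimod (cone_cvx t) sp ((unimod_emb l t1t).2 ul).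
  by rewrite E lE -lin_cone_gen.
by apply/regularP; exists (v :: [seq emb t w | w <- l]).
Qed.

Lemma loc_untouched Vs s : (forall V, V \in Vs -> trace s V = set0) ->
  loc Vs s = base s.
Proof.
elim/last_ind: Vs => [//|Vs V IH] h; rewrite loc_rcons /starF.
rewrite h ?fstar_set0; last by rewrite mem_rcons mem_head.
by apply: IH => W WV; apply: h; rewrite mem_rcons inE WV orbT.
Qed.

Definition labelled Vs s (w : 'rV[rat]_(crk s)) : Prop :=
  exists2 V, V \in Vs & trace s V w.

(** The cones of a barycentric subdivision, once the singular irreducible cones of
    rank at least [k] have been subdivided: each is the join of barycenters [ws]
    and of an original cone [t] whose irreducible singular faces have smaller
    rank. *)
Definition bary_inv k Vs : Prop :=
  [/\ admissible Vs,
      forall V p, V \in Vs -> V p -> (k <= crk (tag p))%N &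
      forall s C, loc Vs s C -> exists ws fs t,
        [/\ (t <= s)%O, C = cone_gen (ws ++ fs), im s (cone t) = cone_gen fs,
            indep_over ws fs & {in ws, forall w, labelled Vs w}] /\
        forall e, (e <= t)%O -> sing S e -> (crk e < k)%N].

Lemma bary_inv_untouched k Vs d : bary_inv k.+1 Vs -> (crk d <= k)%N ->
  loc Vs d = base d.
Proof.
move=> [adm hV _] dk; apply: loc_untouched => V VV.
apply/seteqP; split=> // x [p Vp [pd _]]; have := hV V p VV Vp.
have [e|/(crk_lt pd) lt] := eqVneq (tag p) d; first by rewrite e ltnNge dk.
by rewrite ltnNge (leq_trans (ltnW lt) dk).
Qed.

(** The cone of [p] has not been subdivided and contains none of the barycenters [ws], so
    its intersection with the join of [ws] and [t] lies in [t]. *)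
Lemma bary_inv_face k Vs p s ws fs t : bary_inv k.+1 Vs -> sing_bary k p ->
  (tag p <= s)%O -> (t <= s)%O -> loc Vs s (cone_gen (ws ++ fs)) ->
  im s (cone t) = cone_gen fs -> {in ws, forall w, labelled Vs w} ->
  cone_gen (ws ++ fs) (emb s (tagged p)) -> (tag p <= t)%O.
Proof.
move=> inv bp ps ts lC tE lab Cp; have [adm hV _] := inv.
have [fP _ comp] := admissible_coherent adm; have [_ _ fan3] := fP s.
have [_ kp _] := bp; have rp := bary_relint bp.
have lp : loc Vs s (im s (cone (tag p))).
  apply/(comp _ _ _ ps) => //; rewrite (bary_inv_untouched inv) ?kp //.
  exact: face_refl.
have [u u0 E] := fan3 _ _ _ lp lC (relint_emb ps rp) Cp.
apply: (tag_le ps ts rp); rewrite tE.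
have : cone_gen [seq v <- ws ++ fs | ev u v == 0] (emb s (tagged p)).
  rewrite -(@face_filter _ (ws ++ fs)); last by move=> v /mem_cone_gen/u0.
  move: E => /(congr1 (fun A : set _ => A (emb s (tagged p)))) => <-.
  by exists (tagged p) => //; case: rp.
apply: cone_subset => v; rewrite mem_filter mem_cat => /andP[/eqP uv /orP[vw|//]].
have [V VV [q Vq [qs vE]]] := lab v vw.
have : im s (cone (tag p)) v.
  rewrite E; split=> //; apply: mem_cone_gen; by rewrite mem_cat vw.
have [_ sV _ _ _] : centered (take (index V Vs) Vs) V.
  by have := adm (index V Vs); rewrite index_mem nth_index //; apply.
rewrite vE => /(tag_le qs ps (sV q Vq).2) qp.
have kq : (crk (tag q) <= k)%N.
  rewrite -kp; have [e|/(crk_lt qp)/ltnW//] := eqVneq (tag q) (tag p).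
  by rewrite [X in crk X]e.
by have := leq_trans (hV V q VV Vq) kq; rewrite ltnn.
Qed.

Lemma bary_inv_centered k Vs : bary_inv k.+1 Vs -> centered Vs (sing_bary k).
Proof.
move=> inv; have [adm hV hC] := inv; split.
- pose g s : cpoint S := existT _ s
    (xget 0 [set v | primitive_on_ray (barycenter (cone s)) v]).
  apply: sub_finite_set (finite_image g (finite_finset (X := [set: S]))).
  move=> p bp; exists (tag p) => //; have [_ _ pp] := bp.
  case: p {bp} pp => s v /= pv; rewrite /g; congr existT.
  by case: xgetP => [w _ pw|/(_ v)//]; apply: primitive_on_ray_unique pv.
- by move=> p bp; split; [case: bp|exact: bary_relint bp].
- by move=> p [_ _ []].
- move=> p bp; exists (cone (tag p)); last exact: bary_relint bp.
  rewrite (bary_inv_untouched inv); first exact: face_refl.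
  by have [_ kp _] := bp; rewrite kp.
move=> s C x y lC [p bp [ps ->]] [q bq [qs ->]] Cp Cq.
have [ws [fs [t [[ts CE tE ind lab] sm]]]] := hC s C lC.
rewrite CE in lC Cp Cq.
have pt := bary_inv_face inv bp ps ts lC tE lab Cp.
have qt := bary_inv_face inv bq qs ts lC tE lab Cq.
have [sp kp _] := bp; have [sq kq _] := bq.
suff -> : p = q by [].
exact: (bary_unique bp bq (max_sing_unique sm pt qt sp sq kp kq)).
Qed.

Lemma bary_step k Vs : bary_inv k.+1 Vs -> bary_inv k (rcons Vs (sing_bary k)).
Proof.
move=> inv; have cV := bary_inv_centered inv; have [adm hV hC] := inv.
have [fP sub _] := admissible_coherent adm.
have adm' : admissible (rcons Vs (sing_bary k)) by apply/admissible_rcons.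
split=> //.
  move=> V p; rewrite mem_rcons inE => /predU1P[->|VV Vp]; first by case=> _ kp _; rewrite kp.
  exact/ltnW/(hV V).
have lab' s (ws : seq 'rV[rat]_(crk s)) : {in ws, forall w, labelled Vs w} ->
    {in ws, forall w, labelled (rcons Vs (sing_bary k)) w}.
  by move=> lab w /lab[V VV tw]; exists V => //; rewrite mem_rcons inE VV orbT.
move=> s C; rewrite loc_rcons.
have small t D e : (t <= s)%O -> (e <= t)%O -> im s (cone t) `<=` D -> sing S e ->
    (crk e <= k)%N -> (forall x, trace s (sing_bary k) x -> ~ D x) -> (crk e < k)%N.
  move=> ts et tD se ek nD; rewrite ltn_neqAle ek andbT; apply/eqP => ke.
  have [p bp pe] := bary_exists se; rewrite ke in bp.
  have ps : (tag p <= s)%O by rewrite pe (le_trans et).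
  apply: (nD (emb s (tagged p))); first by exists p.
  have pt : (tag p <= t)%O by rewrite pe.
  apply: tD; rewrite -(emb_comp _ pt ts); exists (emb t (tagged p)) => //.
  apply: (face_subset (cinc_face pt)); exists (tagged p) => //.
  by case: (bary_relint bp).
case=> [[lC nC]|[p [c [d [[tp lc ld dp] [nc cd CE]]]]]].
  have [ws [fs [t [[ts CE tE ind lab] sm]]]] := hC s C lC.
  exists ws, fs, t; split; first by split=> //; apply: lab'.
  move=> e et se; apply: (small t C) => //; last by rewrite -ltnS; apply: sm.
  by rewrite tE CE; apply: cone_subset => v vf; rewrite mem_cat vf orbT.
have [ws [fs [t [[ts dE tE ind lab] sm]]]] := hC s d ld.
have [u [u0 cE np]] := fan_face_gens (fP s) lc ld cd dE dp (nc p tp).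
rewrite filter_cat in cE np.
set ws' := [seq v <- ws | _] in cE np; set fs' := [seq v <- fs | _] in cE np.
have fsc : cone_gen fs' `<=` c.
  by rewrite cE; apply: cone_subset => v vf; rewrite mem_cat vf orbT.
have ft : face (cone_gen fs') (im s (cone t)).
  by rewrite tE; apply: cone_gen_face => v vf; apply: u0; rewrite mem_cat vf orbT.
have [t' t's t'E] := face_tag (face_trans (cone_fg s) (cinc_face ts) ft).
have t't : (t' <= t)%O.
  have [x rx] := relint_nonempty (cone_fg t').
  apply: (tag_le t's ts rx); apply: (face_subset ft); rewrite t'E.
  by exists x => //; case: rx.
exists (p :: ws'), fs', t'; split.
  split=> //; first by rewrite CE cE -cone_cons.
    by rewrite /= np; apply: indep_over_filter.
  move=> w; rewrite inE => /predU1P[->|].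
    by exists (sing_bary k) => //; rewrite mem_rcons mem_head.
  by rewrite mem_filter => /andP[_ /(lab' s ws lab)].
move=> e et' se; apply: (small t' c) => //.
  by rewrite -t'E.
by rewrite -ltnS; apply: sm => //; apply: le_trans t't.
Qed.

Lemma bary_skip k Vs : bary_inv k.+1 Vs -> sing_bary k = set0 -> bary_inv k Vs.
Proof.
move=> [adm hV hC] e0; split=> // [V p VV Vp|s C /hC[ws [fs [t [h sm]]]]].
  exact/ltnW/(hV V).
exists ws, fs, t; split=> // e et se; rewrite ltn_neqAle -ltnS sm // andbT.
apply/eqP => ke; have [p bp _] := bary_exists se.
have : sing_bary k p by rewrite -ke.
by rewrite e0.
Qed.

Definition maxrk : nat := \max_(s : S) crk s.

Lemma bary_inv_init : bary_inv maxrk.+1 [::].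
Proof.
split=> // s C fC; have [l ll] := face_fg (cone_fg s) fC.
have [t ts tE] := face_tag fC; exists [::], l, t; split=> //.
  by split=> //; rewrite -tE.
by move=> e _ _; rewrite ltnS; apply: (leq_bigmax e).
Qed.

Definition phase1 : seq (set (cpoint S)) :=
  [seq V <- [seq sing_bary k | k <- rev (iota 0 maxrk.+1)] | V != set0].

Lemma phase1_inv : bary_inv 0 phase1.
Proof.
suff h m Vs : bary_inv m Vs -> bary_inv 0
    (Vs ++ [seq V <- [seq sing_bary k | k <- rev (iota 0 m)] | V != set0]).
  exact: (h _ _ bary_inv_init).
elim: m Vs => [|m IH] Vs inv; first by rewrite cats0.
rewrite -addn1 iotaD rev_cat /= add0n.
case: ifPn => [_|/negPn/eqP e0]; last exact/IH/bary_skip.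
by rewrite -cat_rcons; apply/IH/bary_step.
Qed.

(** ** Simplicial stage *)

(** The generators [fs] carry no label that would order them; unimodularity makes up for
    this, as it excludes fractional coordinates along them. *)
Definition simplicial_inv Vs : Prop :=
  admissible Vs /\ forall s C, loc Vs s C -> exists ws fs,
    [/\ C = cone_gen (ws ++ fs), free (ws ++ fs), unimod fs &
        {in ws, forall w, labelled Vs w}].

Lemma phase1_simplicial : simplicial_inv phase1.
Proof.
have [adm _ hC] := phase1_inv; split=> // s C lC.
have [ws [fs [t [[ts CE tE ind lab] sm]]]] := hC s C lC.
have /regularP[l ul lE] : regular (cone t).
  by apply: no_sing_regular => e et se; have := sm e et se.
have fE : cone_gen fs = cone_gen [seq emb s w | w <- l] by rewrite -tE lE -lin_cone_gen.
have ul' := (unimod_emb l ts).2 ul.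
exists ws, [seq emb s w | w <- l]; split=> //.
  by rewrite CE !cone_cat fE.
case: ul' => fl _ _; rewrite indep_over_free //.
by rewrite -(eq_span_indep _ (eq_cone_span fE)).
Qed.

End Barycenters.

(** * Subdivision at minimal points *)

Section MinimalPoints.
Variable S : conical_complex.
Implicit Types (s t d : S) (p q : cpoint S) (V Q : set (cpoint S)).
Implicit Types (Vs : seq (set (cpoint S))).

Definition cand Vs : set (cpoint S) :=
  [set p | relint (cone (tag p)) (tagged p) /\
     exists C, [/\ loc Vs (tag p) C, relint C (tagged p) &
                   minimal_point C (tagged p)]].

(** Along the point of [V] that is a generator of the cell of [p], the largest [a]
    with [reach Vs V p a] is the coordinate of [p]. *)
Definition reach Vs V p (a : rat) : Prop :=
  exists C x, [/\ loc Vs (tag p) C, relint C (tagged p), trace (tag p) V x, C x &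
                  C (tagged p - a *: x)].

Definition refine Vs Q V : set (cpoint S) :=
  [set p | Q p /\ forall q, Q q -> forall a, reach Vs V q a -> reach Vs V p a].

(** The candidates whose list of coordinates along the earlier centers is
    lexicographically largest. Since an empty center selects nothing, the result
    does not depend on the presence of empty centers in the sequence. *)
Definition next Vs : set (cpoint S) := foldl (refine Vs) (cand Vs) Vs.

Lemma refine_sub Vs Q V : refine Vs Q V `<=` Q.
Proof. by move=> p []. Qed.

Lemma foldl_refine_sub Vs Q l : foldl (refine Vs) Q l `<=` Q.
Proof.
by elim: l Q => [Q p //|V l IH Q p /= /IH[]].
Qed.

Lemma next_cand Vs : next Vs `<=` cand Vs.
Proof. exact: foldl_refine_sub. Qed.

Lemma foldl_refine_reach Vs Q l V p q a : V \in l ->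
  foldl (refine Vs) Q l p -> foldl (refine Vs) Q l q ->
  reach Vs V p a -> reach Vs V q a.
Proof.
elim: l Q => //= W l IH Q; rewrite inE => /predU1P[<-|Vl]; last exact: IH.
by move=> /foldl_refine_sub[Qp _] /foldl_refine_sub[_ h]; apply: h.
Qed.

Lemma admissible_center Vs V : admissible Vs -> V \in Vs ->
  [/\ V `<=` support_of (sing S), V `<=` ipoints S,
      forall p, V p -> primitive (tagged p) &
      forall s, separated (trace s V) (loc Vs s)].
Proof.
elim/last_ind: Vs => // Vs W IH /admissible_rcons[adm cW].
have [fP _ _] := admissible_coherent adm.
rewrite mem_rcons inE => /predU1P[->|/(IH adm)[sV iV pV sep]].
  have iW := centered_ipoints cW; case: cW => _ sW pW _ sep; split=> // s.
  by rewrite loc_rcons; apply: separated_fstar.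
by split=> // s; rewrite loc_rcons; apply: separated_fstar.
Qed.

Lemma labelled_primitive Vs s w : admissible Vs -> labelled Vs (s := s) w -> primitive w.
Proof.
move=> adm [V /(admissible_center adm)[_ _ pV _]] [p Vp [ps ->]].
by apply/(primitive_lin _ (emb_lattice_inj ps))/pV.
Qed.

Lemma simplicial_gens Vs s C : simplicial_inv Vs -> loc Vs s C -> exists ws fs,
  [/\ C = cone_gen (ws ++ fs), free (ws ++ fs), unimod fs,
      {in ws, forall w, labelled Vs w} & {in ws ++ fs, forall w, primitive w}].
Proof.
move=> [adm h] /h[ws [fs [CE fr uf lab]]]; exists ws, fs; split=> // w.
rewrite mem_cat => /orP[/lab|]; first exact: labelled_primitive.
exact: unimod_primitive.
Qed.

Lemma trace_finite s V : finite_set V -> finite_set (trace s V).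
Proof.
move=> fV; apply: sub_finite_set (finite_image (fun p => emb s (tagged p)) fV).
by move=> x [p Vp [_ ->]]; exists p.
Qed.

Lemma loc_finite Vs s : admissible Vs -> finite_set (loc Vs s).
Proof.
elim/last_ind: Vs => [_|Vs V IH /admissible_rcons[/IH fl [fV _ _ _ _]]].
  apply: sub_finite_set
    (finite_image (fun t => im s (cone t)) (finite_finset (X := [set: S]))).
  by move=> F /face_tag[t ts ->]; exists t.
by rewrite loc_rcons; apply: fstar_finite => //; apply: trace_finite.
Qed.

Lemma cand_finite Vs : simplicial_inv Vs -> finite_set (cand Vs).
Proof.
move=> inv; have [adm _] := inv.
apply: (@sub_finite_set _ _ (\bigcup_(s in [set: S]) \bigcup_(C in loc Vs s)
    [set (existT _ s x : cpoint S) | x in minimal_point C])).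
  by move=> [s x] [_ [C [lC _ mx]]]; exists s => //; exists C => //; exists x.
apply: bigcup_finite; first exact: finite_finset.
move=> s _; apply: bigcup_finite; first exact: loc_finite.
move=> C /(simplicial_gens inv)[ws [fs [-> fr _ _ pr]]].
exact/finite_image/minimal_points_finite.
Qed.

(** A singular cone has a minimal point, which lies in the interior of one of its
    faces and is minimal there. *)
Lemma cand_exists Vs s C : simplicial_inv Vs -> loc Vs s C -> ~ regular C ->
  cand Vs !=set0.
Proof.
move=> inv lC nreg; have [adm _] := inv; have cP := admissible_coherent adm.
have [fP _ _] := cP; have [rat fac _] := fP s.
have [ws [fs [CE fr _ _ pr]]] := simplicial_gens inv lC.
have [|x mx] := singular_minimal_point fr pr.
  by move=> um; apply: nreg; apply/regularP; exists (ws ++ fs).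
rewrite -CE in mx; have [Cx _ _ _ _] := mx; have fC := rational_fg (rat _ lC).
have [G fG rG] := min_face fC Cx.
have {}mx : minimal_point G x by apply/(minimal_face fC fG) => //; case: rG.
have [t [G0 [ts [lG0 rG0] GE]]] := coherent_cells cP (fac _ _ lC fG).
have [y G0y yx] : im s G0 x by rewrite -GE; case: rG.
have fG0 : fgcone G0 by case: (fP t) => rt _ _; apply/rational_fg/rt.
have ry : relint G0 y.
  by apply/(relint_image _ (emb_inj ts) fG0); rewrite -/(emb s) -/(emb s y) -GE yx.
exists (existT _ t y); split; first exact: rG0.
exists G0; split=> //.
by apply/(minimal_lin _ _ (emb_lattice_inj ts)); rewrite -/(emb s) -/(emb s y) -GE yx.
Qed.

(** If the cone of [p] split off a ray, then by [loc_splits] so would the cell of [p],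
    along the same vector [v]. Since [p] is interior it has a positive integral
    component along [v], and being indecomposable it is equal to [v]; but then the cell
    is the ray of [v], of which [v] is the vertex. *)
Lemma cand_irreducible Vs p : admissible Vs -> cand Vs p -> irreducible (cone (tag p)).
Proof.
move=> adm [rp [C [lC rC mp]]]; have [fP sub _] := admissible_coherent adm.
set s := tag p in rp C lC rC mp *; set x := tagged p in rp rC mp.
have [rat _ _] := fP s; have fC := rational_fg (rat _ lC); have cC := fg_cvx fC.
have [C0 CD CZ] := cC.
apply/cone_irreducible => -[v [u sp]]; have [sv iv iu uv hs] := sp.
have hP := loc_splits adm sp lC.
have [Cx ix x0 nv dec] := mp.
have ux : 0 < ev u x.
  have [e e0 /hs[+ _]] := relint_sub (cone_cvx s) rp sv.
  rewrite evB evZ uv mulr1 subr_ge0; exact: lt_le_trans.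
have [Cy] := hP x Cx; rewrite gt_eqF // => /(_ isT) Cv.
have v0 : v != 0 by apply: contra_eq_neq uv => ->; rewrite ev0 eq_sym oner_neq0.
have iux := ev_int iu ix.
have [y0|y0] := eqVneq (x - ev u x *: v) 0; last first.
  apply: dec; exists (x - ev u x *: v), (ev u x *: v); split; split=> //.
  - by apply: integralB => //; apply: integralZ.
  - by apply: CZ => //; apply: ltW.
  - exact: integralZ.
  - by rewrite scaler_eq0 gt_eqF.
  - by rewrite subrK.
have px := minimal_primitive cC mp.
have u1 : ev u x = 1.
  have [_ _ /(_ (absz (Num.floor (ev u x))) v iv)] := px.
  have e : (absz (Num.floor (ev u x)))%:R = ev u x.
    by rewrite natr_absz ger0_norm ?floor_ge0 ?ltW // floorK.
  by rewrite -scaler_nat e => /(_ (subr0_eq y0)) k1; rewrite -e k1.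
have xv : x = v by rewrite (subr0_eq y0) u1 scale1r.
apply: nv; split=> //; suff -> : ray x = C by apply: face_refl.
apply/seteqP; split=> [_ /rayP[a a0 ->]|z Cz]; first exact: CZ.
have [Cz' _] := hP z Cz; set z' := z - ev u z *: v in Cz'.
have uz' : ev u z' = 0 by rewrite evB evZ uv mulr1 subrr.
have [e e0 he] := relint_sub cC rC Cz'.
have [+ _] := hP _ he; rewrite evB evZ uz' mulr0 subr0 u1 scale1r xv.
rewrite addrAC subrr add0r => nz.
have : e *: z' = 0.
  apply: (@cone_strictly_convex _ s); first by apply/(sub _ _ lC)/CZ => //; apply: ltW.
  exact: (sub _ _ lC).
move/eqP; rewrite scaler_eq0 gt_eqF //= => /eqP zz.
apply/rayP; exists (ev u z); first by case: (hs z (sub _ _ lC _ Cz)).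
exact: subr0_eq.
Qed.

Lemma cand_sing Vs : admissible Vs -> cand Vs `<=` support_of (sing S).
Proof.
move=> adm p cp; have [rp [C [lC rC mp]]] := cp.
split=> //; split; first exact: cand_irreducible cp.
move=> reg; have /regularP[l ul lE] := reg.
move: lC; rewrite (loc_regular adm reg) => fC.
have CE : C = cone (tag p).
  apply/seteqP; split; first exact: face_subset.
  apply: (relint_face_sub (cone_cvx _) (cone_cvx _) rp _ fC) => //.
  by case: rC.
by move: mp; rewrite CE lE; apply: unimod_no_minimal.
Qed.

(** Cones contain at most one point of an earlier center, so the point occurring in the
    definition of [reach] can only be [w]. *)
Lemma reach_coef Vs s D l c p V w : admissible Vs -> loc Vs s D ->
  D = cone_gen l -> free l -> cand Vs p -> (tag p <= s)%O ->
  {in l, forall v, 0 <= c v} -> emb s (tagged p) = comb l c ->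
  w \in l -> V \in Vs -> trace s V w ->
  forall a, reach Vs V p a <-> 0 < c w /\ a <= c w.
Proof.
move=> adm lD DE fl [rp [C0 [lC0 rC0 _]]] ps c0 pE wl VV tw a.
have ul := free_uniq fl; have [_ iV _ sep] := admissible_center adm VV.
have [fP sub comp] := admissible_coherent adm; have [_ _ fan3] := fP s.
have [rat _ _] := fP (tag p).
have Dp : D (emb s (tagged p)) by rewrite DE pE; apply: cone_gen_comb.
have Dw : D w by rewrite DE; apply: mem_cone_gen.
have fD C : loc Vs (tag p) C -> relint C (tagged p) -> face (im s C) D.
  move=> lC rC; apply: (fan3 _ _ (emb s (tagged p))) => //.
    by apply/(comp _ _ _ ps) => //; apply: sub.
  by apply/(relint_image _ (emb_inj ps)) => //; apply/rational_fg/rat.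
have subD b : comb l c - b *: w = comb l (fun v => c v - b * (v == w)%:R).
  by rewrite -combB -combZ comb_indic.
have coefD b : D (comb l c - b *: w) -> b <= c w.
  rewrite DE subD => /(cone_gen_combP ul)[d d0 e].
  by have := free_comb_inj fl e wl; rewrite eqxx mulr1 => h; have := d0 w wl; lra.
split.
  move=> [C [x [lC rC tx Cx Cpx]]]; have fC := fD C lC rC.
  have xw : emb s x = w.
    have tsx : trace s V (emb s x) by apply/(trace_emb iV ps) => //; apply: (sub _ _ lC).
    by apply: (sep s D) => //; apply: (face_subset fC); exists x.
  have [e e0 he] := relint_sub (fg_cvx (rational_fg (rat _ lC))) rC Cx.
  have in_im b : C (tagged p - b *: x) -> b <= c w.
    move=> h; apply: coefD; rewrite -pE -xw -[X in _ - X]linZ -linB.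
    by apply: (face_subset fC); exists (tagged p - b *: x).
  by split; [apply: lt_le_trans e0 _|]; apply: in_im.
move=> [cw ac]; have fC := fD C0 lC0 rC0.
have cim : cvx (im s C0) by apply/fg_cvx/lin_fg/rational_fg/rat.
have D1 : D (comb l c - c w *: w).
  rewrite subD DE; apply: cone_gen_comb => v vl.
  by have [->|_] := eqVneq v w; rewrite ?mulr1 ?subrr // mulr0 subr0 c0.
have imp : im s C0 (comb l c) by rewrite -pE; exists (tagged p) => //; case: rC0.
have cD : D (c w *: w).
  by rewrite DE; case: (cvx_cone_gen l) => _ _; apply; [exact: ltW|exact: mem_cone_gen].
have im1 : im s C0 (comb l c - c w *: w).
  by apply: (face_extreme (y := c w *: w) fC) => //; rewrite subrK.
have im2 : im s C0 w.
  have : im s C0 (c w *: w).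
    by apply: (face_extreme (y := comb l c - c w *: w) fC); rewrite // addrC subrK.
  have [_ _ iZ] := cim => /(iZ (c w)^-1); rewrite scalerA mulVf ?gt_eqF // scale1r.
  by apply; rewrite invr_ge0 ltW.
case: im2 => x C0x xw; exists C0, x; split=> //.
  by apply/(trace_emb iV ps); [exact: (sub _ _ lC0)|rewrite xw].
apply/(image_injE _ _ (emb_inj ps)); rewrite linB linZ -/(emb s (tagged p)) -/(emb s x) xw pE.
have -> : comb l c - a *: w = comb l c - c w *: w + (c w - a) *: w.
  by rewrite scalerBl addrA subrK.
have [_ iD iZ] := cim; apply: iD => //; apply: iZ; first by rewrite subr_ge0.
by exists x.
Qed.

(** A minimal point of a face is a minimal point of the cone, so [minimal_coef_lt1]
    applies. *)
Lemma cand_coefs Vs s l p : admissible Vs -> loc Vs s (cone_gen l) -> free l ->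
  {in l, forall w, primitive w} -> cand Vs p -> (tag p <= s)%O ->
  cone_gen l (emb s (tagged p)) ->
  integral _ (emb s (tagged p)) /\ exists2 c, {in l, forall v, 0 <= c v < 1} &
      emb s (tagged p) = comb l c.
Proof.
move=> adm lD fr pr [_ [C [lC rC mC]]] ps Dp.
have [fP sub comp] := admissible_coherent adm; have [rat _ fan3] := fP s.
have fgC : fgcone C by case: (fP (tag p)) => rt _ _; apply/rational_fg/rt.
have fC : face (im s C) (cone_gen l).
  apply: (fan3 _ _ (emb s (tagged p))) => //.
    by apply/(comp _ _ _ ps) => //; apply: sub.
  exact/(relint_image _ (emb_inj ps)).
have mD : minimal_point (cone_gen l) (emb s (tagged p)).
  apply/(minimal_face (rational_fg (rat _ lD)) fC).
    by exists (tagged p) => //; case: rC.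
  exact/(minimal_lin _ _ (emb_lattice_inj ps)).
split; first by case: mD.
move: Dp => /(cone_gen_combP (free_uniq fr))[c c0 rE]; exists c => //.
rewrite rE in mD; have c1 := minimal_coef_lt1 fr pr c0 mD.
by move=> v vl; rewrite c0 ?c1.
Qed.

(** The selected points have the same coordinates along all earlier centers, so the
    difference of two of them in one cone is a combination of the regular part, with
    integral coefficients of absolute value less than 1. *)
Lemma next_separated Vs s : simplicial_inv Vs -> separated (trace s (next Vs)) (loc Vs s).
Proof.
move=> inv D _ _ lD [p np [ps ->]] [q nq [qs ->]] Dp Dq.
have [adm _] := inv.
have [ws [fs [DE fr uf lab pr]]] := simplicial_gens inv lD.
have [ff fi fint] := uf.
have cp := next_cand np; have cq := next_cand nq.
rewrite {1}DE in lD; rewrite DE in Dp Dq.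
have [ip [a a01 pE]] := cand_coefs adm lD fr pr cp ps Dp.
have [iq [b b01 qE]] := cand_coefs adm lD fr pr cq qs Dq.
have a0 : {in ws ++ fs, forall v, 0 <= a v} by move=> v /a01/andP[].
have b0 : {in ws ++ fs, forall v, 0 <= b v} by move=> v /b01/andP[].
have abw w : w \in ws -> a w = b w.
  move=> ww; have [V VV tw] := lab w ww.
  have wl : w \in ws ++ fs by rewrite mem_cat ww.
  have ha := reach_coef adm lD erefl fr cp ps a0 pE wl VV tw.
  have hb := reach_coef adm lD erefl fr cq qs b0 qE wl VV tw.
  have hab c : 0 < a w /\ c <= a w <-> 0 < b w /\ c <= b w.
    by split=> [/ha/(foldl_refine_reach VV np nq)/hb|/hb/(foldl_refine_reach VV nq np)/ha].
  have := a0 w wl; have := b0 w wl; rewrite !le_eqVlt.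
  case/predU1P=> [eb|bw] /predU1P[ea|aw]; first by rewrite -ea.
  - by have [] := (hab (a w)).1 (conj aw (lexx _)); rewrite -eb ltxx.
  - by have [] := (hab (b w)).2 (conj bw (lexx _)); rewrite -ea ltxx.
  apply/eqP; rewrite eq_le; apply/andP; split.
    by have [] := (hab (a w)).1 (conj aw (lexx _)).
  by have [] := (hab (b w)).2 (conj bw (lexx _)).
have dE : emb s (tagged p) - emb s (tagged q) = comb fs (fun v => a v - b v).
  rewrite pE qE combB comb_cat [comb ws _]big_seq big1 ?add0r // => w ww.
  by rewrite abw // subrr scale0r.
have := integralB ip iq; rewrite dE => /fint ab.
apply/subr0_eq; rewrite dE /comb big_seq big1 // => v vf.
have vl : v \in ws ++ fs by rewrite mem_cat vf orbT.
have /andP[h1 h2] := a01 v vl; have /andP[h3 h4] := b01 v vl.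
have iab := ab v vf; have [ge|lt] := leP 0 (a v - b v).
  by rewrite (int_lt1 iab ge) ?scale0r //; lra.
have : b v - a v = 0.
  by apply: int_lt1; [rewrite -opprB rpredN|lra|lra].
by move=> e; have -> : a v - b v = 0 by [lra]; rewrite scale0r.
Qed.

Lemma next_centered Vs : simplicial_inv Vs -> centered Vs (next Vs).
Proof.
move=> inv; have [adm _] := inv; have [fP _ _] := admissible_coherent adm.
split.
- by apply: sub_finite_set (cand_finite inv); apply: next_cand.
- by move=> p /next_cand; apply: cand_sing.
- move=> p /next_cand[_ [C [lC _ mp]]]; apply: minimal_primitive mp.
  by case: (fP (tag p)) => rat _ _; apply/fg_cvx/rational_fg/rat.
- by move=> p /next_cand[_ [C [lC rC _]]]; exists C.
by move=> s; apply: next_separated.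
Qed.

Lemma next_simplicial Vs : simplicial_inv Vs -> simplicial_inv (rcons Vs (next Vs)).
Proof.
move=> inv; have [adm hC] := inv; have cV := next_centered inv.
have [fP _ _] := admissible_coherent adm.
split; first exact/admissible_rcons.
have lab' s (ws : seq 'rV[rat]_(crk s)) : {in ws, forall w, labelled Vs w} ->
    {in ws, forall w, labelled (rcons Vs (next Vs)) w}.
  by move=> lab w /lab[V VV tw]; exists V => //; rewrite mem_rcons inE VV orbT.
move=> s C; rewrite loc_rcons; case=> [[/hC[ws [fs [CE fr uf lab]]] _]|].
  by exists ws, fs; split=> //; apply: lab'.
case=> p [c [d [[tp lc ld dp] [nc cd CE]]]].
have [ws [fs [dE fr uf lab]]] := hC s d ld.
have [u [u0 cE np]] := fan_face_gens (fP s) lc ld cd dE dp (nc p tp).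
exists (p :: [seq v <- ws | ev u v == 0]), [seq v <- fs | ev u v == 0]; split.
- by rewrite CE cE -cone_cons filter_cat.
- by rewrite /= free_cons -filter_cat np free_filter.
- exact: unimod_filter.
move=> w; rewrite inE => /predU1P[->|].
  by exists (next Vs) => //; rewrite mem_rcons mem_head.
by rewrite mem_filter => /andP[_ /(lab' s ws lab)].
Qed.

Lemma reach_le Vs V p a b : admissible Vs -> b <= a -> reach Vs V p a -> reach Vs V p b.
Proof.
move=> adm ba [C [x [lC rC tx Cx Cpx]]]; exists C, x; split=> //.
have [fP _ _] := admissible_coherent adm; have [rat _ _] := fP (tag p).
have [_ CD CZ] := fg_cvx (rational_fg (rat _ lC)).
have -> : tagged p - b *: x = tagged p - a *: x + (a - b) *: x.
  by rewrite scalerBl addrA subrK.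
by apply: CD => //; apply: CZ; rewrite ?subr_ge0.
Qed.

(** The sets of values reached are closed downwards, hence totally ordered by inclusion. *)
Lemma refine_nonempty Vs Q V : admissible Vs -> finite_set Q -> Q !=set0 ->
  refine Vs Q V !=set0.
Proof.
move=> adm /finite_seqP[l ->] [p0 pl].
have tot p q : (forall a, reach Vs V p a -> reach Vs V q a) \/
    (forall a, reach Vs V q a -> reach Vs V p a).
  have [h|/existsNP[a /not_implyP[pa qa]]] :=
    pselect (forall a, reach Vs V p a -> reach Vs V q a).
    by left.
  right=> b qb; have [ba|ab] := leP b a; first exact: (reach_le adm ba).
  by case: qa; apply: (reach_le adm _ qb); apply: ltW.
elim: l p0 pl => // p l IH _ _.
case: l IH => [_|q l IH].
  exists p; split; first by rewrite /= mem_head.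
  by move=> q /=; rewrite inE => /eqP ->.
have [r [/= rl hr]] := IH q (mem_head _ _).
have [h|h] := tot p r.
  exists r; split; first by rewrite /= inE rl orbT.
  by move=> q' /=; rewrite inE => /predU1P[->|/hr//].
exists p; split; first by rewrite /= mem_head.
by move=> q' /=; rewrite inE => /predU1P[->//|/hr hq] a /hq/h.
Qed.

Lemma next_nonempty Vs : simplicial_inv Vs -> cand Vs !=set0 -> next Vs !=set0.
Proof.
move=> inv; have [adm _] := inv; rewrite /next; have fc := cand_finite inv.
move: {2}Vs (cand Vs) fc; elim=> //= V l IH Q fQ Q0.
apply: IH; last exact: refine_nonempty.
by apply: sub_finite_set fQ; apply: refine_sub.
Qed.

End MinimalPoints.

(** * Termination *)

Section Volume.
Variable n : nat.
Implicit Types (s : seq 'rV[rat]_n) (p v w : 'rV[rat]_n).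

Definition gens_mx k s : 'M[rat]_(k, n) := \matrix_(i < k) s`_i.

Definition gram k s : rat := \det (gens_mx k s *m (gens_mx k s)^T).

(** The square of the volume of the parallelepiped spanned by [s]. *)
Definition vol s : nat := absz (numq (gram (size s) s)).

Lemma gram_int k s : {in s, forall v, integral n v} -> (k <= size s)%N ->
  gram k s \is a Num.int.
Proof.
move=> si ks; rewrite /gram /determinant; apply: rpred_sum => g _.
apply: rpredM; first by rewrite rpredX // rpredN rpred1.
apply: rpred_prod => i _; rewrite mxE; apply: rpred_sum => j _.
have ii (m : 'I_k) : gens_mx k s m j \is a Num.int.
  rewrite mxE; move: j; apply/integralP; apply: si; apply: mem_nth.
  exact: leq_trans (ltn_ord m) ks.
by apply: rpredM => //; rewrite mxE.
Qed.

Lemma volE s : {in s, forall v, integral n v} -> (vol s)%:R = `|gram (size s) s|.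
Proof.
move=> si; rewrite /vol natr_absz -[in RHS](numqK (gram_int si (leqnn _))).
by rewrite intr_norm.
Qed.

Lemma row_sqr_eq0 (y : 'rV[rat]_n) : y *m y^T = 0 -> y = 0.
Proof.
move=> yy; have : \sum_j y 0 j ^+ 2 = 0.
  have := congr1 (fun M : 'M_1 => M 0 0) yy; rewrite [LHS]mxE [RHS]mxE => e.
  by rewrite -[RHS]e; apply: eq_bigr => j _; rewrite [y^T _ _]mxE expr2.
move/eqP; rewrite psumr_eq0 => [/allP h|j _]; last exact: sqr_ge0.
apply/rowP => j; have /implyP/(_ isT) := h j (mem_index_enum _).
by rewrite sqrf_eq0 => /eqP ->; rewrite mxE.
Qed.

Lemma gram_neq0 s : free s -> gram (size s) s != 0.
Proof.
move=> fs; apply/det0P => -[x x0 xA].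
case/eqP: x0; apply/rowP => i; rewrite mxE.
have : x *m gens_mx (size s) s = 0.
  by apply: row_sqr_eq0; rewrite trmx_mul mulmxA -(mulmxA x) xA mul0mx.
rewrite mulmx_sum_row => e; apply: (elimT (freeP (X := in_tuple s)) fs (x 0)).
by rewrite -[RHS]e; apply: eq_bigr => j _; rewrite rowK.
Qed.

Definition replace v p s : seq 'rV[rat]_n := [seq if w == v then p else w | w <- s].

Lemma replace_perm v p s : uniq s -> v \in s -> perm_eq (replace v p s) (p :: rem v s).
Proof.
move=> us vs; have := perm_map (fun w => if w == v then p else w) (perm_to_rem vs).
rewrite /= eqxx (_ : [seq _ | w <- rem v s] = rem v s) //.
rewrite -[RHS]map_id; apply/eq_in_map => w.
by rewrite rem_filter // mem_filter => /andP[/= /negPf -> _].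
Qed.

Lemma det_replace_row k (i0 : 'I_k) (a : 'I_k -> rat) :
  \det (\matrix_(i < k, j < k) if i == i0 then a j else (i == j)%:R) = a i0.
Proof.
set E := \matrix_(i, j) _; rewrite (expand_det_row E i0).
have cf j : cofactor E i0 j = (i0 == j)%:R.
  have -> : cofactor E i0 j = cofactor 1%:M i0 j.
    rewrite /cofactor; congr (_ * \det _); apply/matrixP => x y; rewrite !mxE.
    have -> : (lift i0 x == i0) = false by rewrite eq_sym (negPf (neq_lift _ _)).
    by [].
  have := mul_mx_adj (1%:M : 'M[rat]_k); rewrite mul1mx det1 => /matrixP/(_ j i0).
  by rewrite !mxE eq_sym.
rewrite (bigD1 i0) //= cf eqxx mulr1 big1 ?addr0 ?mxE ?eqxx // => j /negPf jn.
by rewrite cf eq_sym jn mulr0.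
Qed.

(** The change of generators is given by an identity matrix with one row replaced, whose
    determinant is the coefficient of the replaced generator. *)
Lemma gram_replace s v c : uniq s -> v \in s ->
  gram (size s) (replace v (comb s c) s) = c v ^+ 2 * gram (size s) s.
Proof.
move=> us vs; have vi : (index v s < size s)%N by rewrite index_mem.
pose i0 := Ordinal vi; pose a j := c s`_(nat_of_ord (j : 'I_(size s))).
pose E := \matrix_(i < size s, j < size s) if i == i0 then a j else (i == j)%:R.
have AE : gens_mx (size s) (replace v (comb s c) s) = E *m gens_mx (size s) s.
  apply/row_matrixP => i; rewrite rowK row_mul mulmx_sum_row.
  rewrite (nth_map 0) //.
  have -> : (s`_i == v) = (i == i0).
    by rewrite -(nth_index 0 vs) nth_uniq.
  have [ii|ii] := eqVneq i i0.
    rewrite comb_ord; apply: eq_bigr => j _; rewrite rowK !mxE.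
    by rewrite ii eqxx.
  rewrite (bigD1 i) //= !mxE (negPf ii) eqxx scale1r rowK big1 ?addr0 // => j ji.
  by rewrite !mxE (negPf ii) eq_sym (negPf ji) scale0r.
rewrite /gram AE trmx_mul mulmxA -(mulmxA E) !det_mulmx det_tr.
rewrite det_replace_row /a /= nth_index //; ring.
Qed.

Lemma vol_replace s v c : free s -> {in s, forall w, integral n w} ->
  integral n (comb s c) -> v \in s -> 0 <= c v < 1 ->
  (vol (replace v (comb s c) s) < vol s)%N.
Proof.
move=> fs si ip vs /andP[c0 c1].
have si' : {in replace v (comb s c) s, forall w, integral n w}.
  by move=> _ /mapP[w ws ->]; case: ifP => // _; apply: si.
rewrite -(ltr_nat rat) !volE // size_map gram_replace ?free_uniq //.
rewrite normrM ger0_norm ?sqr_ge0 // gtr_pMl ?normr_gt0 ?gram_neq0 //.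
by rewrite expr2; apply: le_lt_trans (ler_piMr c0 (ltW c1)) c1.
Qed.

End Volume.

Section Termination.
Variable S : conical_complex.
Implicit Types (s t d : S) (p q : cpoint S) (V Q : set (cpoint S)).
Implicit Types (Vs : seq (set (cpoint S))).

Definition gcell : Type := {s : S & seq 'rV[rat]_(crk s)}.
HB.instance Definition _ := Choice.on gcell.
Implicit Types (L : seq gcell) (a b : gcell).

(** Replacing a simplex by at most [maxrk S] simplices of smaller volume lowers this sum,
    because the base exceeds [maxrk S]. *)
Definition weight L : nat := \sum_(a <- L) (maxrk S).+2 ^ vol (tagged a).

(** It suffices to keep track of enough simplices to contain all cones. *)
Definition covers L Vs : Prop :=
  (forall a, a \in L -> [/\ loc Vs (tag a) (cone_gen (tagged a)), free (tagged a) &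
     {in tagged a, forall w, primitive w}]) /\
  forall s C, loc Vs s C ->
    exists2 l, (existT _ s l : gcell) \in L & C `<=` cone_gen l.

Lemma covers_exists Vs : simplicial_inv Vs -> exists L, covers L Vs.
Proof.
move=> inv; have [adm _] := inv.
have h s (C : set 'rV[rat]_(crk s)) : exists l,
    loc Vs s C -> [/\ C = cone_gen l, free l & {in l, forall w, primitive w}].
  have [lC|nC] := pselect (loc Vs s C); last by exists [::].
  by have [ws [fs [? ? _ _ ?]]] := simplicial_gens inv lC; exists (ws ++ fs).
have h2 s : exists e : seq (set 'rV[rat]_(crk s)), loc Vs s = [set` e].
  by apply/finite_seqP; apply: loc_finite.
pose g s C := sval (cid (h s C)); pose e s := sval (cid (h2 s)).
have eE s : loc Vs s = [set` e s] := svalP (cid (h2 s)).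
have gE s C : loc Vs s C -> [/\ C = cone_gen (g s C), free (g s C) &
    {in g s C, forall w, primitive w}] := svalP (cid (h s C)).
exists (flatten [seq [seq (existT _ s (g s C) : gcell) | C <- e s] | s <- enum S]).
split=> [a|s C lC].
  case/flatten_mapP => s _ /mapP[C eC ->] /=.
  have lC : loc Vs s C by rewrite eE.
  by have [<- ? ?] := gE s C lC.
exists (g s C); last by have [<- _ _] := gE s C lC.
apply/flatten_mapP; exists s; first by rewrite mem_enum.
by apply/mapP; exists C => //; move: lC; rewrite eE.
Qed.

Lemma free_size n (l : seq 'rV[rat]_n) : free l -> (size l <= n)%N.
Proof.
move=> /eqP <-; have := dimvS (subvf <<l>>%VS); rewrite dimvf.
by rewrite /dim /= mul1n.
Qed.

Lemma sum_lt_exp (B m k : nat) (r : seq nat) : (k.+1 < B)%N -> (size r <= k)%N ->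
  {in r, forall i, (i < m)%N} -> (\sum_(i <- r) B ^ i < B ^ m)%N.
Proof.
move=> kB rk rm; case: m rm => [|m] rm.
  by case: r rk rm => [_ _|i r _ /(_ i (mem_head _ _))//]; rewrite big_nil.
have B0 : (0 < B)%N by apply: leq_trans kB.
apply: (@leq_ltn_trans (\sum_(i <- r) B ^ m)).
  rewrite big_seq [X in (_ <= X)%N]big_seq; apply: leq_sum => i /rm im.
  by rewrite leq_pexp2l.
rewrite big_const_seq count_predT iter_addn_0 expnSr ltn_pmul2l ?expn_gt0 ?B0 //.
exact: leq_ltn_trans rk (ltnW kB).
Qed.

Lemma cone_gen_replace n (l : seq 'rV[rat]_n) v (p : 'rV[rat]_n) : uniq l -> v \in l ->
  cone_gen (replace v p l) = msum (ray p) (cone_gen [seq w <- l | w != v]).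
Proof.
move=> ul vl; rewrite -cone_cons -[X in cone_gen (p :: X)](rem_filter v ul).
exact/eq_cone_gen/perm_mem/replace_perm.
Qed.

Lemma facet_face n (l : seq 'rV[rat]_n) v : free l -> v \in l ->
  face (cone_gen [seq w <- l | w != v]) (cone_gen l).
Proof.
move=> fl vl; have [u uE] := free_functional (fun w => (w == v)%:R) fl.
have u0 w : w \in l -> 0 <= ev u w by move=> /uE ->; apply: ler0n.
have -> : [seq w <- l | w != v] = [seq w <- l | ev u w == 0].
  by apply: eq_in_filter => w /uE ->; case: eqP.
exact: cone_gen_face.
Qed.

Lemma notin_facet n (l : seq 'rV[rat]_n) v c : free l -> v \in l -> c v != 0 ->
  comb l c \notin <<[seq w <- l | w != v]>>%VS.
Proof.
move=> fl vl cv; have [u [u1 u0]] := dual_free fl vl.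
have h : {in [seq w <- l | w != v], forall w, ev u w = 0}.
  by move=> w; rewrite mem_filter => /andP[wv wl]; apply: u0.
apply/negP => /(ev_span0 h).
by rewrite (ev_dual_comb c (free_uniq fl) vl u1 u0) => /eqP; rewrite (negPf cv).
Qed.

Lemma covers_step L Vs : simplicial_inv Vs -> covers L Vs -> next Vs !=set0 ->
  exists2 L', covers L' (rcons Vs (next Vs)) & (weight L' < weight L)%N.
Proof.
move=> inv [hL hC] [p0 np0]; have [adm _] := inv.
have cV := next_centered inv; have iV := centered_ipoints cV.
have [_ _ pV TV sepV] := cV; have [fP sub comp] := admissible_coherent adm.
pose hit a x := trace (tag a) (next Vs) x /\ cone_gen (tagged a) x.
have /choice[ch chP] : forall a, exists ch : seq gcell, a \in L ->
    (exists x c, [/\ hit a x, x = comb (tagged a) c,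
       {in tagged a, forall v, 0 <= c v < 1}, integral _ x /\ primitive x &
       ch = [seq (existT _ (tag a) (replace v x (tagged a)) : gcell) |
              v <- tagged a & c v != 0]]) \/
    (forall x, ~ hit a x) /\ ch = [:: a].
  move=> a; have [aL|naL] := boolP (a \in L); last by exists [::].
  have [[x hx]|nx] := pselect (exists x, hit a x); last first.
    by exists [:: a] => _; right; split=> // x hx; apply: nx; exists x.
  have [lD fl pr] := hL a aL; have [[p np [ps xE]] Dx] := hx.
  rewrite xE in Dx.
  have [ix [c c01 pE]] := cand_coefs adm lD fl pr (next_cand np) ps Dx.
  eexists => _; left; exists x, c; split=> //; rewrite ?xE //; split=> //.
  exact/(primitive_lin _ (emb_lattice_inj ps))/pV.
have chlt a : a \in L -> (exists x, hit a x) ->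
    (\sum_(b <- ch a) (maxrk S).+2 ^ vol (tagged b) < (maxrk S).+2 ^ vol (tagged a))%N.
  move=> aL [x0 hx0]; have [[x [c [hx xE c01 [ix px] ->]]]|[h _]] := chP a aL; last first.
    by case: (h x0).
  have [lD fl pr] := hL a aL.
  rewrite big_map -(big_map (fun v => vol (replace v x (tagged a))) predT
    (fun i => ((maxrk S).+2 ^ i)%N)).
  apply: (@sum_lt_exp _ _ (maxrk S)) => //.
    rewrite size_map size_filter; apply: leq_trans (count_size _ _) _.
    by apply: leq_trans (free_size fl) _; apply: (leq_bigmax (tag a)).
  move=> i /mapP[v]; rewrite mem_filter => /andP[cv vl] ->.
  by rewrite xE; apply: vol_replace => //; [move=> w /pr[]|rewrite -xE|apply: c01].
have chle a : a \in L ->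
    (\sum_(b <- ch a) (maxrk S).+2 ^ vol (tagged b) <= (maxrk S).+2 ^ vol (tagged a))%N.
  move=> aL; have [hx|nx] := pselect (exists x, hit a x); first exact/ltnW/chlt.
  have [[x [c [hx _ _ _ _]]]|[_ ->]] := chP a aL; first by case: nx; exists x.
  by rewrite big_seq1.
exists (flatten [seq ch a | a <- L]); last first.
  rewrite /weight big_flatten big_map.
  have [T lT rT] := TV p0 np0; have [l lL Tl] := hC _ _ lT.
  rewrite !(perm_big _ (perm_to_rem lL)) !big_cons -addSn leq_add //.
    apply: chlt => //; exists (tagged p0); split; last exact/Tl/(relint_subset rT).
    by exists p0 => //; split=> //; rewrite emb_id.
  rewrite big_seq [X in (_ <= X)%N]big_seq; apply: leq_sum => a /mem_rem.
  exact: chle.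
split=> [b /flatten_mapP[a aL]|s C].
  have [lD fl pr] := hL a aL; have ul := free_uniq fl.
  have [[x [c [[tx Dx] xE c01 [ix px] ->]]]|[nh ->]] := chP a aL; last first.
    rewrite inE => /eqP ->; rewrite loc_rcons; split=> //.
    by left; split=> // x tx Dx; apply: (nh x).
  case/mapP => v; rewrite mem_filter => /andP[cv vl] ->{b} /=.
  have nx : x \notin <<[seq w <- tagged a | w != v]>>%VS by rewrite xE; apply: notin_facet.
  have ff := facet_face fl vl; have [_ fac _] := fP (tag a).
  split; last first.
  - by move=> w /mapP[w' /pr pw ->]; case: ifP.
  - rewrite (perm_free (replace_perm x ul vl)) free_cons rem_filter // nx.
    exact: free_filter.
  rewrite loc_rcons (cone_gen_replace x ul vl); right.
  exists x, (cone_gen [seq w <- tagged a | w != v]), (cone_gen (tagged a)).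
  split; split=> //; [exact: fac ff| |exact: face_subset].
  move=> y ty cy; have yx : y = x.
    by apply: (sepV (tag a) (cone_gen (tagged a))) => //; apply: (face_subset ff).
  by move: nx; rewrite -yx => /negP; apply; apply: cone_gen_span.
(* The generators of a face that misses [x] do not span [x], so some generator along
   which [x] has a nonzero coordinate is not among them. *)
have key C0 l x c : loc Vs s C0 -> (existT _ s l : gcell) \in L -> C0 `<=` cone_gen l ->
    cone_gen l x -> ~ C0 x -> x = comb l c ->
    exists2 v, v \in l & c v != 0 /\ C0 `<=` cone_gen [seq w <- l | w != v].
  move=> lC0 lL C0l lx nx xE; have [lD fl _] := hL _ lL.
  have [u [u0 CE np]] := fan_face_gens (fP s) lC0 lD C0l erefl lx nx.
  have [v vl /andP[uv cv]] : exists2 v, v \in l & (ev u v != 0) && (c v != 0).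
    apply: contrapT => h; move/negP: np; apply; rewrite xE.
    rewrite (@comb_filter _ (fun w => ev u w == 0)) ?comb_span // => v vl uv.
    by apply/eqP/negPn/negP => cv; apply: h; exists v; rewrite // uv.
  exists v => //; split=> //; rewrite CE; apply: cone_subset => w.
  rewrite !mem_filter => /andP[uw ->]; rewrite andbT; apply: contraTneq uw => ->.
  exact: uv.
have inL' l x : (existT _ s l : gcell) \in L -> hit (existT _ s l) x ->
    exists c, [/\ x = comb l c & forall v, v \in l -> c v != 0 ->
      (existT _ s (replace v x l) : gcell) \in flatten [seq ch a | a <- L]].
  move=> lL hx; have [lD _ _] := hL _ lL.
  have [[y [c [hy yE _ _ chE]]]|[nh _]] := chP _ lL; last by case: (nh x).
  have xy : x = y.
    case: hx hy => [tx Dx] [ty Dy].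
    by apply: (sepV s (cone_gen l)).
  exists c; rewrite xy; split=> // v vl cv; apply/flatten_mapP.
  exists (existT _ s l) => //; rewrite chE; apply/mapP; exists v => //.
  by rewrite mem_filter cv.
rewrite loc_rcons; case=> [[lC nC]|[x [c0 [d [[tx lc ld dx] [nc cd CE]]]]]].
  have [l lL Cl] := hC s C lC; have ul := free_uniq (let: And3 _ f _ := hL _ lL in f).
  have [[x hx]|nh] := pselect (exists x, hit (existT _ s l) x).
    have [c [xE hc]] := inL' l x lL hx; case: (hx) => [tx lx].
    have [v vl [cv Cv]] := key C l x c lC lL Cl lx (nC x tx) xE.
    exists (replace v x l); first exact: hc.
    by rewrite cone_gen_replace // => y /Cv; apply: msum_ray_incl.
  exists l => //; apply/flatten_mapP; exists (existT _ s l) => //.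
  have [[y [c [hy _ _ _ _]]]|[_ ->]] := chP _ lL; first by case: nh; exists y.
  by rewrite mem_head.
have [l lL dl] := hC s d ld; have ul := free_uniq (let: And3 _ f _ := hL _ lL in f).
have lx := dl _ dx; have hx : hit (existT _ s l) x by [].
have [c [xE hc]] := inL' l x lL hx.
have c0l : c0 `<=` cone_gen l by move=> y /cd/dl.
have [v vl [cv Cv]] := key c0 l x c lc lL c0l lx (nc x tx) xE.
exists (replace v x l); first exact: hc.
rewrite cone_gen_replace // CE => _ [y yx [z /Cv cz <-]]; exists y => //.
by exists z.
Qed.

Definition step Vs := if next Vs == set0 then Vs else rcons Vs (next Vs).

(** By [covers_step] the weight of a covering family decreases at every step. *)
Lemma step_terminates Vs : simplicial_inv Vs -> exists n, next (iter n step Vs) = set0.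
Proof.
move=> inv; have [L cL] := covers_exists inv.
have [m] := ubnP (weight L); elim: m L Vs inv cL => // m IH L Vs inv cL Lm.
have [e|ne] := eqVneq (next Vs) set0; first by exists 0%N.
have [L' cL' LL] := covers_step inv cL ((set0P _).1 ne).
have [|n nE] := IH L' _ (next_simplicial inv) cL'.
  by apply: leq_trans LL _; rewrite -ltnS.
by exists n.+1; rewrite iterSr {2}/step (negPf ne).
Qed.

Lemma step_simplicial Vs n : simplicial_inv Vs -> simplicial_inv (iter n step Vs).
Proof.
move=> inv; elim: n => //= n IH; rewrite /step; case: ifP => // _.
exact: next_simplicial.
Qed.

Lemma step_stable Vs n m : next (iter n step Vs) = set0 ->
  next (iter m step Vs) = set0 -> iter n step Vs = iter m step Vs.
Proof.
wlog nm : n m / (n <= m)%N => [h|].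
  by have [nm|/ltnW mn] := leqP n m; [exact: h|move=> hn hm; apply/esym/h].
move=> hn _; rewrite -(subnK nm) iterD; elim: (m - n)%N => //= k <-.
by rewrite /step hn eqxx.
Qed.

End Termination.

(** * Functoriality *)

Section Transport.
Variables m n : nat.
Implicit Types (M : 'M[rat]_(m, n)) (C D : set 'rV[rat]_m) (x : 'rV[rat]_m).

Definition lattice_iso M : Prop := lattice_inj M /\ forall y, exists x, y = lin M x.

Lemma lin_preimage M (D : set 'rV[rat]_n) : lattice_iso M ->
  exists C, D = lin M @` C.
Proof.
move=> [_ sur]; exists (lin M @^-1` D); apply/seteqP; split; last by move=> _ [x Dx <-].
by move=> y Dy; have [x yx] := sur y; exists x; rewrite /= -?yx.
Qed.

Lemma lattice_iso_dim M : lattice_iso M -> m = n.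
Proof.
move=> [[iM _] sur]; have [N MN] := injective_linP iM.
have rf : row_free M by apply/row_freeP; exists N.
have rF : row_full M.
  rewrite -sub1mx; apply/row_subP => i; have [x ->] := sur (row i 1%:M).
  exact: submxMl.
by rewrite -(eqP rf) (eqP rF).
Qed.

Lemma splits_lin M C : lattice_iso M ->
  (exists v u, splits (lin M @` C) v u) <-> exists v u, splits C v u.
Proof.
move=> [[iM intM] sur]; split.
  move=> [_ [u [[v Cv <-] iv iu uv hC]]]; exists v, (M *m u); split=> //.
  - exact/intM.
  - by apply: intu_ev => x /intM ix; rewrite -ev_lin; apply: ev_int.
  - by rewrite -ev_lin.
  move=> x Cx; rewrite -ev_lin; have [u0 h] := hC _ (imageP (lin M) Cx).
  by split=> //; apply/(image_injE _ _ iM); rewrite linB linZ.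
move=> [v [u [Cv iv iu uv hC]]]; have [N MN] := injective_linP iM.
have evE x : ev (N *m u) (lin M x) = ev u x.
  by rewrite -ev_lin /lin -mulmxA MN mulmx1.
exists (lin M v), (N *m u); split.
- by exists v.
- exact/intM.
- by apply: intu_ev => y; have [x ->] := sur y; rewrite evE => /intM; apply: ev_int.
- by rewrite evE.
move=> _ [x Cx <-]; rewrite evE; have [u0 h] := hC x Cx.
by split=> //; exists (x - ev u x *: v); rewrite // linB linZ.
Qed.

Lemma regular_lin M C : lattice_iso M -> regular (lin M @` C) <-> regular C.
Proof.
move=> [lM sur]; have [iM _] := lM; split=> /regularP[l ul lE]; apply/regularP.
  have [k kE] : exists k, l = [seq lin M v | v <- k].
    elim: l {ul lE} => [|v l [k ->]]; first by exists [::].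
    by have [x ->] := sur v; exists (x :: k).
  exists k; first by apply/(unimod_lin _ lM); rewrite -kE.
  by apply: (image_inj_eq iM); rewrite lE kE lin_cone_gen.
exists [seq lin M v | v <- l]; first exact/(unimod_lin _ lM).
by rewrite lE lin_cone_gen.
Qed.

Lemma minimal_internal_lin M C x : lattice_inj M -> fgcone C ->
  minimal_internal (lin M @` C) (lin M x) <-> minimal_internal C x.
Proof.
move=> [iM intM] fC; split=> -[rx ix dec]; split.
- exact/(relint_image _ iM).
- exact/intM.
- move=> [y [z [[ry iy y0] [Cz iz z0 xE]]]]; apply: dec.
  exists (lin M y), (lin M z); rewrite !lin_neq0 // xE linD.
  by split; split=> //; [exact/(relint_image _ iM)|exact/intM|exact/intM].
- exact/(relint_image _ iM).
- exact/intM.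
move=> [y' [z' [[ry iy y0] [[z Cz zE] iz z0 xE]]]]; apply: dec; subst z'.
have [y Cy yE] := relint_subset ry; subst y'.
exists y, z; rewrite -(lin_neq0 y iM) -(lin_neq0 z iM).
split; split=> //; [exact/(relint_image _ iM)|exact/intM|exact/intM|].
by apply: iM; rewrite linD.
Qed.

Lemma barycenter_lin M C : lattice_inj M -> rational_cone C -> strictly_convex C ->
  barycenter (lin M @` C) = lin M (barycenter C).
Proof.
move=> lM rC sC; have [iM _] := lM; have fC := rational_fg rC.
have fm := minimal_internal_finite rC sC.
have E : minimal_internal (lin M @` C) = lin M @` minimal_internal C.
  apply/seteqP; split=> [y my|_ [x mx <-]]; last exact/minimal_internal_lin.
  have [ry _ _] := my; have [x Cx xE] := relint_subset ry.
  by exists x => //; apply/(minimal_internal_lin _ lM fC); rewrite xE.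
rewrite /barycenter E (fsbig_image _ (lin M)); last by move=> x y _ _ /iM.
rewrite !fsbig_finite //=; elim: (fset_set _ : seq _) => [|v l IH].
  by rewrite !big_nil lin0.
by rewrite !big_cons linD IH.
Qed.

Lemma primitive_on_ray_lin M v w : lattice_inj M ->
  primitive_on_ray (lin M v) (lin M w) <-> primitive_on_ray v w.
Proof.
move=> lM; have [iM _] := lM; split=> -[pw [k k0 vE]]; split.
- exact/(primitive_lin _ lM).
- by exists k => //; apply: iM; rewrite vE -!scaler_nat linZ.
- exact/(primitive_lin _ lM).
by exists k => //; rewrite vE -!scaler_nat linZ.
Qed.

Lemma fstar_lin M V Phi (V' : set 'rV[rat]_n) Phi' : lattice_iso M ->
  (forall x, V x <-> V' (lin M x)) -> (forall C, Phi C <-> Phi' (lin M @` C)) ->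
  forall C, fstar V Phi C <-> fstar V' Phi' (lin M @` C).
Proof.
move=> lM hV hP C; have [[iM _] sur] := lM; split.
  case=> [[PC VC]|[p [c [d [[Vp Pc Pd dp] [Vc cd ->]]]]]].
    left; split; first exact/hP.
    by move=> _ /[swap] -[x Cx <-] /hV/VC.
  right; exists (lin M p), (lin M @` c), (lin M @` d); split; split.
  - exact/hV.
  - exact/hP.
  - exact/hP.
  - by exists p.
  - by move=> _ /[swap] -[x Cx <-] /hV/Vc.
  - exact/(image_inj_sub _ _ iM).
  by rewrite lin_msum lin_ray.
case=> [[PC VC]|[p' [c' [d' [[Vp Pc Pd dp] [Vc cd CE]]]]]].
  left; split; first exact/hP.
  by move=> x /hV/VC h Cx; apply: h; exists x.
have [p pE] := sur p'; have [c cE] := lin_preimage c' lM.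
have [d dE] := lin_preimage d' lM; subst p' c' d'.
right; exists p, c, d; split; split.
- exact/hV.
- exact/hP.
- exact/hP.
- exact/(image_injE _ _ iM).
- by move=> x /hV/Vc h cx; apply: h; exists x.
- exact/(image_inj_sub _ _ iM).
by apply: (image_inj_eq iM); rewrite lin_msum lin_ray.
Qed.

End Transport.

Section Functoriality.
Variables (S S' : conical_complex) (f : cmap S S').
Implicit Types (s t : S) (p q : cpoint S) (V Q : set (cpoint S')).
Implicit Types (Vs : seq (set (cpoint S'))).

Lemma femb t s x : (t <= s)%O ->
  emb (f s) (lin (fmx f t) x) = lin (fmx f s) (emb s x).
Proof. by move=> ts; rewrite /emb /lin -!mulmxA cmap_faces. Qed.

Lemma iso_at_lattice s : iso_at f s -> lattice_iso (fmx f s).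
Proof.
move=> [inj cE lE].
have full x : x \in lspan (cone s) by rewrite inE cone_full_dim.
have iM : injective (lin (fmx f s)) by move=> x y; apply: inj.
have latE (r : S) : lattice (cone r) = integral _.
  by rewrite /lattice cone_full_dim setIT.
have latE' (r : S') : lattice (cone r) = integral _.
  by rewrite /lattice cone_full_dim setIT.
rewrite latE latE' in lE; split.
  split=> // x; split=> ix; last by rewrite -lE; exists x.
  by move: ix; rewrite -lE => -[y iy /iM <-].
move=> y; have : lspan (cone (f s)) y by rewrite cone_full_dim.
rewrite -cE => -[_ [a sa <-] [_ [b sb <-] <-]]; exists (a - b).
by rewrite linB.
Qed.

Lemma iso_at_cone s : iso_at f s -> lin (fmx f s) @` cone s = cone (f s).
Proof. by case. Qed.

(** Interiors are mapped into interiors, so each of the faces [f t] and [t'] contains an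
    interior point of the other. *)
Lemma iso_face s t (t' : S') : iso_at f s -> (t <= s)%O -> (t' <= f s)%O ->
  im (f s) (lin (fmx f t) @` cone t) = im (f s) (cone t') -> f t = t'.
Proof.
move=> iso ts t's E; have fts := cmap_mono f ts.
have [x rx] := relint_nonempty (cone_fg t).
have rfx : relint (cone (f t)) (lin (fmx f t) x) by apply: cmap_int; exists x.
have le1 : (f t <= t')%O.
  apply: (tag_le fts t's rfx); rewrite -E.
  by exists (lin (fmx f t) x) => //; exists x => //; case: rx.
have le2 : (t' <= f t)%O.
  have [y ry] := relint_nonempty (cone_fg t').
  apply: (tag_le t's fts ry).
  have : im (f s) (cone t') (emb (f s) y) by exists y => //; case: ry.
  rewrite -E => -[_ [z tz <-] <-]; exists (lin (fmx f t) z) => //.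
  by apply: cmap_cone; exists z.
by apply/eqP; rewrite eq_le le1 le2.
Qed.

Lemma im_fmx s t : (t <= s)%O ->
  im (f s) (lin (fmx f t) @` cone t) = lin (fmx f s) @` im s (cone t).
Proof.
move=> ts; apply/seteqP; split.
  move=> _ [_ [x tx <-] <-]; exists (emb s x); first by exists x.
  by rewrite femb.
move=> _ [_ [x tx <-] <-]; exists (lin (fmx f t) x); first by exists x.
by rewrite femb.
Qed.

(** The image of a face [t] of [s] is a face of [f s], and it is that of [f t] since
    interiors are mapped into interiors. *)
Lemma iso_down s t : iso_at f s -> (t <= s)%O -> iso_at f t.
Proof.
move=> iso ts; have [[iM intM] sur] := iso_at_lattice iso.
have cE := iso_at_cone iso; have fts := cmap_mono f ts.
have fF : face (im (f s) (lin (fmx f t) @` cone t)) (cone (f s)).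
  rewrite im_fmx // -cE; apply/(face_image _ _ iM); exact: cinc_face.
have [t' t's E] := face_tag fF; have ft := iso_face iso ts t's E.
rewrite -ft in E; have tE := image_inj_eq (emb_inj fts) E.
have it : injective (lin (fmx f t)).
  move=> x y e; apply: (emb_inj ts); apply: iM.
  by rewrite -/(emb s x) -/(emb s y) -!femb // e.
split=> //; first by move=> x y _ _; apply: it.
rewrite /lattice !cone_full_dim !setIT; apply/seteqP; split=> y; first exact: cmap_lattice.
move=> iy; have : lspan (cone (f t)) y by rewrite cone_full_dim.
rewrite -tE => -[_ [a ta <-] [_ [b tb <-]]]; rewrite -linB => yE.
exists (a - b) => //; apply/(emb_integral _ ts)/intM.
by rewrite -femb // yE; apply/emb_integral.
Qed.

Lemma iso_face_exists s (t' : S') : iso_at f s -> (t' <= f s)%O ->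
  exists2 t, (t <= s)%O & f t = t'.
Proof.
move=> iso t's; have lM := iso_at_lattice iso; have [[iM _] _] := lM.
have [F FE] := lin_preimage (im (f s) (cone t')) lM.
have fF : face F (cone s).
  apply/(face_image _ _ iM); rewrite -FE iso_at_cone //; exact: cinc_face.
have [t ts tE] := face_tag fF; exists t => //.
by apply: (iso_face iso ts t's); rewrite im_fmx // -tE -FE.
Qed.

(** A point of [V] visible in [f s] lies in a face of [f s], which is the isomorphic image
    of a face of [s]. *)
Lemma trace_pullback s V x : iso_at f s -> V `<=` ipoints S' ->
  trace s (pullback f V) x <-> trace (f s) V (lin (fmx f s) x).
Proof.
move=> iso iV; split.
  move=> [p [sp ip Vp] [ps ->]]; exists (fpoint f p) => //; split.
    exact: (cmap_mono f).
  by rewrite -femb.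
move=> [[t' v'] Vp [/= t's xE]]; have [rv _] := iV _ Vp; rewrite /= in rv.
have [t ts ft] := iso_face_exists iso t's.
move: v' Vp t's xE rv; rewrite -ft => v' Vp t's xE rv.
have it := iso_down iso ts; have [[iMt _] _] := iso_at_lattice it.
have cE := iso_at_cone it; have [y ty yE] : (lin (fmx f t) @` cone t) v'.
  by rewrite cE; case: rv.
have ry : relint (cone t) y.
  by apply/(relint_image _ iMt (cone_fg t)); rewrite cE yE.
exists (existT _ t y); first by split=> //; rewrite /fpoint /= yE.
split=> //=; have [[iM _] _] := iso_at_lattice iso.
by apply: iM; rewrite xE -femb // yE.
Qed.

Lemma loc_pullback Vs s : iso_at f s -> (forall V, V \in Vs -> V `<=` ipoints S') ->
  forall C, loc [seq pullback f V | V <- Vs] s C <->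
            loc Vs (f s) (lin (fmx f s) @` C).
Proof.
move=> iso; have lM := iso_at_lattice iso; have [[iM _] _] := lM.
elim/last_ind: Vs => [_ C|Vs V IH iV C].
  by rewrite /loc /= /base /= -(iso_at_cone iso); split=> /(face_image _ _ iM).
rewrite map_rcons !loc_rcons; apply: fstar_lin => //.
  by move=> x; apply: trace_pullback => //; apply: iV; rewrite mem_rcons mem_head.
by apply: IH => W WV; apply: iV; rewrite mem_rcons inE WV orbT.
Qed.

(** The property common to local isomorphisms and regular local projections that makes
    the centers correspond. *)
Definition iso_on_irreducible : Prop := forall s, irreducible (cone s) -> iso_at f s.

Lemma local_isomorphism_irreducible :
  local_isomorphism f \/ regular_local_projection f -> iso_on_irreducible.
Proof.
move=> h s irr; case: h => [|/(_ s)[A [B [pr rB iA _]]]]; first exact.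
have [B0|nB] := pselect (B = [set 0]); last by case: irr; exists A, B.
suff e : A = cone s by rewrite /iso_at -e.
have [_ _ -> _ _] := pr; rewrite B0; apply/seteqP; split=> x.
  by move=> Ax; exists x => //; exists 0; rewrite ?addr0.
by case=> y Ay [_ -> <-]; rewrite addr0.
Qed.

Hypothesis irr_iso : iso_on_irreducible.

Lemma fpoint_relint p : iso_at f (tag p) ->
  relint (cone (tag (fpoint f p))) (tagged (fpoint f p)) <->
  relint (cone (tag p)) (tagged p).
Proof.
move=> iso; have [[iM _] _] := iso_at_lattice iso.
by rewrite /= -(iso_at_cone iso); apply: relint_image => //; apply: cone_fg.
Qed.

Section WithCenters.
Variable Vs : seq (set (cpoint S')).
Hypothesis adm' : admissible Vs.
Let Us := [seq pullback f V | V <- Vs].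

Let iV V : V \in Vs -> V `<=` ipoints S'.
Proof. by case/(admissible_center adm'). Qed.

Lemma loc_fg (r : S') D : loc Vs r D -> fgcone D.
Proof.
have [fP _ _] := admissible_coherent adm'.
by case: (fP r) => rat _ _ /rat/rational_fg.
Qed.

Lemma loc_lin_fg s C : iso_at f s -> loc Us s C -> fgcone C.
Proof.
move=> iso /(loc_pullback iso iV)/loc_fg; have [[iM _] _] := iso_at_lattice iso.
exact: lin_fg_inj.
Qed.

Lemma cand_pullback : (forall p, cand Us p -> irreducible (cone (tag p))) ->
  cand Us = pullback f (cand Vs).
Proof.
move=> irr; apply/seteqP; split=> p.
  move=> cp; have iso := irr_iso (irr p cp).
  have [lM _] := iso_at_lattice iso; have [iM _] := lM.
  have [rp [C [lC rC mC]]] := cp; split=> //.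
  split; first exact/fpoint_relint.
  exists (lin (fmx f (tag p)) @` C); split.
  - exact/loc_pullback.
  - exact/(relint_image _ iM (loc_lin_fg iso lC)).
  exact/minimal_lin.
move=> [[_ rp] iso [_ [D [lD rD mD]]]]; split=> //.
have lM := iso_at_lattice iso; have [lM' _] := lM; have [iM _] := lM'.
have [C CE] := lin_preimage D lM; rewrite {}CE in lD rD mD.
have lC : loc Us (tag p) C by apply/(loc_pullback iso iV).
exists C; split=> //; last exact/(minimal_lin _ _ lM').
exact/(relint_image _ iM (loc_lin_fg iso lC)).
Qed.

Lemma reach_pullback V p a : iso_at f (tag p) -> V \in Vs ->
  reach Us (pullback f V) p a <-> reach Vs V (fpoint f p) a.
Proof.
move=> iso VV; have lM := iso_at_lattice iso; have [[iM _] sur] := lM; split.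
  move=> [C [x [lC rC tx Cx Cpx]]].
  exists (lin (fmx f (tag p)) @` C), (lin (fmx f (tag p)) x); split.
  - exact/loc_pullback.
  - exact/(relint_image _ iM (loc_lin_fg iso lC)).
  - by apply/trace_pullback => //; apply: iV.
  - by exists x.
  by exists (tagged p - a *: x) => //; rewrite linB linZ.
move=> [D [y [lD rD ty Dy Dpy]]]; have [x xE] := sur y.
have [C CE] := lin_preimage D lM; subst y D.
have lC : loc Us (tag p) C by apply/(loc_pullback iso iV).
exists C, x; split=> //.
- exact/(relint_image _ iM (loc_lin_fg iso lC)).
- by apply/trace_pullback => //; apply: iV.
- exact/(image_injE _ _ iM).
by apply/(image_injE _ _ iM); rewrite linB linZ.
Qed.

Lemma pullback_sub V Q : V `<=` Q -> pullback f V `<=` pullback f Q.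
Proof. by move=> VQ p [sp ip /VQ]. Qed.

(** If some point of [S] maps to a maximal point of [Q], then maximality in the pullback is
    maximality in [Q]. *)
Lemma refine_pullback Q V : Q `<=` Defs.support S' -> V \in Vs ->
  pullback f (refine Vs Q V) !=set0 ->
  refine Us (pullback f Q) (pullback f V) = pullback f (refine Vs Q V).
Proof.
move=> sQ VV [r [sr ir [Qr hr]]]; apply/seteqP; split=> p.
  move=> [[sp ip Qp] hp]; split=> //; split=> // q' Qq a.
  move=> /(hr _ Qq)/(reach_pullback _ ir VV) h.
  by apply/(reach_pullback _ ip VV); apply: (hp r).
move=> [sp ip [Qp hp]]; split=> // q [sq iq Qq] a.
by move=> /(reach_pullback _ iq VV)/(hp _ Qq)/(reach_pullback _ ip VV).
Qed.

Lemma next_pullback : (forall p, cand Us p -> irreducible (cone (tag p))) ->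
  pullback f (next Vs) !=set0 ->
  next Us = pullback f (next Vs).
Proof.
move=> irr.
have h l Q : {subset l <= Vs} -> Q `<=` Defs.support S' ->
    pullback f (foldl (refine Vs) Q l) !=set0 ->
    foldl (refine Us) (pullback f Q) [seq pullback f V | V <- l] =
    pullback f (foldl (refine Vs) Q l).
  elim: l Q => //= V l IH Q lV sQ ne.
  have VV : V \in Vs by apply: lV; rewrite mem_head.
  have lV' : {subset l <= Vs} by move=> W Wl; apply: lV; rewrite inE Wl orbT.
  rewrite refine_pullback // ?IH //; first by move=> p /refine_sub/sQ.
  have [p pp] := ne; exists p; move: p pp.
  by apply: pullback_sub; apply: foldl_refine_sub.
by rewrite /next cand_pullback //; apply: h => // p [rp _].
Qed.

End WithCenters.

End Functoriality.

(** ** Pullback of the sequence of centers *)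

Section RunPullback.
Variables (S S' : conical_complex) (f : cmap S S').
Hypothesis irr_iso : iso_on_irreducible f.

Lemma iso_sing s : iso_at f s -> sing S s <-> sing S' (f s).
Proof.
move=> iso; have lM := iso_at_lattice iso; have cE := iso_at_cone iso.
have := splits_lin (cone s) lM; have := regular_lin (cone s) lM; rewrite cE => hr hs.
split=> -[/cone_irreducible irr nr]; split.
- by apply/cone_irreducible => /hs.
- by move/hr.
- by apply/cone_irreducible => /hs.
by move/hr.
Qed.

Lemma sing_bary_pullback k : pullback f (@sing_bary S' k) = @sing_bary S k.
Proof.
have fb s : iso_at f s -> barycenter (cone (f s)) = lin (fmx f s) (barycenter (cone s)).
  move=> iso; have [lM _] := iso_at_lattice iso.
  rewrite -(iso_at_cone iso); apply: barycenter_lin lM (cone_rational s) _.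
  exact: cone_strictly_convex.
apply/seteqP; split=> p.
  move=> [_ ip [sp kp pp]]; have lM := iso_at_lattice ip; split.
  - exact/(iso_sing ip).
  - by rewrite (lattice_iso_dim lM).
  by apply/(primitive_on_ray_lin _ _ lM.1); rewrite -fb.
move=> bp; have [sp kp pp] := bp; have ip := irr_iso sp.1.
have lM := iso_at_lattice ip; split=> //; first by split=> //; apply: bary_relint bp.
split; [exact/(iso_sing ip)|by rewrite -(lattice_iso_dim lM)|].
by rewrite /= fb //; apply/(primitive_on_ray_lin _ _ lM.1).
Qed.

End RunPullback.

Section EmptyCenters.
Variable S : conical_complex.
Implicit Types (Vs : seq (set (cpoint S))).

Definition nonempty_centers Vs := [seq V <- Vs | V != set0].

Lemma loc_nonempty Vs : loc (nonempty_centers Vs) = loc Vs.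
Proof.
apply: functional_extensionality_dep => s.
elim/last_ind: Vs => // Vs V IH.
rewrite /nonempty_centers filter_rcons loc_rcons.
case: eqP => [->|_]; last by rewrite loc_rcons /starF -/(nonempty_centers Vs) IH.
rewrite -/(nonempty_centers Vs) IH /starF.
suff -> : trace s (@set0 (cpoint S)) = set0 by rewrite fstar_set0.
by apply/seteqP; split=> // x [].
Qed.

Lemma refine_loc Us Vs : loc Us = loc Vs -> refine Us = refine Vs.
Proof.
move=> e; apply: functional_extensionality_dep => Q.
apply: functional_extensionality_dep => V.
by rewrite /refine /reach e.
Qed.

Lemma next_nonempty_centers Vs : next (nonempty_centers Vs) = next Vs.
Proof.
rewrite /next (refine_loc (loc_nonempty Vs)) /cand loc_nonempty.
move: [set p | _] => Q; rewrite /nonempty_centers.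
elim: {2 4}Vs Q => //= V l IH Q; case: eqP => [->|_] /=; last exact: IH.
rewrite IH; congr foldl; apply/seteqP; split=> p; last by case.
by move=> Qp; split=> // q _ a [C [x [_ _ [r []]]]].
Qed.

(** Any range of ranks covering those of the complex gives the same centers, which allows
    complexes of different dimensions to be compared. *)
Lemma phase1E M : (maxrk S < M)%N ->
  phase1 S = nonempty_centers [seq sing_bary k | k <- rev (iota 0 M)].
Proof.
have h K : (maxrk S < K)%N ->
    nonempty_centers [seq @sing_bary S k | k <- rev (iota 0 K.+1)] =
    nonempty_centers [seq @sing_bary S k | k <- rev (iota 0 K)].
  move=> mK; have e0 : @sing_bary S K = set0.
    apply/seteqP; split=> // p [_ kp _].
    by have := @leq_bigmax S (@crk S) (tag p); rewrite kp -/(maxrk S) leqNgt mK.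
  by rewrite -addn1 iotaD rev_cat map_cat /nonempty_centers filter_cat /= add0n e0 eqxx.
move=> mM; rewrite -(subnKC mM); elim: (M - _)%N => [|k IH]; first by rewrite addn0.
by rewrite addnS h // leq_addr.
Qed.

Definition run n := iter n (@step S) (phase1 S).

Lemma run_simplicial n : simplicial_inv (run n).
Proof. exact/step_simplicial/phase1_simplicial. Qed.

Definition desing : seq (set (cpoint S)) :=
  run (sval (cid (step_terminates (phase1_simplicial S)))).

Lemma desing_next : next desing = set0.
Proof. exact: (svalP (cid (step_terminates (phase1_simplicial S)))). Qed.

Lemma desing_unique n : next (run n) = set0 -> run n = desing.
Proof. by move=> h; apply: step_stable h desing_next. Qed.

Lemma desing_simplicial : simplicial_inv desing.
Proof. exact: run_simplicial. Qed.

End EmptyCenters.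

Section DesingPullback.
Variables (S S' : conical_complex) (f : cmap S S').
Hypothesis irr_iso : iso_on_irreducible f.

Lemma pullback0 : pullback f set0 = set0.
Proof. by apply/seteqP; split=> // p []. Qed.

Lemma pullback_nonempty_centers (Vs : seq (set (cpoint S'))) :
  nonempty_centers [seq pullback f V | V <- nonempty_centers Vs] =
  nonempty_centers [seq pullback f V | V <- Vs].
Proof.
rewrite /nonempty_centers; elim: Vs => //= V Vs IH.
have [->|_] /= := eqVneq V set0; last by rewrite IH.
by rewrite pullback0 eqxx IH.
Qed.

(** The step that creates the centers with index [n] on [S'] corresponds to one step on [S]
    if its pullback is nonempty, and to none otherwise. *)
Lemma run_pullback n : exists m,
  run S m = nonempty_centers [seq pullback f V | V <- run S' n].
Proof.
elim: n => [|n [m mE]].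
  exists 0%N; pose M := (maxn (maxrk S) (maxrk S')).+1.
  rewrite /run /= (@phase1E S M) ?ltnS ?leq_maxl // (@phase1E S' M) ?ltnS ?leq_maxr //.
  rewrite pullback_nonempty_centers -map_comp; congr nonempty_centers.
  by apply: eq_map => k /=; rewrite sing_bary_pullback.
rewrite /run iterS -/(run S' n) /step.
have [_|ne] := eqVneq (next (run S' n)) set0; first by exists m.
rewrite map_rcons /nonempty_centers filter_rcons -/(nonempty_centers _).
have [e|ne'] := eqVneq (pullback f (next (run S' n))) set0; first by exists m.
have [adm' _] := run_simplicial S' n; have [adm _] := run_simplicial S m.
have irr p : cand [seq pullback f V | V <- run S' n] p -> irreducible (cone (tag p)).
  by rewrite /cand -loc_nonempty -mE; apply: cand_irreducible.
have nE : next (run S m) = pullback f (next (run S' n)).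
  rewrite mE next_nonempty_centers next_pullback //; exact/set0P.
by exists m.+1; rewrite /run iterS -/(run S m) /step nE (negPf ne') mE.
Qed.

Lemma desing_pullback :
  desing S = nonempty_centers [seq pullback f V | V <- desing S'].
Proof.
have [m mE] : exists m, run S m = nonempty_centers [seq pullback f V | V <- desing S'].
  exact: run_pullback.
rewrite -mE; apply/esym/desing_unique.
have [adm' _] := desing_simplicial S'; have [adm _] := run_simplicial S m.
have irr p : cand [seq pullback f V | V <- desing S'] p -> irreducible (cone (tag p)).
  by rewrite /cand -loc_nonempty -mE; apply: cand_irreducible.
have c0 : cand (desing S') = set0.
  apply/seteqP; split=> // p cp.
  have := next_nonempty (desing_simplicial S') (ex_intro _ p cp).
  by rewrite desing_next => -[].
rewrite mE next_nonempty_centers; apply/seteqP; split=> // p /next_cand.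
by rewrite cand_pullback // c0 pullback0.
Qed.

End DesingPullback.

(** * The desingularization *)

Section MinimalIrreducible.
Variable n : nat.
Implicit Types (C A B : set 'rV[rat]_n) (p x : 'rV[rat]_n).

(** For a cone [A] x [B] with [B] regular, an interior minimal point cannot have
    components along both factors, so it lies in [B], which is then the whole cone;
    but regular cones have no minimal points. *)
Lemma minimal_relint_irreducible C p : cvx C -> strictly_convex C -> relint C p ->
  minimal_point C p -> irreducible C.
Proof.
move=> cC sC rp mp [A [B [[rA rB CE dir lat] regB B0]]].
have [Cp ip p0 _ dec] := mp.
have cA := fg_cvx (rational_fg rA); have cB := fg_cvx (rational_fg rB).
have [A0 AD AZ] := cA; have [B0' BD BZ] := cB.
have AC : A `<=` C by move=> x Ax; rewrite CE; exists x => //; exists 0; rewrite ?addr0.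
have BC : B `<=` C by move=> x Bx; rewrite CE; exists 0 => //; exists x; rewrite ?add0r.
have lD D x y : cvx D -> lspan D x -> lspan D y -> lspan D (x - y).
  move=> [_ DD _] [a Da [b Db <-]] [c Dc [d Dd <-]].
  exists (a + d); first exact: DD.
  exists (b + c); first exact: DD.
  by rewrite opprB !opprD !addrA; congr (_ - _); rewrite addrAC.
(* The spans of the two factors are independent. *)
have uniq a b a' b' : lspan A a -> lspan B b -> lspan A a' -> lspan B b' ->
    a + b = a' + b' -> a = a' /\ b = b'.
  move=> la lb la' lb' e.
  have ab : a - a' = b' - b.
    by apply/eqP; rewrite subr_eq addrAC eq_sym subr_eq addrC e addrC.
  have : (lspan A `&` lspan B) (a - a').
    by split; [apply: lD|rewrite ab; apply: lD].
  rewrite dir => /= z; split; first exact: subr0_eq.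
  by apply/esym/subr0_eq; rewrite -ab.
have [a [ia la] [b [ib lb] abp]] : msum (lattice A) (lattice B) p.
  by rewrite -lat; split=> //; apply: cvx_lspan.
have [Aa Bb] : A a /\ B b.
  move: Cp; rewrite CE => -[a' Aa' [b' Bb' e]].
  have [-> ->] := uniq a b a' b' la lb (cvx_lspan cA Aa') (cvx_lspan cB Bb')
    (etrans abp (esym e)).
  by [].
have [a0|a0] := eqVneq a 0; last first.
  have [b0|b0] := eqVneq b 0; last first.
    by apply: dec; exists a, b; split; split=> //; [apply: AC|apply: BC].
  have [y By y0] : exists2 y, B y & y != 0.
    apply: contrapT => h; apply: B0; apply/seteqP; split=> y; last by move=> ->.
    by move=> By; apply/eqP/negPn/negP => y0; apply: h; exists y.
  have [e e0 he] := relint_sub cC rp (BC _ By).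
  move: he; rewrite CE => -[a' Aa' [b' Bb' E]].
  have E2 : a + 0 = a' + (b' + e *: y) by rewrite addrA E -abp b0 subrK.
  have [_ bz] := uniq _ _ _ _ la (cvx_lspan cB B0') (cvx_lspan cA Aa')
    (cvx_lspan cB (BD _ _ Bb' (BZ _ _ (ltW e0) By))) E2.
  have : e *: y = 0.
    apply: sC; first by apply/BC/BZ => //; apply: ltW.
    by rewrite -[- _]addr0 bz addrC addrK; apply: BC.
  by move/eqP; rewrite scaler_eq0 gt_eqF // (negPf y0).
have pb : p = b by rewrite -abp a0 add0r.
have CB : C = B.
  apply/seteqP; split=> // z Cz.
  have [e e0 he] := relint_sub cC rp Cz; move: (Cz) he.
  rewrite {1 2}CE => -[za Aza [zb Bzb zE]] [a' Aa' [b' Bb' E]].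
  have E2 : 0 + p = (a' + e *: za) + (b' + e *: zb).
    by rewrite add0r addrACA E -scalerDr zE subrK.
  have [az _] := uniq _ _ _ _ (cvx_lspan cA A0) (eq_ind_r (lspan B) lb pb)
    (cvx_lspan cA (AD _ _ Aa' (AZ _ _ (ltW e0) Aza)))
    (cvx_lspan cB (BD _ _ Bb' (BZ _ _ (ltW e0) Bzb))) E2.
  have : e *: za = 0.
    apply: sC; first by apply/AC/AZ => //; apply: ltW.
    by rewrite -[- _]addr0 az addrC addrK; apply: AC.
  move/eqP; rewrite scaler_eq0 gt_eqF //= => /eqP za0.
  by rewrite -zE za0 add0r.
have /regularP[l ul lE] := regB.
by apply: (unimod_no_minimal ul (x := p)); rewrite -lE -CB.
Qed.

End MinimalIrreducible.

Section Stages.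
Variable S : conical_complex.
Implicit Types (s : S) (p : cpoint S) (V : set (cpoint S)) (Vs : seq (set (cpoint S))).

Definition good_stage Vs V : Prop :=
  (forall p, V p -> in_irreducible_face (cells (loc Vs)) p) /\
  ((forall p, V p -> is_minimal_point (cells (loc Vs)) p) \/
   (forall p, V p -> is_irreducible_barycenter (cells (loc Vs)) p)).

Lemma cell_points_intro p (C A : set 'rV[rat]_(crk (tag p))) : A (tagged p) ->
  cell_points (c := existT _ (tag p) C) A p.
Proof. by case: p C A => s x C A Ax; exists x. Qed.

Lemma next_good_stage Vs : simplicial_inv Vs -> good_stage Vs (next Vs).
Proof.
move=> [adm _]; have cP := admissible_coherent adm; have [fP sub _] := cP.
have h p : next Vs p -> exists C, [/\ cells (loc Vs) (existT _ (tag p) C),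
    relint C (tagged p), minimal_point C (tagged p) & irreducible C].
  move=> /next_cand[rp [C [lC rC mC]]]; exists C; split=> //.
    exact: cells_intro.
  have [rat _ _] := fP (tag p).
  apply: (minimal_relint_irreducible (fg_cvx (rational_fg (rat _ lC))) _ rC mC).
  move=> x Cx Cnx.
  by apply: (@cone_strictly_convex _ (tag p)); apply: (sub _ _ lC).
split; last left; move=> p /h[C [KC rC mC iC]]; exists (existT _ (tag p) C) => //.
  exact: cell_int_intro.
exact: cell_points_intro.
Qed.

Lemma bary_good_stage k Vs : bary_inv k.+1 Vs -> good_stage Vs (sing_bary k).
Proof.
move=> inv; have [adm _ _] := inv; have cP := admissible_coherent adm.
have h p : sing_bary k p -> cells (loc Vs) (to_cell (tag p)).
  move=> bp; have [_ kp _] := bp; have rp := bary_relint bp.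
  apply: cells_intro => //; rewrite (bary_inv_untouched inv); first exact: face_refl.
  by rewrite kp.
split; last right; move=> p bp; have [sp _ pp] := bp;
  exists (to_cell (tag p)); try by split; [exact: h|case: sp].
  by apply: cell_int_intro; apply: bary_relint bp.
exact: cell_points_intro.
Qed.

Lemma phase1_good : stagewise good_stage (phase1 S).
Proof.
suff h m Vs : bary_inv m Vs -> stagewise good_stage Vs -> stagewise good_stage
    (Vs ++ nonempty_centers [seq @sing_bary S k | k <- rev (iota 0 m)]).
  exact: (h _ _ (@bary_inv_init S)).
elim: m Vs => [|m IH] Vs inv good; first by rewrite cats0.
rewrite -addn1 iotaD rev_cat map_cat /nonempty_centers filter_cat /= add0n.
have [e0|_] /= := eqVneq (@sing_bary S m) set0; first exact/IH/good/bary_skip.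
rewrite -cat_rcons; apply: IH; first exact: bary_step.
by apply/stagewise_rcons; split=> //; apply: bary_good_stage.
Qed.

Lemma desing_good : stagewise good_stage (desing S).
Proof.
rewrite /desing; elim: (sval _) => [|n IH]; first exact: phase1_good.
rewrite /run iterS -/(run S n) /step; case: ifP => // _.
by apply/stagewise_rcons; split=> //; apply/next_good_stage/run_simplicial.
Qed.

Lemma desing_nonempty V : V \in desing S -> V !=set0.
Proof.
move=> VS; apply/set0P; move: V VS; apply/allP; rewrite /desing.
elim: (sval _) => [|n IH]; first exact: filter_all.
rewrite /run iterS -/(run S n) /step; case: ifP => //= ne.
by rewrite all_rcons ne IH.
Qed.

Lemma desing_regular s C : loc (desing S) s C -> regular C.
Proof.
move=> lC; apply: contrapT => nreg; have inv := desing_simplicial S.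
have := next_nonempty inv (cand_exists inv lC nreg).
by rewrite desing_next => -[].
Qed.

End Stages.

Local Close Scope ring_scope.

Theorem theorem4p6p1 :
  exists desing : forall S : conical_complex, seq (set (cpoint S)),
    (forall S : conical_complex,
       [/\ is_desingularization (desing S),
           (forall i, (i < size (desing S))%N ->
              nth set0 (desing S) i `<=` support_of (sing S) /\
              forall p, nth set0 (desing S) i p ->
                in_irreducible_face (subdivided (desing S) i) p),
           (forall i, (i < size (desing S))%N ->
              (forall p, nth set0 (desing S) i p ->
                 is_minimal_point (subdivided (desing S) i) p) \/
              (forall p, nth set0 (desing S) i p ->
                 is_irreducible_barycenter (subdivided (desing S) i) p)) &
           (forall s : S, Reg S s ->
              subdivided (desing S) (size (desing S)) (to_cell s))]) /\
    (forall (S S' : conical_complex) (f : cmap S S'),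
       local_isomorphism f \/ regular_local_projection f ->
       desing S = [seq V <- map (pullback f) (desing S') | V != set0]) /\
    (forall (S S' : conical_complex) (f : cmap S S'),
       local_isomorphism f -> surjective_cmap f ->
       desing S = map (pullback f) (desing S')).
Proof.
exists desing; split; last split.
- move=> S; have inv := desing_simplicial S; have [adm _] := inv.
  have good := @desing_good S.
  split.
  + split=> [i iS|c].
      rewrite subdividedE //; apply: centered_is_center; first exact: admissible_take.
      exact: adm.
    rewrite subdividedE // take_size => -[lc _]; exact: desing_regular lc.
  + move=> i iS; rewrite subdividedE //; have [h _] := good i iS; split=> //.
    by have [_ sV _ _ _] := adm i iS.
  + by move=> i iS; rewrite subdividedE //; have [_ h] := good i iS.
  move=> s rs; rewrite subdividedE // take_size; split=> //=.
  by rewrite loc_regular //; apply: face_refl.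
- by move=> S S' f /local_isomorphism_irreducible; apply: desing_pullback.
move=> S S' f iso sur.
rewrite (desing_pullback (local_isomorphism_irreducible (or_introl iso))).
apply/all_filterP/allP => _ /mapP[V VS ->]; apply/set0P.
have [adm _] := desing_simplicial S'; have [sV _ _ _] := admissible_center adm VS.
have [p Vp] := desing_nonempty VS.
have [q sq qp] := sur p (conj I (sV p Vp).2).
by exists q; split=> //; rewrite qp.
Qed.
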